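(* Let $f$ be a meromorphic function in $\mathbb{C}$ of finite $\varphi$-order $\rho_{\varphi}(f)$ such that $\mathcal{D}_q f\not\equiv 0$. Let $\varepsilon>0$, and denote $|x|=r$. (a) If $\limsup_{r\to\infty}\frac{s(r)}{r}=\infty$ and if $s(r)$ is convex and differentiable, then $$m\left(r,\frac{\mathcal{D}_q f(x)}{f(x)}\right)=O\left(\frac{\varphi(s(r))^{\rho_\varphi(f)+\frac{\varepsilon}{2}}}{\log\frac{s(r)}{r}}+1\right)=O\left(\varphi(s(r))^{\rho_\varphi(f)-\alpha_{\varphi,s}\gamma_{\varphi,s}+\varepsilon}\right).$$ (b) If $\limsup_{r\to\infty}\frac{s(r)}{r}<\infty$ and if $\varphi(r)$ is subadditive, then $$m\left(r,\frac{\mathcal{D}_q f(x)}{f(x)}\right)=O\left(\varphi(r)^{\rho_\varphi(f)+\varepsilon}\right).$$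
   Context: ''$g(r)\le h(r)$ for $r\ge R_0$'' means that the inequality holds for all sufficiently large $r$; the $O$-estimates are as $r\to\infty$. ''Meromorphic'' means meromorphic in $\mathbb{C}$; $T(r,f)$ and $m(r,f)$ are the Nevanlinna characteristic and the proximity function. The growth functions $\varphi$ and $s$. Throughout, $\varphi:(R_0,\infty)\to(0,\infty)$ is a non-decreasing unbounded function with $\log r\le\varphi(r)\le r$ for $r\ge R_0$. It is called subadditive if $\varphi(a+b)\le\varphi(a)+\varphi(b)$ for all $a,b\ge R_0$. Throughout, $s:(R_0,\infty)\to(0,\infty)$ is a non-decreasing function with $r<s(r)\le r^2$ for $r\ge R_0$ and $\liminf_{r\to\infty}s(r)/r>1$. The $\varphi$-order of a meromorphic function $f$ is $$\rho_\varphi(f)=\limsup_{r\to\infty}\frac{\log T(r,f)}{\log\varphi(r)}.$$ Growth parameters: $$\alpha_{\varphi,s}=\liminf_{r\to\infty}\frac{\log\varphi(r)}{\log\varphi(s(r))}\in[0,1],\qquad \gamma_{\varphi,s}=\liminf_{r\to\infty}\frac{\log\log\frac{s(r)}{r}}{\log\varphi(r)}\in[0,1].$$ Askey-Wilson operator. Fix $q\in\mathbb{C}$ with $0<|q|<1$ (and a value of $q^{1/2}$). For $x\in\mathbb{C}$ write $x=(z+1/z)/2$ with $z=x+\sqrt{x^2-1}$ (a fixed branch, so that each $x$ determines a unique $z$), and set $$\hat{x}=\frac{q^{1/2}z+q^{-1/2}z^{-1}}{2},\qquad \check{x}=\frac{q^{-1/2}z+q^{1/2}z^{-1}}{2}.$$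 For a meromorphic function $f$ the Askey-Wilson divided difference operator is $$(\mathcal{D}_qf)(x)=\frac{f(\hat{x})-f(\check{x})}{\hat{x}-\check{x}}\quad (x\ne\pm1),\qquad (\mathcal{D}_qf)(\pm1)=\lim_{x\to\pm1,\ x\neq\pm1}(\mathcal{D}_qf)(x)=f'\big(\pm(q^{1/2}+q^{-1/2})/2\big).$$ Here $\hat x-\check x=(q^{1/2}-q^{-1/2})(z-1/z)/2$. The function $\mathcal{D}_qf$ is again meromorphic in $\mathbb{C}$. *)

(* Defs.v *)
From HB Require Import structures.
From mathcomp Require Export all_boot all_order all_algebra.
From mathcomp Require Export all_classical all_reals all_analysis.
From mathcomp Require Export complex.
Set Implicit Arguments.
Unset Strict Implicit.
Unset Printing Implicit Defensive.
Export Order.TTheory GRing.Theory Num.Theory.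
Export numFieldNormedType.Exports.
Local Open Scope classical_set_scope.
Local Open Scope complex_scope.
Local Open Scope ring_scope.

(* The Landau notation f =O_ (+oo_R) g needs +oo as a canonical filter_on.     *)
Canonical pinfty_filter_on (R : numFieldType) : filter_on R :=
  FilterType (pinfty_nbhs R) _.

(* The complex plane is R[i]^o, i.e. R[i] as a normed module over itself, so   *)
(* that derivable _ _ 1 is complex differentiability. The norm `|z| of R[i]    *)
(* takes its values in R[i]; the real modulus is Normc.normc.                  *)

Definition holomorphic_at (R : realType) (f : R[i]^o -> R[i]^o) (p : R[i]^o) :=
  \forall z \near p, derivable f z 1.

(* f has at p at most a pole of order n; the value f p itself is irrelevant.   *)
Definition pole_order_le (R : realType) (f : R[i]^o -> R[i]^o) (p : R[i]^o)
    (n : nat) :=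
  exists g : R[i]^o -> R[i]^o, holomorphic_at g p /\
    \forall z \near p^', f z = g z / (z - p) ^+ n.

(* Meromorphic functions are represented by total functions whose values at    *)
(* poles (more generally, on a closed discrete set) are arbitrary. Pole orders *)
(* and the integrals over circles do not depend on these values.               *)
Definition meromorphic (R : realType) (f : R[i]^o -> R[i]^o) :=
  forall p, exists n, pole_order_le f p n.

(* f vanishes identically as a meromorphic function, i.e. away from the        *)
(* isolated points where its value is arbitrary.                               *)
Definition meromorphic_eq0 (R : realType) (f : R[i]^o -> R[i]^o) :=
  forall p : R[i]^o, \forall z \near p^', f z = 0.

Definition pole_order (R : realType) (f : R[i]^o -> R[i]^o) (p : R[i]^o) : nat :=
  xget 0%N [set n | pole_order_le f p n /\
                    forall k, pole_order_le f p k -> (n <= k)%N].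

(* n(t, f): the number of poles in |z| <= t, with multiplicity. The \in sum is *)
(* a sum over the support, which is finite when f is meromorphic.              *)
Definition pole_count (R : realType) (f : R[i]^o -> R[i]^o) (t : R) : R :=
  \sum_(p \in [set p : R[i]^o | Normc.normc p <= t]) ((pole_order f p)%:R : R).

(* N(r, f) *)
Definition pole_counting (R : realType) (f : R[i]^o -> R[i]^o) (r : R) : R :=
  \int[lebesgue_measure]_(t in `[0, r]) ((pole_count f t - pole_count f 0) / t)
  + pole_count f 0 * ln r.

Definition log_plus (R : realType) (x : R) : R := Num.max 0 (ln x).

(* m(r, f); log_plus vanishes at 0 since ln 0 = 0.                             *)
Definition proximity (R : realType) (r : R) (f : R[i]^o -> R[i]^o) : R :=
  (2 * pi)^-1 * \int[lebesgue_measure]_(t in `[0, 2 * pi])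
    log_plus (Normc.normc (f ((r * cos t) +i* (r * sin t)))).

(* T(r, f) *)
Definition characteristic (R : realType) (r : R) (f : R[i]^o -> R[i]^o) : R :=
  proximity r f + pole_counting f r.

(* phi and s live on ]R0, +oo[; their values on ]-oo, R0] are never used.      *)
Definition admissible_phi (R : realType) (R0 : R) (phi : R -> R) :=
  [/\ forall r, R0 < r -> 0 < phi r,
      forall r r', R0 < r -> r <= r' -> phi r <= phi r',
      forall M, exists2 r, R0 < r & M < phi r
    & \forall r \near +oo, ln r <= phi r <= r].

Definition admissible_s (R : realType) (R0 : R) (s : R -> R) :=
  [/\ forall r, R0 < r -> 0 < s r,
      forall r r', R0 < r -> r <= r' -> s r <= s r',
      \forall r \near +oo, r < s r <= r ^+ 2
    & (1 < limf_einf (fun r : R => (s r / r)%:E) +oo%R)%E].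

Definition subadditive_near_oo (R : realType) (phi : R -> R) :=
  exists A : R, forall a b, A <= a -> A <= b -> phi (a + b) <= phi a + phi b.

Definition phi_order (R : realType) (phi : R -> R) (f : R[i]^o -> R[i]^o)
    : \bar R :=
  limf_esup (fun r : R => (ln (characteristic r f) / ln (phi r))%:E) +oo.

(* Both lower limits lie in [0, 1] when phi and s are admissible, so that fine *)
(* only forgets the extended-real type.                                        *)
Definition alpha_growth (R : realType) (phi s : R -> R) : R :=
  fine (limf_einf (fun r : R => (ln (phi r) / ln (phi (s r)))%:E) +oo).

Definition gamma_growth (R : realType) (phi s : R -> R) : R :=
  fine (limf_einf (fun r : R => (ln (ln (s r / r)) / ln (phi r))%:E) +oo).

(* zeta is a branch of z = x + sqrt (x ^ 2 - 1), a root of z + 1 / z = 2 x.    *)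
Definition joukowski_branch (R : realType) (zeta : R[i]^o -> R[i]^o) :=
  forall x, (zeta x - x) ^+ 2 = x ^+ 2 - 1.

(* qh is the chosen value of q ^ (1/2).                                        *)
Definition aw_hat (R : realType) (qh : R[i]) (zeta : R[i]^o -> R[i]^o)
    (x : R[i]^o) : R[i]^o :=
  (qh * zeta x + qh^-1 * (zeta x)^-1) / 2.

Definition aw_check (R : realType) (qh : R[i]) (zeta : R[i]^o -> R[i]^o)
    (x : R[i]^o) : R[i]^o :=
  (qh^-1 * zeta x + qh * (zeta x)^-1) / 2.

Definition aw_quotient (R : realType) (qh : R[i]) (zeta : R[i]^o -> R[i]^o)
    (f : R[i]^o -> R[i]^o) (x : R[i]^o) : R[i]^o :=
  (f (aw_hat qh zeta x) - f (aw_check qh zeta x))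
  / (aw_hat qh zeta x - aw_check qh zeta x).

Definition askey_wilson (R : realType) (qh : R[i]) (zeta : R[i]^o -> R[i]^o)
    (f : R[i]^o -> R[i]^o) (x : R[i]^o) : R[i]^o :=
  if (x == 1) || (x == -1) then lim (aw_quotient qh zeta f y @[y --> x^'])
  else aw_quotient qh zeta f x.

(* Main.v *)
Require Import Defs.
From mathcomp Require Import ring lra zify measurable_realfun.
Local Open Scope classical_set_scope.
Local Open Scope complex_scope.
Local Open Scope ring_scope.

(** The difference quotient is bounded, at each point [x] of the circle
    [|x| = r], by a Poisson-Jensen representation of [log |f|] in a disc
    [|z| < S] with [S >= 2 K r], where [K] bounds [|x^| / |x|] and
    [|x_| / |x|] for the two shifted points [x^] and [x_].  The regular part
    contributes [O((r / S) T(S, f))]; a zero or pole [p] contributes logarithms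
    of [|x^ - p| / |x - p|], which are controlled in both directions through
    [(x^ - p) (x_ - p) = (x - p^) (x - p_)], so that only logarithmic poles at
    the points [p], [p^] and [p_] of the circle variable occur.  These have
    uniformly bounded mean, whence
      [m(r, D_q f / f) <= C ((r / S) (T(S) + 1) + (T(R) + 1) / log (R / S) + 1)]
    because there are at most [(2 T(R) + O(1)) / log (R / S)] zeros and poles in
    [|z| < S].  Part (a) takes [S ~ sqrt (r s(r))] and [R ~ s(r)], part (b) takes
    [S] and [R] comparable to [r].  The second estimate of (a) also needs
    [rho >= gamma], which follows from [T(r, f) >= log r - O(1)].

    Radii [S], [R] are chosen off the moduli of the zeros, poles and irregular
    points of [f]; this is possible in every interval. *)

Set Implicit Arguments.
Unset Strict Implicit.
Unset Printing Implicit Defensive.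

(** The obstacle is that the branch [zeta] is arbitrary, possibly discontinuous or non-measurable,
    so [log |x^ - p|] cannot be studied directly as a function of the angle. Exchanging [zeta x] and
    [1 / zeta x] swaps [x^] and [x_], so the product [(x^ - p) (x_ - p)] is a polynomial in [x]; it
    bounds one factor from below once the other is bounded from above. The factor [r / S] comes from
    the difference of two Cauchy kernels on [|z| = S], and [1 / log (R / S)] from counting zeros and
    poles of the disc [|z| < S] by Jensen's formula in the larger disc. The geometric mean balances
    the two: with [y = sqrt (s(r) / r)], [r / S] is about [1 / y] and [R / S] about [y], so both
    coefficients are [O(1 / log y)]. Since [S] must also exceed [2 K r], the quotient [s(r) / r] has
    to be large for every large [r] and not only along a sequence; this is what convexity of [s]
    supplies. The bound [rho >= gamma] makes the final exponent positive, so that it absorbs the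
    summand [1]. *)

Local Notation N := Normc.normc.

(** * Derivatives and integrals of functions into the complex plane *)

Section ContAlg.
Context {K : numFieldType} {T : topologicalType}.
Implicit Types (f g : T -> K^o) (t : T).
Lemma contD f g t : {for t, continuous f} -> {for t, continuous g} ->
  {for t, continuous (fun u => f u + g u : K^o)}.
Proof. move=> cf cg; exact: (cvgD cf cg). Qed.
Lemma contM f g t : {for t, continuous f} -> {for t, continuous g} ->
  {for t, continuous (fun u => f u * g u : K^o)}.
Proof. move=> cf cg; exact: (cvgM cf cg). Qed.
Lemma contK (c : K^o) t : {for t, continuous (fun=> c)}.
Proof. exact: cst_continuous. Qed.
Lemma contN f t : {for t, continuous f} -> {for t, continuous (fun u => - f u : K^o)}.
Proof. move=> cf; exact: (cvgN cf). Qed.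
Lemma contB f g t : {for t, continuous f} -> {for t, continuous g} ->
  {for t, continuous (fun u => f u - g u : K^o)}.
Proof. move=> cf cg; exact: (cvgB cf cg). Qed.
Lemma contV f t : f t != 0 -> {for t, continuous f} ->
  {for t, continuous (fun u => (f u)^-1 : K^o)}.
Proof. move=> f0 cf; exact: (cvgV f0 cf). Qed.
End ContAlg.

Section Modulus.
Context {R : realType}.
Implicit Types z w : R[i]^o.

Lemma NE z : `|z| = (N z)%:C :> R[i]. Proof. by []. Qed.

Lemma N_ge0 z : 0 <= N z.
Proof. by case: z => a b /=; rewrite sqrtr_ge0. Qed.

Lemma ND z w : N (z + w) <= N z + N w. Proof. exact: (@le_normcD R). Qed.
Lemma NN z : N (- z) = N z. Proof. exact: (@normcN R). Qed.
Lemma NB z w : N (z - w) <= N z + N w. Proof. by rewrite -(NN w) ND. Qed.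
Lemma NBC z w : N (z - w) = N (w - z). Proof. by rewrite -NN opprB. Qed.
Lemma NB_le z w : N z - N w <= N (z - w).
Proof. by rewrite lerBlDr; have := ND (z - w) w; rewrite subrK. Qed.
Lemma N_eq0 z : (N z == 0) = (z == 0).
Proof. apply/eqP/eqP => [/Normc.eq0_normc//|->]. exact: Normc.normc0. Qed.
Lemma N_gt0 z : (0 < N z) = (z != 0).
Proof. by rewrite lt_neqAle eq_sym N_eq0 N_ge0 andbT. Qed.
Lemma NX z n : N (z ^+ n) = N z ^+ n.
Proof. elim: n => [|n IH]; first by rewrite !expr0 Normc.normc1. by rewrite !exprS Normc.normcM IH. Qed.
Lemma NR (x : R) : N x%:C = `|x|.
Proof. by rewrite /= expr0n /= addr0 sqrtr_sqr. Qed.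
Lemma N_Re z : `|complex.Re z| <= N z.
Proof. by case: z => a b /=; rewrite -sqrtr_sqr ler_wsqrtr // lerDl sqr_ge0. Qed.
Lemma N_Im z : `|complex.Im z| <= N z.
Proof. by case: z => a b /=; rewrite -[`|b|]sqrtr_sqr ler_wsqrtr // lerDr sqr_ge0. Qed.
Lemma N_ReIm z : N z <= `|complex.Re z| + `|complex.Im z|.
Proof.
case: z => a b /=; rewrite -[leRHS]ger0_norm ?addr_ge0// -[leRHS]sqrtr_sqr ler_wsqrtr//.
rewrite sqrrD !real_normK ?num_real// -addrA lerD2l lerDr.
by rewrite mulrn_wge0// mulr_ge0.
Qed.
Lemma N_conj z : N (z^*) = N z.
Proof. by case: z => a b /=; rewrite sqrrN. Qed.

(** Balls of [R[i]] have radii in [R[i]], but positivity of such a radius forces its imaginary part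
    to vanish. Real radii thus give the same filter, and the epsilon-delta arguments below stay in
    [R]. *)
Lemma nbhsN z (P : set R[i]) :
  nbhs (z : R[i]^o) P <-> exists2 d : R, 0 < d & forall w, N (w - z) < d -> P w.
Proof.
split => [/nbhs_ballP [e /= e0 H]|[d d0 H]].
  exists (complex.Re e); first by move: e0; rewrite ltcE => /andP[].
  move=> w hw; apply: H; rewrite -ball_normE /= distrC NE ltcE /=.
  by move: e0; rewrite ltcE /= => /andP[/eqP -> _]; rewrite eqxx.
apply/nbhs_ballP; exists d%:C => /=; first by rewrite ltcR.
by move=> w; rewrite -ball_normE /= distrC NE ltcR => /H.
Qed.

Lemma contCP (f : R[i]^o -> R[i]^o) z : {for z, continuous f} <->
  forall e : R, 0 < e -> exists2 d : R, 0 < d & forall w, N (w - z) < d -> N (f w - f z) < e.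
Proof.
split => [H e e0|H].
  have /nbhsN [d d0 hd] : nbhs (z : R[i]^o) (f @^-1` [set v | N (v - f z) < e]).
    by apply: H; apply/nbhsN; exists e.
  by exists d.
by move=> A /nbhsN[e e0 he]; have [d d0 hd] := H e e0; apply/nbhsN; exists d => // w /hd /he.
Qed.

Lemma contRCP (f : R -> R[i]^o) t : {for t, continuous f} <->
  forall e : R, 0 < e -> exists2 d : R, 0 < d & forall u, `|u - t| < d -> N (f u - f t) < e.
Proof.
split => [H e e0|H].
  have /nbhs_ballP : nbhs t (f @^-1` [set v | N (v - f t) < e]).
    by apply: H; apply/nbhsN; exists e.
  move=> [d /= d0 hd]; exists d => // u hu; apply: hd.
  by rewrite -ball_normE /= distrC.
move=> A /nbhsN[e e0 he]; have [d d0 hd] := H e e0; apply/nbhs_ballP; exists d => //= u.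
by rewrite -ball_normE /= distrC => /hd /he.
Qed.

Lemma contCRP (f : R[i]^o -> R) z : {for z, continuous f} <->
  forall e : R, 0 < e -> exists2 d : R, 0 < d & forall w, N (w - z) < d -> `|f w - f z| < e.
Proof.
split => [H e e0|H].
  have /nbhsN [d d0 hd] : nbhs (z : R[i]^o) (f @^-1` [set v | `|v - f z| < e]).
    by apply: H; apply/nbhs_ballP; exists e => //= v; rewrite -ball_normE /= distrC.
  by exists d.
move=> A /nbhs_ballP[e /= e0 he]; have [d d0 hd] := H e e0; apply/nbhsN; exists d => // w /hd h.
by apply: he; rewrite -ball_normE /= distrC.
Qed.

Lemma N_cont z : {for z, continuous (@Normc.normc R : R[i]^o -> R)}.
Proof.
apply/contCRP => e e0; exists e => // w; apply: le_lt_trans.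
by rewrite ler_norml lerNl opprB NBC NB_le/= NBC NB_le.
Qed.
Lemma Re_cont z : {for z, continuous (@complex.Re R : R[i]^o -> R)}.
Proof.
apply/contCRP => e e0; exists e => // w; apply: le_lt_trans.
by rewrite -raddfB N_Re.
Qed.
Lemma Im_cont z : {for z, continuous (@complex.Im R : R[i]^o -> R)}.
Proof.
apply/contCRP => e e0; exists e => // w; apply: le_lt_trans.
by rewrite -raddfB N_Im.
Qed.
Lemma ofR_cont t : {for t, continuous (fun x : R => x%:C : R[i]^o)}.
Proof.
by apply/contRCP => e e0; exists e => // w; rewrite -rmorphB NR.
Qed.
Lemma Complex_cont (f g : R -> R) t : {for t, continuous f} -> {for t, continuous g} ->
 {for t, continuous (fun u => (f u +i* g u)%C : R[i]^o)}.
Proof.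
move=> cf cg.
rewrite (_ : (fun u => _) = (fun u => ((f u)%:C + 'i * (g u)%:C : R[i]^o))); last first.
  by apply/funext => u; rewrite [LHS]complexE.
apply: contD; first by apply: continuous_comp; [exact: cf|exact: ofR_cont].
apply: contM; first exact: contK.
by apply: continuous_comp; [exact: cg|exact: ofR_cont].
Qed.
End Modulus.

Section Derivative.
Context {R : realType}.
Implicit Types z w : R[i]^o.

(* Caratheodory's form of differentiability avoids quotients, so that sums,
   products and compositions reduce to ring identities. *)
Definition cderiv (F : R[i]^o -> R[i]^o) z l := exists phi : R[i]^o -> R[i]^o,
  [/\ phi z = l, {for z, continuous phi} & forall w, F w = F z + phi w * (w - z)].
Definition rderiv (g : R -> R[i]^o) t l := exists phi : R -> R[i]^o,
  [/\ phi t = l, {for t, continuous phi} & forall u, g u = g t + phi u * (u - t)%:C].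

Lemma near_contC (f g : R[i]^o -> R[i]^o) z : (\forall w \near (z:R[i]^o), f w = g w) ->
  {for z, continuous f} -> {for z, continuous g}.
Proof.
move=> H /contCP cf; apply/contCP => e e0; have fz := nbhs_singleton H.
move/nbhsN : H => [d d0 hd]; have [d' d'0 hd'] := cf e e0.
exists (Num.min d d'); first by rewrite lt_min d0.
by move=> w; rewrite lt_min => /andP[h1 h2]; rewrite -fz -hd//; exact: hd'.
Qed.

Lemma cderivP F z l : cderiv F z l <-> (forall e : R, 0 < e -> exists2 d : R, 0 < d &
  forall w, N (w - z) < d -> N (F w - F z - l * (w - z)) <= e * N (w - z)).
Proof.
split => [[phi [pl /contCP cp Fp]] e e0|H].
  have [d d0 hd] := cp e e0; exists d => // w hw.
  rewrite (_ : _ - l * _ = (phi w - phi z) * (w - z)); last by rewrite Fp pl; ring.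
  rewrite Normc.normcM.
  by rewrite ler_wpM2r ?N_ge0// ltW// hd.
exists (fun w => if w == z then l else (F w - F z) / (w - z)); split; first by rewrite eqxx.
  (* Halving [e] turns the weak bound of the hypothesis into the strict one required by
     continuity. *)
  apply/contCP => e e0; have [d d0 hd] := H (e/2) (divr_gt0 e0 (ltr0n _ 2)).
  exists d => // w hw; rewrite eqxx.
  case: (eqVneq w z) => [_|wz]; first by rewrite subrr Normc.normc0.
  have wz0 : w - z != 0 by rewrite subr_eq0.
  rewrite (_ : _ - l = (F w - F z - l * (w - z)) / (w - z)); last by field.
  rewrite Normc.normcM Normc.normcV ltr_pdivrMr ?N_gt0//.
  apply: le_lt_trans (hd w hw) _; rewrite ltr_pM2r ?N_gt0//.
  by rewrite ltr_pdivrMr// ltr_pMr// ltr1n.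
move=> w; case: (eqVneq w z) => [->|wz]; first by rewrite subrr mulr0 addr0.
by rewrite divfK ?subr_eq0// addrC subrK.
Qed.

Lemma derivableP F z : derivable (F : R[i]^o -> R[i]^o) z 1 <-> exists l, cderiv F z l.
Proof.
split => [|[l [phi [pl cp Fp]]]].
  move=> /cvg_ex [l hl]; exists l; apply/cderivP => e e0.
  have /nbhsN [d d0 hd] : nbhs (0:R[i]^o) [set h : R[i]^o | h != 0 -> N ((h^-1 *: (F (h *: (1:R[i]^o) + z) - F z)) - l) < e].
    have H : nbhs l [set v : R[i]^o | N (v - l) < e] by apply/nbhsN; exists e.
    exact: (hl _ H).
  exists d => // w hw; have [->|wz] := eqVneq w z.
    by rewrite !subrr mulr0 subrr Normc.normc0 mulr0.
  have wz0 : w - z != 0 by rewrite subr_eq0.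
  have := hd (w - z); rewrite subr0 => /(_ hw wz0).
  rewrite [(w - z) *: _]mulr1 subrK => h.
  rewrite (_ : _ - l * (w - z) = ((w - z)^-1 *: (F w - F z : R[i]^o) - l) * (w - z)); last by rewrite /GRing.scale/=; field.
  by rewrite Normc.normcM ler_wpM2r ?N_ge0// ltW.
apply/cvg_ex; exists l.
have c1 : (fun h : R[i]^o => phi (h + z)) @ (0 : R[i]^o)^' --> l.
  apply: cvg_within_filter; rewrite -pl.
  have -> : phi z = phi (0 + z) by rewrite add0r.
  apply: (@continuous_comp _ _ _ (fun h : R[i]^o => h + z : R[i]^o) phi); last by rewrite /= add0r.
  by apply: contD; [exact: cvg_id|exact: contK].
apply: cvg_trans c1; apply: near_eq_cvg; near=> h.
have h0 : h != 0 by near: h; exact: nbhs_dnbhs_neq.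
rewrite /= [h *: _]mulr1 [in RHS]Fp addrK /GRing.scale/=; field.
Unshelve. all: by end_near. Qed.

Lemma cderiv_cont F z l : cderiv F z l -> {for z, continuous F}.
Proof.
move=> [phi [pl cp Fp]].
rewrite (_ : F = (fun w => F z + phi w * (w - z))); last by apply/funext.
apply: contD; first exact: contK.
apply: contM; first exact: cp.
apply: contB; [exact: cvg_id|exact: contK].
Qed.

Lemma rderiv_cont g t l : rderiv g t l -> {for t, continuous g}.
Proof.
move=> [phi [pl cp Fp]].
rewrite (_ : g = (fun w : R => g t + phi w * (w - t)%:C)); last by apply/funext.
apply: contD; first exact: contK.
apply: contM; first exact: cp.
apply: (@continuous_comp _ _ _ (fun u : R => u - t) (fun x : R => x%:C : R[i]^o)); last exact: ofR_cont.
by apply: cvgB => //; exact: cvg_cst.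
Qed.

Lemma cderiv_near F G z l : (\forall w \near (z : R[i]^o), F w = G w) -> cderiv F z l -> cderiv G z l.
Proof.
move=> H; have e := nbhs_singleton H; move/nbhsN: H => [d d0 hd] /cderivP H; apply/cderivP => ep ep0.
have [d' d'0 hd'] := H _ ep0; exists (Num.min d d'); first by rewrite lt_min d0.
move=> w; rewrite lt_min => /andP[h1 h2]; rewrite -e -hd//; exact: hd'.
Qed.

Lemma cderiv_cst c z : cderiv (fun=> c) z 0.
Proof. exists (fun=> 0); split => //; [exact: cst_continuous|by move=> w; rewrite mul0r addr0]. Qed.
Lemma cderiv_id z : cderiv (fun w => w) z 1.
Proof. exists (fun=> 1); split => //; [exact: cst_continuous|by move=> w; rewrite mul1r addrC subrK]. Qed.
Lemma cderivD F G z l m : cderiv F z l -> cderiv G z m -> cderiv (fun w => F w + G w) z (l + m).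
Proof.
move=> [f [<- cf Ff]] [g [<- cg Gg]]; exists (fun w => f w + g w); split; [by []| |].
  exact: contD cf cg.
by move=> w; rewrite Ff Gg; ring.
Qed.
Lemma cderivM F G z l m : cderiv F z l -> cderiv G z m ->
  cderiv (fun w => F w * G w) z (l * G z + F z * m).
Proof.
move=> [f [<- cf Ff]] dG; have cG := cderiv_cont dG.
have [g [<- cg Gg]] := dG.
exists (fun w => f w * G w + F z * g w); split; [by []| |].
  have h1 := contM cf cG.
  have h2 := contM (@contK _ _ (F z) z) cg.
  apply: contD; [exact: h1|exact: h2].
by move=> w; rewrite Ff Gg; ring.
Qed.
Lemma cderivV (F : R[i]^o -> R[i]^o) z l : F z != 0 -> cderiv F z l -> cderiv (fun w => (F w)^-1) z (- l / F z ^+ 2).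
Proof.
move=> Fz0 dF; have cF := cderiv_cont dF; have [f [fl cf Ff]] := dF.
have n0 : \forall w \near (z : R[i]^o), F w != 0.
  have /contCP/(_ (N (F z))) := cF; rewrite N_gt0 => /(_ Fz0) [d d0 hd].
  apply/nbhsN; exists d => // w /hd; apply: contraTneq => ->.
  by rewrite sub0r NN ltxx.
pose phi w := if w == z then - l / F z ^+ 2 else ((F w)^-1 - (F z)^-1) / (w - z).
exists phi; split; first by rewrite /phi eqxx.
  apply: (@near_contC (fun w => - f w / (F z * F w))).
    apply: filterS n0 => w Fw0; rewrite /phi; case: (eqVneq w z) => [->|wz]; first by rewrite fl expr2.
    have wz0 : w - z != 0 by rewrite subr_eq0.
    have -> : (F w)^-1 - (F z)^-1 = (F z - F w) / (F z * F w) by field; apply/andP.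
    rewrite [X in (_ - X) / _ / _]Ff; field; by rewrite Fz0 wz0 Fw0.
  apply: contM; first exact: contN cf.
  apply: contV; first by rewrite mulf_neq0.
  by apply: contM; [exact: contK|exact: cF].
move=> w; rewrite /phi; case: (eqVneq w z) => [->|wz]; first by rewrite subrr mulr0 addr0.
by rewrite divfK ?subr_eq0// addrC subrK.
Qed.

Lemma rderiv_cst c t : rderiv (fun=> c) t 0.
Proof. exists (fun=> 0); split => //; [exact: cst_continuous|by move=> w; rewrite mul0r addr0]. Qed.
Lemma rderiv_id t : rderiv (fun u : R => u%:C) t 1.
Proof. exists (fun=> 1); split => //; [exact: cst_continuous|by move=> w; rewrite mul1r rmorphB/= addrC subrK]. Qed.
Lemma rderivD F G t l m : rderiv F t l -> rderiv G t m -> rderiv (fun u : R => F u + G u) t (l + m).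
Proof.
move=> [f [<- cf Ff]] [g [<- cg Gg]]; exists (fun u : R => f u + g u); split; [by []| |].
  exact: contD cf cg.
by move=> w; rewrite Ff Gg; ring.
Qed.
Lemma rderivM F G t l m : rderiv F t l -> rderiv G t m ->
  rderiv (fun u : R => F u * G u) t (l * G t + F t * m).
Proof.
move=> [f [<- cf Ff]] dG; have cG := rderiv_cont dG.
have [g [<- cg Gg]] := dG.
exists (fun u : R => f u * G u + F t * g u); split; [by []| |].
  have h1 := contM cf cG.
  have h2 := contM (@contK _ _ (F t) t) cg.
  exact: (contD h1 h2).
by move=> w; rewrite Ff Gg; ring.
Qed.
Lemma rderiv_comp F g t l m : cderiv F (g t) l -> rderiv g t m -> rderiv (fun u : R => F (g u)) t (l * m).
Proof.
move=> [f [<- cf Ff]] dG; have cG := rderiv_cont dG.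
have [p [<- cp Gg]] := dG.
exists (fun u : R => f (g u) * p u); split; [by []| |].
  apply: contM; [exact: (continuous_comp cG cf)|exact: cp].
by move=> w; rewrite Ff -mulrA; congr (_ + _ * _); rewrite Gg; ring.
Qed.
Lemma rderiv_Re g t l : rderiv g t l -> is_derive t 1 (fun u => complex.Re (g u)) (complex.Re l).
Proof.
move=> [p [<- cp Gg]]; apply/is_derive1_caratheodory; exists (fun u => complex.Re (p u)); split; last by [].
  by move=> u; rewrite [in LHS]Gg; case: (g t) (p u) => a b [c d] /=; ring.
by apply: continuous_comp; [exact: cp|exact: Re_cont].
Qed.
Lemma rderiv_Im g t l : rderiv g t l -> is_derive t 1 (fun u => complex.Im (g u)) (complex.Im l).
Proof.
move=> [p [<- cp Gg]]; apply/is_derive1_caratheodory; exists (fun u => complex.Im (p u)); split; last by [].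
  by move=> u; rewrite [in LHS]Gg; case: (g t) (p u) => a b [c d] /=; ring.
by apply: continuous_comp; [exact: cp|exact: Im_cont].
Qed.
End Derivative.

(** * Integrals of real functions over a segment *)

Section RealIntegral.
Context {R : realType}.
Notation mu := (@lebesgue_measure R).
Implicit Types (f g : R -> R) (a b c : R).

(** Two-sided continuity also at the endpoints. This is stronger than continuity of the restriction,
    but passes to subsegments and to algebraic combinations without any subspace topology. *)
Definition contab f a b := forall t, a <= t <= b -> {for t, continuous f}.

Lemma contab_within f a b : contab f a b -> {within `[a, b], continuous f}.
Proof.
move=> cf; apply: continuous_in_subspaceT => t; rewrite inE/= in_itv/=; exact: cf.
Qed.
Lemma contab_int f a b : contab f a b -> mu.-integrable `[a, b] (EFin \o f).
Proof.
move=> /contab_within cf; apply: continuous_compact_integrable; [exact: segment_compact|exact: cf].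
Qed.

Definition rint a b f : R := \int[mu]_(x in `[a, b]) f x.

Lemma rint_split f a b c : a <= b -> b <= c -> contab f a c ->
  rint a c f = rint a b f + rint b c f.
Proof.
move=> ab bc cf; have i := contab_int cf.
have := @Rintegral_itvB R f (BLeft a) (BRight c) b i.
rewrite !bnd_simp => /(_ ab bc).
rewrite /rint => /eqP; rewrite subr_eq => /eqP ->; rewrite addrC; congr (_ + _).
rewrite Rintegral_itv_obnd_cbnd//.
apply: integrableS i => //=; apply: subset_itvr; by rewrite bnd_simp.
Qed.
Lemma rintD f g a b : contab f a b -> contab g a b -> rint a b (fun x => f x + g x) = rint a b f + rint a b g.
Proof. move=> /contab_int i /contab_int j; exact: RintegralD. Qed.
Lemma rintZ k f a b : contab f a b -> rint a b (fun x => k * f x) = k * rint a b f.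
Proof. move=> /contab_int i; exact: RintegralZl. Qed.
Lemma rintC k a b : a <= b -> rint a b (fun=> k) = k * (b - a).
Proof.
move=> ab; rewrite /rint Rintegral_cst//= lebesgue_measure_itv/= lte_fin.
case: ltP => // ba; rewrite mulr0 (_ : b = a) ?subrr ?mulr0//.
by apply/eqP; rewrite eq_le ba.
Qed.
Lemma rint_le f g a b : contab f a b -> contab g a b -> (forall t, a <= t <= b -> f t <= g t) ->
  rint a b f <= rint a b g.
Proof.
move=> /contab_int i /contab_int j H; apply: le_Rintegral => //= t; rewrite in_itv/=; exact: H.
Qed.
Lemma rint_norm f a b : contab f a b -> `|rint a b f| <= rint a b (fun x => `|f x|).
Proof. move=> /contab_int i; exact: le_normr_Rintegral. Qed.
Lemma contab_norm f a b : contab f a b -> contab (fun x => `|f x|) a b.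
Proof. move=> cf t /cf ct; exact: cvg_norm ct. Qed.
Lemma contabD f g a b : contab f a b -> contab g a b -> contab (fun x => f x + g x) a b.
Proof. move=> cf cg t h; exact: (cvgD (cf t h) (cg t h)). Qed.
Lemma contabM f g a b : contab f a b -> contab g a b -> contab (fun x => f x * g x) a b.
Proof. move=> cf cg t h; exact: (cvgM (cf t h) (cg t h)). Qed.
Lemma contabC k a b : contab (fun=> k) a b.
Proof. move=> t h; exact: cst_continuous. Qed.
Lemma rint_bnd f a b M : a <= b -> contab f a b -> (forall t, a <= t <= b -> `|f t| <= M) ->
  `|rint a b f| <= M * (b - a).
Proof.
move=> ab cf H; apply: le_trans (rint_norm cf) _; rewrite -rintC//.
by apply: rint_le => //; [exact: contab_norm|exact: contabC].
Qed.
Lemma rint_eq f g a b : (forall t, a <= t <= b -> f t = g t) -> rint a b f = rint a b g.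
Proof. by move=> H; apply: eq_Rintegral => t; rewrite inE/= in_itv/= => /H. Qed.
Lemma rint_ftc f F a b : a <= b -> contab f a b -> (forall t, a <= t <= b -> is_derive t 1 F (f t)) ->
  rint a b f = F b - F a.
Proof.
rewrite le_eqVlt => /predU1P[<- _ _|ab cf dF].
  by rewrite /rint set_itv1 Rintegral_set1 subrr.
have cF t : a <= t <= b -> {for t, continuous F}.
  move=> /dF [dt _]; exact/differentiable_continuous/derivable1_diffP.
rewrite /rint /Rintegral (@continuous_FTC2 _ f F)//.
- exact: contab_within.
- split => [t||].
  + rewrite in_itv/= => /andP[h1 h2]; have /dF [] // : a <= t <= b by rewrite !ltW.
  + by apply: cvg_at_right_filter; apply: cF; rewrite lexx ltW.
  + by apply: cvg_at_left_filter; apply: cF; rewrite lexx ltW.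
- move=> t; rewrite in_itv/= => /andP[h1 h2]; have /dF dt : a <= t <= b by rewrite !ltW.
  by rewrite derive1E; apply: derive_val.
Qed.
End RealIntegral.

(** * Integrals of complex functions of a real variable *)

Section ComplexIntegral.
Context {R : realType}.
Implicit Types (f g : R -> R[i]^o) (a b c : R).
Notation Re := (@complex.Re R). Notation Im := (@complex.Im R).

Definition ccont f a b := forall t, a <= t <= b -> {for t, continuous f}.
Definition cint a b f : R[i]^o := (rint a b (fun t => Re (f t)) +i* rint a b (fun t => Im (f t)))%C.

Lemma ccont_Re f a b : ccont f a b -> contab (fun t => Re (f t)) a b.
Proof. move=> cf t /cf ct; apply: continuous_comp; [exact: ct|exact: Re_cont]. Qed.
Lemma ccont_Im f a b : ccont f a b -> contab (fun t => Im (f t)) a b.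
Proof. move=> cf t /cf ct; apply: continuous_comp; [exact: ct|exact: Im_cont]. Qed.
Lemma ccontB f g a b : ccont f a b -> ccont g a b -> ccont (fun x => f x - g x) a b.
Proof. move=> cf cg t h; exact: (contB (cf t h) (cg t h)). Qed.
Lemma ccontM f g a b : ccont f a b -> ccont g a b -> ccont (fun x => f x * g x) a b.
Proof. move=> cf cg t h; exact: (contM (cf t h) (cg t h)). Qed.
Lemma ccontC k a b : ccont (fun=> k) a b.
Proof. move=> t h; exact: contK. Qed.
Lemma ccont_N f a b : ccont f a b -> contab (fun x => N (f x)) a b.
Proof. move=> cf t /cf ct; apply: continuous_comp; [exact: ct|exact: N_cont]. Qed.
Lemma ccont_sub f a b c d : a <= c -> d <= b -> ccont f a b -> ccont f c d.
Proof. by move=> ac db H t /andP[ct td]; apply: H; rewrite (le_trans ac) ?(le_trans td). Qed.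

Lemma cint_split f a b c : a <= b -> b <= c -> ccont f a c ->
  cint a c f = cint a b f + cint b c f.
Proof.
move=> ab bc cf; rewrite /cint (rint_split ab bc (ccont_Re cf)) (rint_split ab bc (ccont_Im cf)).
by [].
Qed.
Lemma cint_eq f g a b : (forall t, a <= t <= b -> f t = g t) -> cint a b f = cint a b g.
Proof. by move=> H; congr (_ +i* _)%C; apply: rint_eq => t /H ->. Qed.
Lemma cintD f g a b : ccont f a b -> ccont g a b -> cint a b (fun x => f x + g x) = cint a b f + cint a b g.
Proof.
move=> cf cg; rewrite /cint.
have -> : rint a b (fun t => Re (f t + g t)) = rint a b (fun t => Re (f t) + Re (g t)) by apply: rint_eq => t _; rewrite raddfD.
have -> : rint a b (fun t => Im (f t + g t)) = rint a b (fun t => Im (f t) + Im (g t)) by apply: rint_eq => t _; rewrite raddfD.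
by rewrite !rintD//; [exact: ccont_Im|exact: ccont_Im|exact: ccont_Re|exact: ccont_Re].
Qed.
Lemma cintZ k f a b : ccont f a b -> cint a b (fun x => k * f x) = k * cint a b f.
Proof.
move=> cf; have c1 := ccont_Re cf; have c2 := ccont_Im cf; case: k => k1 k2; rewrite /cint.
have -> : rint a b (fun t => Re ((k1 +i* k2)%C * f t)) = rint a b (fun t => k1 * Re (f t) + (- k2) * Im (f t)).
  by apply: rint_eq => t _; case: (f t) => x y /=; ring.
have -> : rint a b (fun t => Im ((k1 +i* k2)%C * f t)) = rint a b (fun t => k1 * Im (f t) + k2 * Re (f t)).
  by apply: rint_eq => t _; case: (f t) => x y /=; ring.
rewrite !rintD; try (apply: contabM; [exact: contabC|assumption]).
by rewrite !rintZ// mulNr.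
Qed.
Lemma cintB f g a b : ccont f a b -> ccont g a b -> cint a b (fun x => f x - g x) = cint a b f - cint a b g.
Proof.
move=> cf cg; have -> : cint a b (fun x => f x - g x) = cint a b (fun x => f x + (-1) * g x).
  by apply: cint_eq => t _; rewrite mulN1r.
have c := ccontM (@ccontC (-1) a b) cg.
by rewrite (cintD cf c) (cintZ _ cg) mulN1r.
Qed.
(** Real and imaginary parts are bounded separately, whence the factor 2; the later uses only need
    some constant. *)
Lemma cint_bnd f a b M : a <= b -> ccont f a b -> (forall t, a <= t <= b -> N (f t) <= M) ->
  N (cint a b f) <= 2 * M * (b - a).
Proof.
move=> ab cf H; apply: le_trans (N_ReIm _) _ => /=; rewrite -mulrA mulr_natl mulr2n lerD//.
  by apply: rint_bnd => //; [exact: ccont_Re|move=> t /H; apply: le_trans; exact: N_Re].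
by apply: rint_bnd => //; [exact: ccont_Im|move=> t /H; apply: le_trans; exact: N_Im].
Qed.
Lemma cint_ftc f F a b : a <= b -> ccont f a b -> (forall t, a <= t <= b -> rderiv F t (f t)) ->
  cint a b f = F b - F a.
Proof.
move=> ab cf dF; rewrite /cint.
rewrite (rint_ftc ab (ccont_Re cf) (fun t h => rderiv_Re (dF t h))).
rewrite (rint_ftc ab (ccont_Im cf) (fun t h => rderiv_Im (dF t h))).
by case: (F b) (F a) => x y [z w].
Qed.
Lemma cint_conj f a b : ccont f a b -> cint a b (fun t => (f t)^*%C) = (cint a b f)^*%C.
Proof.
move=> cf; rewrite /cint /=; congr (_ +i* _)%C.
  by apply: rint_eq => t _; case: (f t).
rewrite -mulN1r -rintZ; last exact: ccont_Im.
by apply: rint_eq => t _; case: (f t) => x y /=; rewrite mulN1r.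
Qed.
Lemma cintC k a b : a <= b -> cint a b (fun=> k) = k * (b - a)%:C.
Proof.
move=> ab; rewrite /cint !rintC//; case: k => x y /=.
by apply/eqP; rewrite eq_complex /=; apply/andP; split; apply/eqP; ring.
Qed.
End ComplexIntegral.

(** * Goursat's lemma and Cauchy's formula *)

Section Goursat.
Context {R : realType}.

Lemma half_pow_lt (c d : R) : 0 < d -> exists n, c * 2^-1 ^+ n < d.
Proof.
move=> d0; have [c0|c0] := leP c 0.
  by exists 0%N; rewrite expr0 mulr1 (le_lt_trans c0).
have cd0 : 0 <= c / d by rewrite divr_ge0// ltW.
exists (Num.bound (c / d)); have /= hb := archi_boundP cd0.
set n := Num.bound _ in hb *.
rewrite exprVn ltr_pdivrMr ?exprn_gt0// mulrC -ltr_pdivrMr//.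
apply: lt_le_trans hb _; rewrite -natrX ler_nat ltnW// ltn_expl//.
Qed.

(* Goursat's bisection argument, for an arbitrary additive rectangle function
   [J] which is [o(diameter ^ 2)] at every point. *)
Lemma additive_rect_zero (J : R -> R -> R -> R -> R[i]) (x0 x1 y0 y1 : R) :
  x0 <= x1 -> y0 <= y1 ->
  (forall a m a' b b', x0 <= a -> a <= m -> m <= a' -> a' <= x1 -> y0 <= b -> b <= b' -> b' <= y1 ->
     J a a' b b' = J a m b b' + J m a' b b') ->
  (forall a a' b m b', x0 <= a -> a <= a' -> a' <= x1 -> y0 <= b -> b <= m -> m <= b' -> b' <= y1 ->
     J a a' b b' = J a a' b m + J a a' m b') ->
  (forall x y, x0 <= x <= x1 -> y0 <= y <= y1 -> forall e, 0 < e -> exists2 d, 0 < d &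
     forall a a' b b', x0 <= a -> a <= x <= a' -> a' <= x1 -> y0 <= b -> b <= y <= b' -> b' <= y1 ->
     a' - a < d -> b' - b < d -> N (J a a' b b') <= e * ((a' - a) + (b' - b)) ^+ 2) ->
  J x0 x1 y0 y1 = 0.
Proof.
move=> x01 y01 Jx Jy Jloc.
pose w := x1 - x0; pose h := y1 - y0; pose q n : R := 2^-1 ^+ n.
have w0 : 0 <= w by rewrite subr_ge0.
have h0 : 0 <= h by rewrite subr_ge0.
have q0 n : 0 < q n by rewrite exprn_gt0// invr_gt0.
have qS n : q n = q n.+1 + q n.+1 by rewrite /q exprS; field.
pose NJ (p : R * R) n := N (J p.1 (p.1 + w * q n) p.2 (p.2 + h * q n)).
pose P (p : R * R) n := [/\ x0 <= p.1, p.1 + w * q n <= x1, y0 <= p.2 & p.2 + h * q n <= y1].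
(* The rectangle of [p'] is nested in that of [p] and carries at least a quarter of its modulus of
   [J]. *)
pose Rel n (p p' : R * R) := [/\ p.1 <= p'.1, p'.1 + w * q n.+1 <= p.1 + w * q n,
  p.2 <= p'.2, p'.2 + h * q n.+1 <= p.2 + h * q n & NJ p n <= 4 * NJ p' n.+1].
have step (np : nat * (R * R)) : exists p', P np.2 np.1 -> Rel np.1 np.2 p'.
  case: np => n [x y] /=; set p := (x, y).
  have wq := mulr_ge0 w0 (ltW (q0 n.+1)); have hq := mulr_ge0 h0 (ltW (q0 n.+1)).
  have wS : w * q n = w * q n.+1 + w * q n.+1 by rewrite -mulrDr -qS.
  have hS : h * q n = h * q n.+1 + h * q n.+1 by rewrite -mulrDr -qS.
  case: (pselect (P p n)) => [[/= p1 p2 p3 p4]|nP]; last by exists p.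
  have JJ : NJ p n <= NJ (x, y) n.+1 + NJ (x + w * q n.+1, y) n.+1 +
     (NJ (x, y + h * q n.+1) n.+1 + NJ (x + w * q n.+1, y + h * q n.+1) n.+1).
    rewrite /NJ /= wS hS (@Jy _ _ y (y + h * q n.+1)); [|lra..].
    rewrite (@Jx x (x + w * q n.+1)); [|lra..].
    rewrite (@Jx x (x + w * q n.+1) _ (y + h * q n.+1)); [|lra..].
    rewrite ![_ + (w * _ + _)]addrA ![_ + (h * _ + _)]addrA.
    by apply: le_trans (ND _ _) _; apply: lerD; exact: ND.
  (* If each of the four quarters carried less than a quarter of the modulus, their sum would
     contradict [JJ]. *)
  apply: contrapT => /forallNP no.
  have big u : p.1 <= u.1 -> u.1 + w * q n.+1 <= p.1 + w * q n ->
     p.2 <= u.2 -> u.2 + h * q n.+1 <= p.2 + h * q n -> 4 * NJ u n.+1 < NJ p n.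
    move=> h1 h2 h3 h4; rewrite ltNge; apply/negP => h5; apply: (no u) => _; by split.
  have b1 := big (x, y); have b2 := big (x + w * q n.+1, y).
  have b3 := big (x, y + h * q n.+1); have b4 := big (x + w * q n.+1, y + h * q n.+1).
  rewrite /= in b1 b2 b3 b4.
  clear no big.
  have {}b1 : 4 * NJ (x, y) n.+1 < NJ p n by clear JJ b2 b3 b4; apply: b1; lra.
  have {}b2 : 4 * NJ (x + w * q n.+1, y) n.+1 < NJ p n by clear JJ b1 b3 b4; apply: b2; lra.
  have {}b3 : 4 * NJ (x, y + h * q n.+1) n.+1 < NJ p n by clear JJ b1 b2 b4; apply: b3; lra.
  have {}b4 : 4 * NJ (x + w * q n.+1, y + h * q n.+1) n.+1 < NJ p n by clear JJ b1 b2 b3; apply: b4; lra.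
  by clear -JJ b1 b2 b3 b4; lra.
have [next nextP] := choice step.
pose s := fix s n := if n is n'.+1 then next (n', s n') else (x0, y0).
have sP n : P (s n) n /\ N (J x0 x1 y0 y1) <= 4 ^+ n * NJ (s n) n.
  elim: n => [|n [IH1 IH2]].
    rewrite /P /NJ /= /q !expr0 !mulr1 mul1r /w /h; split; last first.
      by rewrite (addrC x0) subrK (addrC y0) subrK.
    by split; lra.
  have /= [r1 r2 r3 r4 r5] := nextP (n, s n) IH1.
  have [p1 p2 p3 p4] := IH1; split.
    by split; [exact: le_trans p1 r1|exact: le_trans r2 p2|exact: le_trans p3 r3|exact: le_trans r4 p4].
  apply: le_trans IH2 _; rewrite exprSr -mulrA ler_pM2l ?exprn_gt0//.
have sR n : Rel n (s n) (s n.+1) by have [/(nextP (n, s n))] := sP n.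
have s0 : s 0%N = (x0, y0) by [].
clearbody s; clear nextP step.
have mono m n : (n <= m)%N -> [/\ (s n).1 <= (s m).1, (s m).1 + w * q m <= (s n).1 + w * q n,
   (s n).2 <= (s m).2 & (s m).2 + h * q m <= (s n).2 + h * q n].
  elim: m => [|m IH]; first by rewrite leqn0 => /eqP ->; split.
  rewrite leq_eqVlt => /orP[/eqP ->|]; first by split.
  rewrite ltnS => /IH [a1 a2 a3 a4]; have [b1 b2 b3 b4 _] := sR m.
  split.
  - exact: le_trans a1 b1.
  - exact: le_trans b2 a2.
  - exact: le_trans a3 b3.
  - exact: le_trans b4 a4.
(* Nested intervals: the supremum of the left endpoints lies in all of them. *)
have lim (f : nat -> R) (c : R) : 0 <= c -> (forall m n, (n <= m)%N -> f n <= f m /\ f m + c * q m <= f n + c * q n) ->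
   exists X, forall n, f n <= X <= f n + c * q n.
  move=> c0 fm; exists (sup (range f)) => n.
  have ub k : ubound (range f) (f k + c * q k).
    move=> _ [m _ <-]; have [km|/ltnW mk] := leqP k m.
      have [_] := fm _ _ km; apply: le_trans; rewrite lerDl mulr_ge0// ltW//.
    have [h1 _] := fm _ _ mk; apply: le_trans h1 _; rewrite lerDl mulr_ge0// ltW//.
  apply/andP; split.
    by apply: ub_le_sup; [exists (f n + c * q n); exact: ub|exists n].
  by apply: ge_sup; [exists (f 0%N), 0%N|exact: ub].
have [X hX] : exists X, forall n, (s n).1 <= X <= (s n).1 + w * q n.
  by apply: lim => // m n /mono [].
have [Y hY] : exists Y, forall n, (s n).2 <= Y <= (s n).2 + h * q n.
  by apply: lim => // m n /mono [].
have X01 : x0 <= X <= x1.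
  by have := hX 0%N; rewrite s0 /= /q expr0 mulr1 /w (addrC x0) subrK.
have Y01 : y0 <= Y <= y1.
  by have := hY 0%N; rewrite s0 /= /q expr0 mulr1 /h (addrC y0) subrK.
(* The factor [4 ^ n] lost by the selection is exactly regained from the square of the diameter,
   which shrinks like [2 ^ - n]. *)
have key e : 0 < e -> N (J x0 x1 y0 y1) <= e * (w + h) ^+ 2.
  move=> e0; have [d d0 hd] := Jloc X Y X01 Y01 e e0.
  have [n hn] := half_pow_lt (w + h) d0.
  have [[p1 p2 p3 p4] hJ] := sP n; apply: le_trans hJ _.
  have wq := mulr_ge0 w0 (ltW (q0 n)); have hq := mulr_ge0 h0 (ltW (q0 n)).
  have whn : w * q n + h * q n < d by rewrite -mulrDl.
  have := hd (s n).1 ((s n).1 + w * q n) (s n).2 ((s n).2 + h * q n) p1 (hX n) p2 p3 (hY n) p4.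
  have -> : (s n).1 + w * q n - (s n).1 = w * q n by ring.
  have -> : (s n).2 + h * q n - (s n).2 = h * q n by ring.
  move=> H; have {}H : NJ (s n) n <= e * (w * q n + h * q n) ^+ 2 by apply: H; lra.
  apply: (@le_trans _ _ (4 ^+ n * (e * (w * q n + h * q n) ^+ 2))).
    by rewrite ler_pM2l ?exprn_gt0.
  rewrite -mulrDl exprMn (_ : 4 ^+ n * _ = e * (w + h) ^+ 2 * (4 * 2^-1 * 2^-1) ^+ n); last first.
    by rewrite /q !exprMn; ring.
  by rewrite (_ : 4 * 2^-1 * 2^-1 = 1 :> R) ?expr1n ?mulr1//; field.
apply/eqP; rewrite -N_eq0; apply/eqP; apply: le_anti; rewrite N_ge0 andbT.
apply/ler_addgt0Pl => e e0; rewrite addr0.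
have c0 : 0 < (w + h) ^+ 2 + 1 by rewrite ltr_wpDl ?sqr_ge0.
apply: le_trans (key (e / ((w + h) ^+ 2 + 1)) _) _; first by rewrite divr_gt0.
by rewrite mulrAC ler_pdivrMr// ler_pM2l// lerDl.
Qed.

Section Cone.
Variables (z0 : R[i]^o) (c c' : R -> R[i]^o) (t0 t1 a b M : R).
Hypotheses (t00 : 0 <= t0) (t01 : t0 <= t1) (t11 : t1 <= 1) (ab : a <= b) (M0 : 0 < M).
Hypothesis (dc : forall s, a <= s <= b -> rderiv c s (c' s)).
Hypothesis (cc' : ccont c' a b).
Hypothesis (Mc' : forall s, a <= s <= b -> N (c' s) <= M).
Hypothesis (Mc : forall s, a <= s <= b -> N (c s - z0) <= M).

(** Bisection takes place on rectangles of parameters [(t, s)] instead of figures in the plane, so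
    that one Goursat argument serves both circles (Cauchy's formula) and segments (primitives). *)
Definition cone t s : R[i]^o := z0 + t%:C * (c s - z0).

(* The integral of [F(z) dz] along the image under [cone] of the boundary of
   the rectangle [t, t'] x [s, s']. *)
Definition cone_form (F : R[i]^o -> R[i]^o) t t' s s' : R[i]^o :=
  cint t t' (fun u => F (cone u s') * (c s' - z0)) -
  cint t t' (fun u => F (cone u s) * (c s - z0)) -
  (cint s s' (fun v => F (cone t' v) * (t'%:C * c' v)) -
   cint s s' (fun v => F (cone t v) * (t%:C * c' v))).

Definition cone_cont F := forall t s, t0 <= t <= t1 -> a <= s <= b -> {for cone t s, continuous (F : R[i]^o -> R[i]^o)}.

Lemma dcone_t t s : rderiv (fun u : R => cone u s) t (c s - z0).
Proof.
have h := rderivD (rderiv_cst z0 t) (rderivM (rderiv_id t) (rderiv_cst (c s - z0) t)).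
by rewrite add0r mul1r mulr0 addr0 in h.
Qed.
Lemma dcone_s t s : a <= s <= b -> rderiv (fun v => cone t v) s (t%:C * c' s).
Proof.
move=> /dc h0.
have h := rderivD (rderiv_cst z0 s) (rderivM (rderiv_cst t%:C s) (rderivD h0 (rderiv_cst (- z0) s))).
by rewrite mul0r add0r addr0 add0r in h.
Qed.
Lemma cone_int_t F s : cone_cont F -> a <= s <= b -> ccont (fun u => F (cone u s) * (c s - z0)) t0 t1.
Proof.
move=> cF hs t ht.
have h := @continuous_comp _ _ _ (fun u : R => cone u s) F t (rderiv_cont (dcone_t t s)) (cF t s ht hs).
exact: (contM h (@contK _ _ (c s - z0) t)).
Qed.
Lemma cone_int_s F t : cone_cont F -> t0 <= t <= t1 -> ccont (fun v => F (cone t v) * (t%:C * c' v)) a b.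
Proof.
move=> cF ht s hs.
have h := @continuous_comp _ _ _ (fun v : R => cone t v) F s (rderiv_cont (dcone_s t hs)) (cF t s ht hs).
exact: (contM h (contM (@contK _ _ t%:C s) (cc' hs))).
Qed.

(** Each side evaluates to a difference of [W] at two of the four corners, and these differences
    telescope. *)
Lemma cone_form_exact F W t t' s s' : cone_cont F -> (forall z, cderiv W z (F z)) ->
  t0 <= t -> t <= t' -> t' <= t1 -> a <= s -> s <= s' -> s' <= b -> cone_form F t t' s s' = 0.
Proof.
move=> cF dW h1 h2 h3 h4 h5 h6.
have hI u : a <= u <= b -> cint t t' (fun x => F (cone x u) * (c u - z0)) = W (cone t' u) - W (cone t u).
  move=> hu; rewrite (@cint_ftc _ _ (fun x => W (cone x u)))//.
    by apply: ccont_sub (cone_int_t cF hu).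
  by move=> x _; apply: rderiv_comp; [exact: dW|exact: dcone_t].
have hJ u : t0 <= u <= t1 -> cint s s' (fun v => F (cone u v) * (u%:C * c' v)) = W (cone u s') - W (cone u s).
  move=> hu; rewrite (@cint_ftc _ _ (fun x => W (cone u x)))//.
    by apply: ccont_sub (cone_int_s cF hu).
  move=> x /andP[x1 x2]; apply: rderiv_comp; first exact: dW.
  by apply: dcone_s; lra.
rewrite /cone_form !hI ?hJ; last 4 first.
- by lra. - by lra. - by lra. - by lra.
by do 4!move: (W _) => ?; ring.
Qed.

Lemma cone_formB F E t t' s s' : cone_cont F -> cone_cont E ->
  t0 <= t -> t <= t' -> t' <= t1 -> a <= s -> s <= s' -> s' <= b ->
  cone_form (fun z => F z - E z) t t' s s' = cone_form F t t' s s' - cone_form E t t' s s'.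
Proof.
move=> cF cE h1 h2 h3 h4 h5 h6.
have hI u : a <= u <= b -> cint t t' (fun x => (F (cone x u) - E (cone x u)) * (c u - z0)) =
  cint t t' (fun x => F (cone x u) * (c u - z0)) - cint t t' (fun x => E (cone x u) * (c u - z0)).
  move=> hu; rewrite -cintB.
  - by apply: cint_eq => v _; rewrite mulrBl.
  - by apply: ccont_sub (cone_int_t cF hu).
  - by apply: ccont_sub (cone_int_t cE hu).
have hJ u : t0 <= u <= t1 -> cint s s' (fun v => (F (cone u v) - E (cone u v)) * (u%:C * c' v)) =
  cint s s' (fun v => F (cone u v) * (u%:C * c' v)) - cint s s' (fun v => E (cone u v) * (u%:C * c' v)).
  move=> hu; rewrite -cintB.
  - by apply: cint_eq => v _; rewrite mulrBl.
  - by apply: ccont_sub (cone_int_s cF hu).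
  - by apply: ccont_sub (cone_int_s cE hu).
rewrite /cone_form !hI ?hJ; last 4 first.
- by lra. - by lra. - by lra. - by lra.
by do 8!move: (cint _ _ _) => ?; ring.
Qed.

Lemma c_lip s s' : a <= s <= b -> a <= s' <= b -> N (c s - c s') <= 2 * M * `|s - s'|.
Proof.
wlog ss : s s' / s' <= s.
  move=> H hs hs'; have [h|/ltW h] := leP s' s; first exact: H.
  by rewrite NBC distrC; apply: H.
move=> /andP[h1 h2] /andP[h3 h4]; rewrite ger0_norm ?subr_ge0//.
have <- : cint s' s c' = c s - c s'.
  apply: cint_ftc => //; first exact: ccont_sub cc'.
  by move=> t /andP[h5 h6]; apply: dc; lra.
apply: cint_bnd => //; first exact: ccont_sub cc'.
by move=> t /andP[h5 h6]; apply: Mc'; lra.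
Qed.

Lemma cone_form_local F ts ss : (forall t s, t0 <= t <= t1 -> a <= s <= b -> exists l, cderiv F (cone t s) l) ->
  t0 <= ts <= t1 -> a <= ss <= b -> forall e, 0 < e -> exists2 d, 0 < d &
     forall t t' s s', t0 <= t -> t <= ts <= t' -> t' <= t1 -> a <= s -> s <= ss <= s' -> s' <= b ->
     t' - t < d -> s' - s < d -> N (cone_form F t t' s s') <= e * ((t' - t) + (s' - s)) ^+ 2.
Proof.
move=> dF hts hss e e0; have [l hl] := dF _ _ hts hss.
have cF : cone_cont F by move=> t s ht hs; have [m /cderiv_cont] := dF _ _ ht hs.
set zs := cone ts ss in hl.
(* The first order expansion [p] of [F] has the primitive [W], so that only
   the remainder [F - p] contributes to the integral. *)
pose p z : R[i]^o := F zs + l * (z - zs).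
pose W z : R[i]^o := F zs * z + (l / 2) * ((z - zs) * (z - zs)).
have dW z : cderiv W z (p z).
  have h1 := cderivD (cderiv_id z) (cderiv_cst (- zs) z).
  have h := cderivD (cderivM (cderiv_cst (F zs) z) (cderiv_id z))
    (cderivM (cderiv_cst (l / 2) z) (cderivM h1 h1)).
  rewrite (_ : p z = 0 * z + F zs * 1 + (0 * ((z - zs) * (z - zs)) +
    l / 2 * ((1 + 0) * (z - zs) + (z - zs) * (1 + 0)))); first exact: h.
  by rewrite /p; field.
have dp z : cderiv p z l.
  have h1 := cderivD (cderiv_id z) (cderiv_cst (- zs) z).
  have h := cderivD (cderiv_cst (F zs) z) (cderivM (cderiv_cst l z) h1).
  by rewrite add0r mul0r add0r addr0 mulr1 in h.
have cp : cone_cont p by move=> t s _ _; exact: cderiv_cont (dp _).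
have cE : cone_cont (fun z => F z - p z).
  by move=> t s ht hs; exact: (contB (cF t s ht hs) (cp t s ht hs)).
(* With this constant the total is exactly [e * sg ^ 2]: the sides stay within [2 * M * sg] of [zs],
   and each of them contributes [2 * B * M] times its parameter length. *)
have e10 : 0 < e / (8 * M ^+ 2) by rewrite divr_gt0// mulr_gt0// exprn_gt0.
move/cderivP : hl => /(_ _ e10) [d d0 hd].
(* Then [2 * M * sg < d], as [sg] is the sum of two lengths below [d / (4 * M)]. *)
exists (d / (4 * M)); first by rewrite divr_gt0// mulr_gt0.
move=> t t' s s' k1 /andP[k2 k3] k4 k5 /andP[k6 k7] k8 kd1 kd2.
have tt' : t <= t' by lra. have ss' : s <= s' by lra.
rewrite -[cone_form F _ _ _ _]subr0 -(cone_form_exact cp dW k1 tt' k4 k5 ss' k8) -cone_formB//.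
set sg := t' - t + (s' - s).
have sg0 : 0 <= sg by rewrite /sg; lra.
have near u v : t <= u <= t' -> s <= v <= s' -> N (cone u v - zs) <= 2 * M * sg.
  move=> /andP[u1 u2] /andP[v1 v2].
  rewrite (_ : cone u v - zs = (u - ts)%:C * (c v - z0) + ts%:C * (c v - c ss)); last first.
    by rewrite /zs /cone rmorphB /=; ring.
  apply: le_trans (ND _ _) _; rewrite !Normc.normcM !NR.
  have hv : a <= v <= b by lra.
  have e1 : `|u - ts| * N (c v - z0) <= (t' - t) * M.
    by apply: ler_pM => //; [exact: N_ge0|rewrite ler_norml; lra|exact: Mc].
  have e2 : `|ts| * N (c v - c ss) <= 1 * (2 * M * (s' - s)).
    have ts01 : `|ts| <= 1 by clear -hts t00 t11; move/andP : hts => [q1 q2]; rewrite ler_norml (le_trans q2 t11) andbT (le_trans _ (le_trans t00 q1))// lerN10.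
    apply: ler_pM => //; first exact: N_ge0.
    apply: le_trans (c_lip hv hss) _; rewrite ler_pM2l ?mulr_gt0//.
    by rewrite ler_norml; lra.
  rewrite /sg; apply: le_trans (lerD e1 e2) _.
  have : 0 <= (t' - t) * M by apply: mulr_ge0; [rewrite subr_ge0|exact: ltW].
  lra.
have Eb u v : t <= u <= t' -> s <= v <= s' -> N (F (cone u v) - p (cone u v)) <= e / (8 * M ^+ 2) * (2 * M * sg).
  move=> hu hv; have h := near u v hu hv.
  have -> : F (cone u v) - p (cone u v) = F (cone u v) - F zs - l * (cone u v - zs) by rewrite /p; ring.
  apply: (le_trans (hd _ _)); last by rewrite ler_wpM2l// ltW.
  apply: le_lt_trans h _; rewrite /sg.
  move: kd1 kd2; rewrite !ltr_pdivlMr ?mulr_gt0// => kd1 kd2; nra.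
set B := e / (8 * M ^+ 2) * (2 * M * sg).
have B0 : 0 <= B by rewrite /B mulr_ge0 ?(ltW e10)// mulr_ge0// mulr_ge0// ltW.
have I1 v : s <= v <= s' -> N (cint t t' (fun u => (F (cone u v) - p (cone u v)) * (c v - z0))) <= 2 * (B * M) * (t' - t).
  move=> hv; apply: cint_bnd => //.
    by apply: ccont_sub (cone_int_t cE _) => //; lra.
  move=> u hu; rewrite Normc.normcM; apply: ler_pM; [exact: N_ge0|exact: N_ge0|exact: Eb|].
  by apply: Mc; lra.
have I2 u : t <= u <= t' -> N (cint s s' (fun v => (F (cone u v) - p (cone u v)) * (u%:C * c' v))) <= 2 * (B * M) * (s' - s).
  move=> hu; apply: cint_bnd => //.
    by apply: ccont_sub (cone_int_s cE _) => //; lra.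
  move=> v hv; rewrite Normc.normcM; apply: ler_pM; [exact: N_ge0|exact: N_ge0|exact: Eb|].
  rewrite Normc.normcM NR -[leRHS]mul1r; apply: ler_pM => //; [exact: N_ge0| |].
    by rewrite ger0_norm; clear -k1 k4 hu t00 t11; move/andP : hu => [q1 q2]; [apply: le_trans t11; apply: le_trans k4|apply: le_trans q1; apply: le_trans k1].
  by apply: Mc'; lra.
rewrite /cone_form; apply: le_trans (NB _ _) _.
have h1 := NB (cint t t' (fun u => (F (cone u s') - p (cone u s')) * (c s' - z0))) (cint t t' (fun u => (F (cone u s) - p (cone u s)) * (c s - z0))).
have h2 := NB (cint s s' (fun v => (F (cone t' v) - p (cone t' v)) * (t'%:C * c' v))) (cint s s' (fun v => (F (cone t v) - p (cone t v)) * (t%:C * c' v))).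
apply: le_trans (lerD h1 h2) _.
have g1 : s <= s' <= s' by rewrite ss' lexx.
have g2 : s <= s <= s' by rewrite lexx ss'.
have g3 : t <= t' <= t' by rewrite tt' lexx.
have g4 : t <= t <= t' by rewrite lexx tt'.
apply: le_trans (lerD (lerD (I1 _ g1) (I1 _ g2)) (lerD (I2 _ g3) (I2 _ g4))) _.
rewrite le_eqVlt; apply/orP; left; apply/eqP; rewrite /B /sg; field.
by rewrite gt_eqF.
Qed.

Lemma cone_goursat F : (forall t s, t0 <= t <= t1 -> a <= s <= b -> exists l, cderiv F (cone t s) l) ->
  cone_form F t0 t1 a b = 0.
Proof.
move=> dF; have cF : cone_cont F by move=> t s ht hs; have [m /cderiv_cont] := dF _ _ ht hs.
apply: additive_rect_zero => //.
- move=> t m t' s s' h1 h2 h3 h4 h5 h6 h7.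
  have hI u : a <= u <= b -> cint t t' (fun x => F (cone x u) * (c u - z0)) =
     cint t m (fun x => F (cone x u) * (c u - z0)) + cint m t' (fun x => F (cone x u) * (c u - z0)).
    by move=> hu; apply: cint_split => //; apply: ccont_sub (cone_int_t cF hu).
  rewrite /cone_form !hI; last 2 first.
  - by lra. - by lra.
  by do 7!move: (cint _ _ _) => ?; ring.
- move=> t t' s m s' h1 h2 h3 h4 h5 h6 h7.
  have hI u : t0 <= u <= t1 -> cint s s' (fun v => F (cone u v) * (u%:C * c' v)) =
     cint s m (fun v => F (cone u v) * (u%:C * c' v)) + cint m s' (fun v => F (cone u v) * (u%:C * c' v)).
    by move=> hu; apply: cint_split => //; apply: ccont_sub (cone_int_s cF hu).
  rewrite /cone_form !hI; last 2 first.
  - by lra. - by lra.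
  by do 7!move: (cint _ _ _) => ?; ring.
- by move=> x y hx hy e e0; apply: cone_form_local.
Qed.
End Cone.
End Goursat.

(** * Cauchy's formula on circles and its consequences *)

Section Cauchy.
Context {R : realType}.
Implicit Types (p z w : R[i]^o) (S t s : R).

Lemma cjM z w : (z * w)^*%C = z^*%C * w^*%C. Proof. exact: (rmorphM (@conjc R)). Qed.
Lemma cjB z w : (z - w)^*%C = z^*%C - w^*%C. Proof. exact: (rmorphB (@conjc R)). Qed.
Lemma cjV z : (z^-1)^*%C = (z^*%C)^-1. Proof. exact: conjc_inv. Qed.
Lemma cjR (x : R) : (x%:C : R[i]^o)^*%C = x%:C. Proof. exact: conjc_real. Qed.
Lemma cj1 : (1 : R[i]^o)^*%C = 1. Proof. exact: conjc1. Qed.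

Lemma rderiv_Complex (f g : R -> R) (t l m : R) : is_derive t (1 : R) f l -> is_derive t (1 : R) g m ->
  rderiv (fun u => (f u +i* g u)%C) t (l +i* m)%C.
Proof.
move=> /is_derive1_caratheodory [p [pf cp <-]] /is_derive1_caratheodory [q [qf cq <-]].
exists (fun u => (p u +i* q u)%C); split; [by []|exact: Complex_cont|].
move=> u; apply/eqP; rewrite eq_complex /=; have := pf u; have := qf u.
by move=> h1 h2; apply/andP; split; apply/eqP; lra.
Qed.

Lemma ccont_bounded (f : R -> R[i]^o) a b : a <= b -> ccont f a b ->
  exists2 M, 0 < M & forall t, a <= t <= b -> N (f t) <= M.
Proof.
move=> ab /ccont_N /contab_within cf.
have [c hc H] := EVT_max ab cf.
exists (N (f c) + 1); first by rewrite ltr_wpDl ?N_ge0.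
move=> t ht; apply: (@le_trans _ _ (N (f c))); last by rewrite lerDl.
by apply: H; rewrite in_itv.
Qed.

Lemma contR_eq0 (x : R[i]) : (forall e : R, 0 < e -> N x <= e) -> x = 0.
Proof.
move=> H; apply/eqP; rewrite -N_eq0; apply/eqP; apply: le_anti; rewrite N_ge0 andbT.
by apply/ler_addgt0Pl => e e0; rewrite addr0 H.
Qed.

Lemma cderiv_eq (F G : R[i]^o -> R[i]^o) z (l : R[i]^o) : (forall w, F w = G w) -> cderiv F z l -> cderiv G z l.
Proof. by move=> /funext ->. Qed.
Lemma cderivB (F G : R[i]^o -> R[i]^o) z (l m : R[i]^o) : cderiv F z l -> cderiv G z m ->
  cderiv (fun w => F w - G w) z (l - m).
Proof.
move=> hF hG; have h := cderivD hF (cderivM (cderiv_cst (-1) z) hG).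
rewrite mul0r add0r mulN1r in h; apply: cderiv_eq h.
by move=> w; rewrite mulN1r.
Qed.
Lemma cderiv_sub p z : cderiv (fun w => w - p) z 1.
Proof. by have := cderivB (cderiv_id z) (cderiv_cst p z); rewrite subr0. Qed.
Lemma cderivX (F : R[i]^o -> R[i]^o) z (l : R[i]^o) n : cderiv F z l ->
  exists m, cderiv (fun w => F w ^+ n) z m.
Proof.
move=> dF; elim: n => [|n [m IH]]; first by exists 0; exact: cderiv_cst.
exists (l * F z ^+ n + F z * m); apply: cderiv_eq (cderivM dF IH) => w.
by rewrite exprS.
Qed.

(* The cone over the closed curve [c] with apex [z0], cut at height [t],
   deforms [c] to [z0 + t (c - z0)]; then [t] tends to [0]. *)
Section Curve.
Variables (z0 : R[i]^o) (c c' : R -> R[i]^o) (a b M rho : R).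
Lemma cauchy_curve (F : R[i]^o -> R[i]^o) : a <= b -> 0 < M -> 0 < rho ->
 (forall s, a <= s <= b -> rderiv c s (c' s)) -> ccont c' a b ->
 (forall s, a <= s <= b -> N (c' s) <= M) ->
 (forall s, a <= s <= b -> N (c s - z0) <= M) ->
 (forall s, a <= s <= b -> rho <= N (c s - z0)) -> c a = c b ->
 (forall t s, 0 <= t <= 1 -> a <= s <= b -> exists l, cderiv F (cone z0 c t s) l) ->
 cint a b (fun s => F (c s) * (c' s / (c s - z0))) = F z0 * cint a b (fun s => c' s / (c s - z0)).
Proof.
move=> ab M0 r0 dc cc' Mc' Mc rc cab dF.
have cz s : a <= s <= b -> c s - z0 != 0.
  by move=> hs; rewrite -N_gt0; apply: lt_le_trans (rc s hs).
pose k s : R[i]^o := c' s / (c s - z0).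
have ck : ccont k a b.
  move=> s hs; apply: (contM (cc' s hs)); apply: contV; first exact: cz.
  exact: (contB (rderiv_cont (dc s hs)) (@contK _ _ z0 s)).
have cF : cone_cont z0 c 0 1 a b F by move=> t s ht hs; have [l /cderiv_cont] := dF t s ht hs.
have cFc t : 0 <= t <= 1 -> ccont (fun s => F (cone z0 c t s)) a b.
  move=> ht s hs.
  exact: (@continuous_comp _ _ _ (fun v : R => cone z0 c t v) F s (rderiv_cont (dcone_s z0 dc t hs)) (cF t s ht hs)).
have cone1 s : cone z0 c 1 s = c s by rewrite /cone mul1r addrC subrK.
have cz1 t s : cone z0 c t s - z0 = t%:C * (c s - z0) by rewrite /cone addrAC subrr add0r.
have Id t : 0 < t -> t <= 1 -> cint a b (fun s => F (cone z0 c 1 s) * k s) = cint a b (fun s => F (cone z0 c t s) * k s).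
  move=> t0 t1.
  have dF1 u s : t <= u <= 1 -> a <= s <= b -> exists l, cderiv (fun z => F z / (z - z0)) (cone z0 c u s) l.
    move=> /andP[u1 u2] hs; have u0 : 0 < u by apply: lt_le_trans u1.
    have [|l hl] := dF u s _ hs; first by rewrite ltW.
    have cn0 : cone z0 c u s - z0 != 0.
      by rewrite cz1 mulf_neq0 ?cz// -N_gt0 NR normr_gt0 gt_eqF.
    have h1 := cderivD (cderiv_id (cone z0 c u s)) (cderiv_cst (- z0) (cone z0 c u s)).
    have h2 := cderivM hl (@cderivV _ (fun z => z - z0) _ _ cn0 h1).
    by eexists; exact: h2.
  have := cone_goursat (ltW t0) t1 (lexx 1) ab M0 dc cc' Mc' Mc dF1.
  rewrite /cone_form.
  (* The curve is closed, so the two radial sides cancel and only the sides at heights [t] and [1]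
     remain. *)
  have -> : cint t 1 (fun u => F (cone z0 c u b) / (cone z0 c u b - z0) * (c b - z0)) =
     cint t 1 (fun u => F (cone z0 c u a) / (cone z0 c u a - z0) * (c a - z0)).
    by apply: cint_eq => u _; rewrite /cone cab.
  rewrite subrr sub0r => /eqP; rewrite oppr_eq0 subr_eq0 => /eqP E.
  transitivity (cint a b (fun v => F (cone z0 c 1 v) / (cone z0 c 1 v - z0) * (1%:C * c' v))).
    apply: cint_eq => s hs; rewrite cone1 /k mul1r; have := cz s hs => h; field; exact: h.
  rewrite E; apply: cint_eq => s hs; rewrite cz1 /k; have := cz s hs => h.
  have tn : t%:C != 0 :> R[i]^o by rewrite -N_gt0 NR normr_gt0 gt_eqF.
  by move: (t%:C : R[i]^o) tn => T Tn; field; rewrite Tn h.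
apply/eqP; rewrite -subr_eq0; apply/eqP; apply: contR_eq0 => e e0.
have [l dFz] : exists l, cderiv F z0 l.
  have := dF 0 a; rewrite /cone mul0r addr0; apply; first by rewrite lexx ler01.
  by rewrite lexx.
have b0 : 0 < 2 * (b - a) * (M / rho) + 1.
  by rewrite ltr_wpDl// !mulr_ge0// ?subr_ge0// ?invr_ge0; exact: ltW.
pose e1 := e / (2 * (b - a) * (M / rho) + 1).
have e10 : 0 < e1 by rewrite divr_gt0.
have /contCP /(_ _ e10) [d d0 hd] := cderiv_cont dFz.
(* At this height the shrunken curve lies within [d / 2] of [z0]. *)
pose t := Num.min 1 (d / (2 * M)).
have t0 : 0 < t by rewrite lt_min ltr01 divr_gt0// mulr_gt0.
have t1 : t <= 1 by rewrite ge_min lexx.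
have td : t <= d / (2 * M) by rewrite ge_min lexx orbT.
have ht : 0 <= t <= 1 by rewrite ltW.
have -> : cint a b (fun s => F (c s) * (c' s / (c s - z0))) = cint a b (fun s => F (cone z0 c t s) * k s).
  by rewrite -(Id t t0 t1); apply: cint_eq => s _; rewrite cone1.
rewrite -(cintZ _ ck) -cintB; last 2 first.
- exact: (ccontM (cFc t ht) ck).
- exact: (ccontM (@ccontC _ (F z0) a b) ck).
apply: (@le_trans _ _ (2 * (e1 * (M / rho)) * (b - a))).
  apply: cint_bnd; first exact: ab.
    exact: (ccontB (ccontM (cFc t ht) ck) (ccontM (@ccontC _ (F z0) a b) ck)).
  move=> s hs; rewrite -mulrBl Normc.normcM; apply: ler_pM; [exact: N_ge0|exact: N_ge0| |].
    apply/ltW/hd; rewrite cz1 Normc.normcM NR gtr0_norm//.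
    apply: (@le_lt_trans _ _ (d / (2 * M) * M)).
      by apply: ler_pM; [exact: ltW|exact: N_ge0|by []|exact: Mc].
    by rewrite (_ : _ * M = d / 2); [lra|field; rewrite gt_eqF].
  rewrite /k Normc.normcM Normc.normcV; apply: ler_pM; [exact: N_ge0|by rewrite invr_ge0 N_ge0|exact: Mc'|].
  by rewrite lef_pV2 ?posrE ?rc// (lt_le_trans r0)// rc.
rewrite (_ : _ * (b - a) = e1 * (2 * (b - a) * (M / rho))); last by ring.
rewrite /e1 mulrAC ler_pdivrMr// ler_pM2l// lerDl ler01//.
Qed.
End Curve.

Definition circ (p : R[i]^o) (S t : R) : R[i]^o := p + S%:C * (cos t +i* sin t)%C.
Definition mean (g : R -> R[i]^o) : R[i]^o := ((2 * pi)^-1)%:C * cint 0 (2 * pi) g.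

Lemma twopi_gt0 : 0 < 2 * pi :> R. Proof. by rewrite mulr_gt0// pi_gt0. Qed.
Lemma twopi_ge0 : 0 <= 2 * pi :> R. Proof. exact: ltW twopi_gt0. Qed.

Lemma circ_deriv p S t : rderiv (circ p S) t ('i * (circ p S t - p)).
Proof.
have h := rderivD (rderiv_cst p t) (rderivM (rderiv_cst S%:C t) (rderiv_Complex (is_derive_cos t) (is_derive_sin t))).
rewrite mul0r !add0r in h; rewrite (_ : 'i * _ = S%:C * (- sin t +i* cos t)); first exact: h.
rewrite /circ addrAC subrr add0r; apply/eqP; rewrite eq_complex /=.
by apply/andP; split; apply/eqP; ring.
Qed.
Lemma N_circ p S t : 0 <= S -> N (circ p S t - p) = S.
Proof.
move=> S0; rewrite /circ addrAC subrr add0r Normc.normcM NR ger0_norm//=.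
by rewrite cos2Dsin2 sqrtr1 mulr1.
Qed.
Lemma circ_cont p S t : {for t, continuous (circ p S)}.
Proof. exact: rderiv_cont (circ_deriv p S t). Qed.
Lemma circ_2pi p S : circ p S 0 = circ p S (2 * pi).
Proof. by rewrite /circ mulr_natl cos2pi sin2pi cos0 sin0. Qed.
Lemma circ_ccont p S a b : ccont (circ p S) a b.
Proof. by move=> t _; exact: circ_cont. Qed.
Lemma circ_comp (F : R[i]^o -> R[i]^o) p S : 0 <= S ->
 (forall z, N (z - p) = S -> {for z, continuous F}) -> ccont (fun t => F (circ p S t)) 0 (2 * pi).
Proof.
move=> S0 cF t _.
exact: (@continuous_comp _ _ _ (circ p S) F t (@circ_cont p S t) (cF _ (N_circ p t S0))).
Qed.

Lemma mean_eq f g : (forall t, 0 <= t <= 2 * pi -> f t = g t) -> mean f = mean g.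
Proof. by move=> H; rewrite /mean (cint_eq H). Qed.
Lemma meanD f g : ccont f 0 (2 * pi) -> ccont g 0 (2 * pi) -> mean (fun t => f t + g t) = mean f + mean g.
Proof. by move=> cf cg; rewrite /mean (cintD cf cg) mulrDr. Qed.
Lemma meanB f g : ccont f 0 (2 * pi) -> ccont g 0 (2 * pi) -> mean (fun t => f t - g t) = mean f - mean g.
Proof. by move=> cf cg; rewrite /mean (cintB cf cg) mulrBr. Qed.
Lemma meanZ k f : ccont f 0 (2 * pi) -> mean (fun t => k * f t) = k * mean f.
Proof. by move=> cf; rewrite /mean (cintZ _ cf) mulrCA. Qed.
Lemma mean_cst k : mean (fun=> k) = k.
Proof.
rewrite /mean cintC ?twopi_ge0// subr0 mulrCA -rmorphM/= mulVf ?mulr1// gt_eqF//.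
exact: twopi_gt0.
Qed.
Lemma mean_conj f : ccont f 0 (2 * pi) -> mean (fun t => (f t)^*%C) = (mean f)^*%C.
Proof. by move=> cf; rewrite /mean (cint_conj cf) cjM cjR. Qed.
Lemma mean_bnd f M : ccont f 0 (2 * pi) -> (forall t, 0 <= t <= 2 * pi -> N (f t) <= M) ->
  N (mean f) <= 2 * M.
Proof.
move=> cf H; have h := cint_bnd twopi_ge0 cf H.
rewrite /mean Normc.normcM NR ger0_norm ?invr_ge0 ?twopi_ge0// mulrC ler_pdivrMr ?twopi_gt0//.
by move: h; rewrite subr0.
Qed.
Lemma Re_mean f : complex.Re (mean f) = (2 * pi)^-1 * rint 0 (2 * pi) (fun t => complex.Re (f t)).
Proof. by rewrite /mean /cint /= mul0r subr0. Qed.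

Definition hol_disc (F : R[i]^o -> R[i]^o) p S := forall z : R[i]^o, N (z - p) <= S -> exists l, cderiv F z l.

Lemma cone_disc p S (z0 : R[i]^o) t s : 0 <= S -> N (z0 - p) <= S -> 0 <= t <= 1 -> N (cone z0 (circ p S) t s - p) <= S.
Proof.
move=> S0 hz /andP[t0 t1]; rewrite /cone.
rewrite (_ : _ - p = (1 - t)%:C * (z0 - p) + t%:C * (circ p S s - p)); last by rewrite rmorphB/=; ring.
apply: le_trans (ND _ _) _; rewrite !Normc.normcM !NR N_circ// !ger0_norm ?subr_ge0//.
have : (1 - t) * N (z0 - p) <= (1 - t) * S by rewrite ler_wpM2l// subr_ge0.
lra.
Qed.

(** The mean on the right is left unevaluated: its value follows in [mean_kernel] from the case
    [z0 = p], where the kernel is visibly [1]. *)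
Lemma cauchy_raw F p S (z0 : R[i]^o) : 0 < S -> N (z0 - p) < S -> hol_disc F p S ->
  mean (fun t => F (circ p S t) * ((circ p S t - p) / (circ p S t - z0))) =
  F z0 * mean (fun t => (circ p S t - p) / (circ p S t - z0)).
Proof.
move=> S0 hz dF; have r0 : 0 < S - N (z0 - p) by rewrite subr_gt0.
have rc s : S - N (z0 - p) <= N (circ p S s - z0).
  have -> : circ p S s - z0 = (circ p S s - p) - (z0 - p) by ring.
  by apply: le_trans (NB_le _ _); rewrite N_circ// ltW.
have cz s : circ p S s - z0 != 0 by rewrite -N_gt0; apply: lt_le_trans (rc s).
have := @cauchy_curve z0 (circ p S) (fun s => 'i * (circ p S s - p)) 0 (2 * pi) (2 * S) _ F twopi_ge0 _ r0 (fun s _ => circ_deriv p S s).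
have S20 : 0 < 2 * S by rewrite mulr_gt0.
have cc : ccont (fun s => circ p S s - p) 0 (2 * pi).
  exact: (ccontB (@circ_ccont p S 0 (2 * pi)) (@ccontC _ p 0 (2 * pi))).
have Ni : N ('i : R[i]) = 1 by rewrite /= expr0n /= add0r expr1n sqrtr1.
move=> /(_ S20 (ccontM (@ccontC _ 'i 0 (2 * pi)) cc)) H.
have {}H := H _ _ (fun s _ => rc s) (circ_2pi p S) _.
have E : cint 0 (2 * pi) (fun s => F (circ p S s) * ('i * (circ p S s - p) / (circ p S s - z0))) =
     F z0 * cint 0 (2 * pi) (fun s => 'i * (circ p S s - p) / (circ p S s - z0)).
  apply: H.
  - by move=> s _; rewrite Normc.normcM Ni mul1r N_circ ?ltW//; lra.
  - move=> s _; rewrite (_ : _ - z0 = (circ p S s - p) - (z0 - p)); last by ring.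
    by apply: le_trans (NB _ _) _; rewrite N_circ ?ltW//; lra.
  - by move=> t s ht _; apply: dF; apply: cone_disc => //; apply: ltW.
have ck : ccont (fun s => (circ p S s - p) / (circ p S s - z0)) 0 (2 * pi).
  apply: (ccontM cc) => s hs; apply: contV; first exact: cz.
  exact: (contB (@circ_cont p S s) (@contK _ _ z0 s)).
have cF : ccont (fun s => F (circ p S s)) 0 (2 * pi).
  apply: circ_comp; first exact: ltW.
  by move=> z hz'; have [|l /cderiv_cont] := dF z; rewrite ?hz'.
have i0 : ('i : R[i]^o) != 0 by rewrite -N_gt0 Ni.
have E2 : 'i * mean (fun t => F (circ p S t) * ((circ p S t - p) / (circ p S t - z0))) =
  'i * (F z0 * mean (fun t => (circ p S t - p) / (circ p S t - z0))).
  rewrite -(meanZ _ (ccontM cF ck)) mulrCA -(meanZ _ ck) /mean.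
  transitivity (((2 * pi)^-1)%:C * cint 0 (2 * pi) (fun s => F (circ p S s) * ('i * (circ p S s - p) / (circ p S s - z0)))).
    by congr (_ * _); apply: cint_eq => s _; ring.
  rewrite E mulrCA; congr (_ * (_ * _)); apply: cint_eq => s _; ring.
exact: (mulfI i0 E2).
Qed.

Lemma cauchy_center F p S : 0 < S -> hol_disc F p S -> mean (fun t => F (circ p S t)) = F p.
Proof.
move=> S0 dF; have := @cauchy_raw F p S p S0; rewrite subrr Normc.normc0 => /(_ S0 dF).
have cp s : circ p S s - p != 0 by rewrite -N_gt0 N_circ// ltW.
rewrite (_ : mean (fun t => (circ p S t - p) / (circ p S t - p)) = 1); last first.
  by rewrite -[RHS](mean_cst 1); apply: mean_eq => t _; rewrite divff.
rewrite mulr1 => <-; apply: mean_eq => t _; by rewrite divff ?mulr1.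
Qed.

(* On the circle, conjugation is the reflection [z - p |-> S ^ 2 / conj (z - p)]. *)
Lemma conj_kernel p S (z0 : R[i]^o) : 0 < S -> N (z0 - p) < S ->
  exists H : R[i]^o -> R[i]^o, [/\ hol_disc H p S, H p = 1 &
    forall t, ((circ p S t - p) / (circ p S t - z0))^*%C = H (circ p S t)].
Proof.
move=> S0 hz; set w := z0 - p.
pose D (z : R[i]^o) : R[i]^o := 1 - (w^*%C / (S ^+ 2)%:C) * (z - p).
have SS : (S ^+ 2)%:C != 0 :> R[i]^o by rewrite -N_gt0 NR normr_gt0 gt_eqF// exprn_gt0.
have D0 z : N (z - p) <= S -> D z != 0.
  move=> hz'; rewrite -N_gt0; apply: lt_le_trans (NB_le _ _); rewrite Normc.normc1 subr_gt0.
  rewrite !Normc.normcM Normc.normcV N_conj NR ger0_norm ?sqr_ge0// mulrAC ltr_pdivrMr ?exprn_gt0// mul1r.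
  apply: (@le_lt_trans _ _ (N w * S)); first by rewrite ler_wpM2l ?N_ge0.
  by rewrite expr2 ltr_pM2r.
have dD z : exists l, cderiv D z l.
  have h1 := cderivD (cderiv_id z) (cderiv_cst (- p) z).
  have h2 := cderivM (cderiv_cst (w^*%C / (S ^+ 2)%:C) z) h1.
  have h3 := cderivD (cderiv_cst 1 z) (cderivM (cderiv_cst (-1) z) h2).
  eexists; apply: cderiv_near h3; near=> x; rewrite /D mulN1r //.
have dH : hol_disc (fun z => (D z)^-1) p S.
  move=> z /D0 h; have [l hl] := dD z; eexists; exact: (cderivV h hl).
exists (fun z => (D z)^-1); split; [exact: dH|by rewrite /D subrr mulr0 subr0 invr1|].
move=> t; rewrite -[RHS]conjcK; congr (_^*%C).
set c := circ p S t - p.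
have cS : c * c^*%C = (S ^+ 2)%:C.
  by rewrite -sqr_normc NE N_circ ?ltW// rmorphXn.
have c0 : c != 0 by rewrite -N_gt0 N_circ// ltW.
have cc0 : c^*%C != 0 by rewrite conjc_eq0.
rewrite cjV cjB cjM cjM cjV cj1 conjcK cjR -/c -cS (_ : circ p S t - z0 = c - w); last by rewrite /c /w; ring.
rewrite (_ : 1 - w / (c * c^*%C) * c^*%C = (c - w) / c); last by field; rewrite c0 cc0.
by rewrite invf_div.
Unshelve. all: by end_near. Qed.

(** The conjugate of the kernel consists of the boundary values of a function that is holomorphic in
    the whole disc and equal to [1] at the centre, so the mean value property applies to it. *)
Lemma mean_kernel p S (z0 : R[i]^o) : 0 < S -> N (z0 - p) < S ->
  mean (fun t => (circ p S t - p) / (circ p S t - z0)) = 1.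
Proof.
move=> S0 hz; have [H [dH H1 HE]] := conj_kernel S0 hz.
have := cauchy_center S0 dH; rewrite H1 => E.
have cH : ccont (fun t => H (circ p S t)) 0 (2 * pi).
  apply: circ_comp; first exact: ltW.
  by move=> z hz'; have [|l /cderiv_cont] := dH z; rewrite ?hz'.
have := mean_conj cH; rewrite E cj1 => <-.
by apply: mean_eq => t _; rewrite -HE conjcK.
Qed.

Lemma cauchy F p S (z0 : R[i]^o) : 0 < S -> N (z0 - p) < S -> hol_disc F p S ->
  mean (fun t => F (circ p S t) * ((circ p S t - p) / (circ p S t - z0))) = F z0.
Proof. by move=> S0 hz dF; rewrite cauchy_raw// mean_kernel// mulr1. Qed.

Lemma circ_off p S z t : N (z - p) < S -> S - N (z - p) <= N (circ p S t - z).
Proof.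
move=> hz; have S0 : 0 <= S by rewrite (le_trans (N_ge0 _) (ltW hz)).
have -> : circ p S t - z = (circ p S t - p) - (z - p) by ring.
by apply: le_trans (NB_le _ _); rewrite N_circ.
Qed.
Lemma circ_off0 p S z t : N (z - p) < S -> circ p S t - z != 0.
Proof.
by move=> hz; rewrite -N_gt0; apply: lt_le_trans (circ_off t hz); rewrite subr_gt0.
Qed.

Definition cauchy_int n (g : R -> R[i]^o) p S z : R[i]^o :=
  mean (fun t => g t / (circ p S t - z) ^+ n).

Lemma ccont_cauchy n g p S z : ccont g 0 (2 * pi) -> N (z - p) < S ->
  ccont (fun t => g t / (circ p S t - z) ^+ n) 0 (2 * pi).
Proof.
move=> cg hz t ht; apply: (contM (cg t ht)); apply: contV.
  by rewrite expf_neq0// circ_off0.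
elim: n => [|n IH].
  by rewrite (_ : (fun u => _) = (fun=> 1)); [exact: contK|apply/funext].
rewrite (_ : (fun u => _) = (fun u => (circ p S u - z) * (circ p S u - z) ^+ n)); last first.
  by apply/funext => u; rewrite exprS.
exact: (contM (contB (@circ_cont p S t) (@contK _ _ z t)) IH).
Qed.

Lemma open_disc p S z (P : R[i]^o -> Prop) : N (z - p) < S ->
  (forall w, N (w - p) < S -> P w) -> \forall w \near z, P w.
Proof.
move=> hz H; apply/nbhsN; exists (S - N (z - p)); first by rewrite subr_gt0.
move=> w hw; apply: H; have -> : w - p = (w - z) + (z - p) by ring.
by apply: le_lt_trans (ND _ _) _; rewrite -ltrBrDr.
Qed.

(** Differentiation under the integral sign: what it takes is a second order Taylor bound for
    [a |-> a ^- n], uniform in [a] away from [0]. The cases [n = 1] and [n = 2] follow, each with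
    its remainder in closed form. *)
Lemma cauchy_kernel_deriv (n : nat) (K : R) g p S z : ccont g 0 (2 * pi) -> N (z - p) < S -> 0 <= K ->
  (forall (a h : R[i]^o), S - N (z - p) <= N a -> N h <= (S - N (z - p)) / 2 ->
    N ((a - h) ^- n - a ^- n - n%:R * a ^- n.+1 * h) <= K * N h ^+ 2) ->
  cderiv (cauchy_int n g p S) z (n%:R * cauchy_int n.+1 g p S z).
Proof.
move=> cg hz K0 HK; set r := S - N (z - p) in HK *.
have r0 : 0 < r by rewrite subr_gt0.
have [M M0 gM] := ccont_bounded twopi_ge0 cg.
apply/cderivP => e e0.
have c0 : 0 < 2 * (M * K) + 1 by rewrite ltr_wpDl// mulr_ge0// mulr_ge0// ltW.
exists (Num.min (r / 2) (e / (2 * (M * K) + 1))); first by rewrite lt_min !divr_gt0.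
move=> w; rewrite lt_min => /andP[h1 h2].
have hw : N (w - p) < S.
  have -> : w - p = (w - z) + (z - p) by ring.
  apply: le_lt_trans (ND _ _) _; rewrite -ltrBrDr; apply: lt_le_trans h1 _.
  by rewrite -/r; lra.
have c1 := ccont_cauchy (n:=n) cg hw; have c2 := ccont_cauchy (n:=n) cg hz; have c3 := ccont_cauchy (n:=n.+1) cg hz.
have -> : cauchy_int n g p S w - cauchy_int n g p S z - n%:R * cauchy_int n.+1 g p S z * (w - z) =
  mean (fun t => (g t / (circ p S t - w) ^+ n - g t / (circ p S t - z) ^+ n) - (n%:R * (w - z)) * (g t / (circ p S t - z) ^+ n.+1)).
  rewrite (meanB (ccontB c1 c2) (ccontM (@ccontC _ (n%:R * (w - z)) 0 (2 * pi)) c3)).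
  by rewrite (meanB c1 c2) (meanZ _ c3) -/(cauchy_int n g p S w) -/(cauchy_int n g p S z) mulrAC.
apply: (@le_trans _ _ (2 * (M * (K * N (w - z) ^+ 2)))).
  apply: mean_bnd.
    exact: (ccontB (ccontB c1 c2) (ccontM (@ccontC _ (n%:R * (w - z)) 0 (2 * pi)) c3)).
  move=> t ht; set a := circ p S t - z.
  have -> : circ p S t - w = a - (w - z) by rewrite /a; ring.
  have -> : g t / (a - (w - z)) ^+ n - g t / a ^+ n - n%:R * (w - z) * (g t / a ^+ n.+1) =
    g t * ((a - (w - z)) ^- n - a ^- n - n%:R * a ^- n.+1 * (w - z)) by ring.
  rewrite Normc.normcM; apply: ler_pM; [exact: N_ge0|exact: N_ge0|exact: gM|].
  by apply: HK; [exact: circ_off|exact: ltW].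
rewrite expr2 (_ : 2 * _ = (2 * (M * K) * N (w - z)) * N (w - z)); last by ring.
rewrite ler_wpM2r ?N_ge0//; move: h2; rewrite ltr_pdivlMr// => h2.
apply: le_trans (ltW h2); rewrite mulrC ler_wpM2l ?N_ge0// lerDl ler01//.
Qed.

Lemma cauchy_int1_deriv g p S z : ccont g 0 (2 * pi) -> N (z - p) < S ->
  cderiv (cauchy_int 1 g p S) z (cauchy_int 2 g p S z).
Proof.
move=> cg hz; rewrite -[X in cderiv _ _ X]mul1r; have r0 : 0 < S - N (z - p) by rewrite subr_gt0.
move: (S - N (z - p)) r0 (@cauchy_kernel_deriv 1 (2 / (S - N (z - p)) ^+ 3) g p S z cg hz) => r r0.
apply; first by rewrite divr_ge0// exprn_ge0// ltW.
move=> a h ra hr; rewrite expr1.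
have a0 : a != 0 by rewrite -N_gt0; apply: lt_le_trans ra.
have ah : r / 2 <= N (a - h) by apply: le_trans (NB_le _ _); lra.
have ah0 : a - h != 0 by rewrite -N_gt0; apply: lt_le_trans ah; rewrite divr_gt0.
rewrite (_ : _ - _ = (a ^+ 2 * (a - h))^-1 * h ^+ 2); last by field; rewrite a0 ah0.
rewrite Normc.normcM NX Normc.normcV Normc.normcM NX ler_wpM2r ?sqr_ge0//.
rewrite -[leRHS]invf_div lef_pV2 ?posrE; last 2 first.
- by rewrite mulr_gt0 ?exprn_gt0// N_gt0.
- by rewrite divr_gt0// exprn_gt0.
rewrite exprSr -mulrA; apply: ler_pM => //; rewrite ?sqr_ge0 ?divr_ge0//; first exact: ltW.
by rewrite ler_pXn2r// nnegrE ?N_ge0// ltW.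
Qed.

Lemma cauchy_int2_deriv g p S z : ccont g 0 (2 * pi) -> N (z - p) < S ->
  cderiv (cauchy_int 2 g p S) z (2 * cauchy_int 3 g p S z).
Proof.
move=> cg hz; have r0 : 0 < S - N (z - p) by rewrite subr_gt0.
move: (S - N (z - p)) r0 (@cauchy_kernel_deriv 2 (16 / (S - N (z - p)) ^+ 4) g p S z cg hz) => r r0.
apply; first by rewrite divr_ge0// exprn_ge0// ltW.
move=> a h ra hr.
have Na0 : 0 < N a by apply: lt_le_trans ra.
have a0 : a != 0 by rewrite -N_gt0.
have ah : r / 2 <= N (a - h) by apply: le_trans (NB_le _ _); lra.
have r20 : 0 < r / 2 by rewrite divr_gt0.
have ah0 : a - h != 0 by rewrite -N_gt0; apply: lt_le_trans ah.
rewrite (_ : _ - _ = (3 * a - 2 * h) / a * ((a ^+ 2 * (a - h) ^+ 2)^-1 * h ^+ 2)); last by field; rewrite a0 ah0.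
rewrite Normc.normcM [N (_^-1 * _)]Normc.normcM NX Normc.normcV [N (_ ^+ 2 * _)]Normc.normcM !NX [N (_ / a)]Normc.normcM Normc.normcV mulrA ler_wpM2r ?sqr_ge0//.
(* This uses [|h| <= r / 2 <= |a| / 2]. The other factor is at most [4 / r ^ 4], which explains the
   16. *)
have h1 : N (3 * a - 2 * h) / N a <= 4.
  rewrite ler_pdivrMr//; apply: le_trans (NB _ _) _; rewrite !Normc.normcM.
  have -> : N (3 : R[i]) = 3 by rewrite (_ : 3 = (3 : R)%:C) ?NR ?normr_nat// rmorph_nat.
  have -> : N (2 : R[i]) = 2 by rewrite (_ : 2 = (2 : R)%:C) ?NR ?normr_nat// rmorph_nat.
  lra.
have h2 : (N a ^+ 2 * N (a - h) ^+ 2)^-1 <= 4 / r ^+ 4.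
  rewrite -[leRHS]invf_div lef_pV2 ?posrE; last 2 first.
  - by rewrite mulr_gt0 ?exprn_gt0// N_gt0.
  - by rewrite divr_gt0// exprn_gt0.
  rewrite (_ : r ^+ 4 / 4 = r ^+ 2 * (r / 2) ^+ 2); last by field.
  by apply: ler_pM; rewrite ?sqr_ge0// ler_pXn2r// nnegrE ?N_ge0// ltW.
rewrite (_ : 16 / r ^+ 4 = 4 * (4 / r ^+ 4)); last by field; rewrite gt_eqF.
apply: ler_pM => //; first by rewrite divr_ge0 ?N_ge0.
by rewrite invr_ge0 mulr_ge0 ?sqr_ge0.
Qed.

Lemma hol_disc_ccont F p S : 0 <= S -> hol_disc F p S -> ccont (fun t => F (circ p S t)) 0 (2 * pi).
Proof.
move=> S0 dF; apply: circ_comp => // z hz.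
by have [|l /cderiv_cont] := dF z; rewrite ?hz.
Qed.
Lemma circ_sub_ccont p S a b : ccont (fun t => circ p S t - p) a b.
Proof. move=> t _; exact: (contB (@circ_cont p S t) (@contK _ _ p t)). Qed.

Lemma cauchy_int_repr F p S z : 0 < S -> hol_disc F p S -> N (z - p) < S ->
  F z = cauchy_int 1 (fun t => F (circ p S t) * (circ p S t - p)) p S z.
Proof.
move=> S0 dF hz; rewrite -(cauchy S0 hz dF); apply: mean_eq => t _.
by rewrite expr1 mulrA.
Qed.

(* Holomorphic functions are differentiable twice, because Cauchy integrals
   are. *)
Lemma hol_deriv2 F p S : 0 < S -> hol_disc F p S ->
  exists F' : R[i]^o -> R[i]^o, forall z, N (z - p) < S ->
    cderiv F z (F' z) /\ exists l, cderiv F' z l.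
Proof.
move=> S0 dF; pose g t : R[i]^o := F (circ p S t) * (circ p S t - p).
have cg : ccont g 0 (2 * pi) := ccontM (hol_disc_ccont (ltW S0) dF) (@circ_sub_ccont p S _ _).
exists (cauchy_int 2 g p S) => z hz; split; last by eexists; exact: cauchy_int2_deriv.
apply: cderiv_near (cauchy_int1_deriv cg hz).
by apply: (open_disc hz) => w hw; rewrite (cauchy_int_repr S0 dF hw).
Qed.

(** [G k] is the Cauchy integral of [F / (z - p) ^ k], and its value at [p] is the [k]-th Taylor
    coefficient. As long as the earlier coefficients vanish, [F = (z - p) ^ k * G k]. If all of them
    vanish, this gives [|F z| <= const * (|z - p| / S) ^ k] for every [k], hence [F z = 0]. *)
Lemma local_order F p S : 0 < S -> hol_disc F p S ->
  (forall z, N (z - p) < S -> F z = 0) \/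
  exists k (G : R[i]^o -> R[i]^o), [/\ G p != 0, forall z, N (z - p) < S -> exists l, cderiv G z l &
     forall z, N (z - p) < S -> F z = (z - p) ^+ k * G z].
Proof.
move=> S0 dF; pose g k t : R[i]^o := F (circ p S t) * (circ p S t - p) / (circ p S t - p) ^+ k.
have pp : N (p - p) < S by rewrite subrr Normc.normc0.
have cg k : ccont (g k) 0 (2 * pi).
  apply: (ccont_cauchy _ pp).
  exact: ccontM (hol_disc_ccont (ltW S0) dF) (@circ_sub_ccont p S _ _).
pose G k := cauchy_int 1 (g k) p S.
have dG k z : N (z - p) < S -> exists l, cderiv (G k) z l.
  by move=> hz; eexists; exact: cauchy_int1_deriv.
have G0 z : N (z - p) < S -> F z = G 0%N z.
  move=> hz; rewrite (cauchy_int_repr S0 dF hz); apply: mean_eq => t _.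
  by rewrite /g expr0 divr1.
have GS k z : N (z - p) < S -> (z - p) * G k.+1 z = G k z - G k p.
  move=> hz; rewrite /G /cauchy_int -(meanZ _ (ccont_cauchy (cg k.+1) hz)).
  rewrite -(meanB (ccont_cauchy (cg k) hz) (ccont_cauchy (cg k) pp)); apply: mean_eq => t _.
  have a0 := circ_off0 t hz; have b0 := circ_off0 t pp.
  rewrite /g !expr1 exprS invfM; have := expf_neq0 k b0; move: (_ ^+ k) => X X0.
  have e : z - p = (circ p S t - p) - (circ p S t - z) by ring.
  rewrite e; move: (circ p S t - p) (circ p S t - z) a0 b0 => u v u0 v0.
  by field; rewrite u0 v0 X0.
have step k : (forall j, (j < k)%N -> G j p = 0) -> forall z, N (z - p) < S -> F z = (z - p) ^+ k * G k z.
  elim: k => [_ z hz|k IH H z hz]; first by rewrite expr0 mul1r G0.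
  rewrite (IH _ z hz); last by move=> j jk; apply: H; apply: ltnW.
  by rewrite exprSr -mulrA GS// H// subr0.
case: (pselect (exists k, G k p != 0)) => [ex|nex].
  right; have [k hk kmin] := ex_minnP ex.
  exists k, (G k); split; [by []|exact: dG|].
  apply: step => j jk; apply/eqP; apply: contraTT jk => /kmin; by rewrite -leqNgt.
left => z hz; apply: contR_eq0 => e e0.
have all0 j : G j p = 0 by apply/eqP; apply: contrapT => /negP h; apply: nex; exists j.
have [M M0 hM] := ccont_bounded twopi_ge0 (cg 0%N).
have r0 : 0 < S - N (z - p) by rewrite subr_gt0.
have bnd k : N (F z) <= (N (z - p) / S) ^+ k * (2 * (M / (S - N (z - p)))).
  rewrite (step k)//; rewrite Normc.normcM NX expr_div_n -mulrA ler_wpM2l ?exprn_ge0 ?N_ge0//.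
  have -> : (S ^+ k)^-1 * (2 * (M / (S - N (z - p)))) = 2 * (M / S ^+ k / (S - N (z - p))) by ring.
  apply: mean_bnd; first exact: ccont_cauchy.
  move=> t ht; rewrite expr1.
  have := hM t ht; rewrite /g expr0 divr1; move: (F _ * _) => u h1.
  have h2 : N (u / (circ p S t - p) ^+ k) <= M / S ^+ k.
    rewrite Normc.normcM Normc.normcV NX N_circ; last exact: ltW.
    by rewrite ler_wpM2r// invr_ge0 exprn_ge0// ltW.
  rewrite Normc.normcM Normc.normcV; apply: ler_pM; [exact: N_ge0|by rewrite invr_ge0 N_ge0|exact: h2|].
  rewrite lef_pV2 ?posrE//; first exact: circ_off.
  by apply: lt_le_trans (circ_off t hz).
have q1 : N (z - p) / S < 1 by rewrite ltr_pdivrMr// mul1r.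
have q0 : 0 <= N (z - p) / S by rewrite divr_ge0 ?N_ge0// ltW.
set A := 2 * _ in bnd; have A0 : 0 < A by rewrite !mulr_gt0// invr_gt0.
have /cvg_expr /cvgrPdist_lt /(_ (e / A) (divr_gt0 e0 A0)) [n _ /(_ n (leqnn n))] : `|N (z - p) / S| < 1.
  by rewrite ger0_norm.
rewrite sub0r normrN ger0_norm ?exprn_ge0// ltr_pdivlMr// => /ltW; exact: le_trans (bnd n).
Qed.
End Cauchy.

(** * Jensen's formula and Poisson's estimate without zeros *)

Section Primitive.
Context {R : realType}.
Implicit Types (z w : R[i]^o) (S t s : R).

Definition ray_int (Q : R[i]^o -> R[i]^o) z : R[i]^o := cint 0 1 (fun t => Q (t%:C * z) * z).

Lemma N_ray z S t : N z < S -> 0 <= t <= 1 -> N ((t%:C : R[i]^o) * z) < S.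
Proof.
move=> hz /andP[t0 t1]; rewrite Normc.normcM NR ger0_norm//.
by apply: le_lt_trans hz; rewrite ler_piMl ?N_ge0.
Qed.

(** Goursat on the triangle with apex [0] over the segment from [z] to [w]: the difference of the
    two ray integrals is the integral along that segment, and the side at height [0] degenerates to
    a point. *)
Lemma primitive (Q : R[i]^o -> R[i]^o) S : (forall z, N z < S -> exists l, cderiv Q z l) ->
  forall z, N z < S -> cderiv (ray_int Q) z (Q z).
Proof.
move=> dQ z hz; apply/cderivP => e e0.
have [l /cderiv_cont /contCP cQ] := dQ z hz.
have e20 : 0 < e / 2 by rewrite divr_gt0.
have [d d0 hd] := cQ _ e20.
exists (Num.min d (S - N z)); first by rewrite lt_min d0 subr_gt0.
move=> w; rewrite lt_min => /andP[wd wS]; set k := w - z in wd wS *.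
have seg s : 0 <= s <= 1 -> N (z + (s%:C : R[i]^o) * k) < S.
  move=> /andP[s0 s1]; apply: le_lt_trans (ND _ _) _; rewrite Normc.normcM NR ger0_norm//.
  have : s * N k <= N k by rewrite ler_piMl ?N_ge0.
  by move: wS; lra.
have wz : w = z + k by rewrite /k addrC subrK.
pose c s : R[i]^o := z + (s%:C : R[i]^o) * k.
have dc s : 0 <= s <= 1 -> rderiv c s k.
  move=> _; have h := rderivD (rderiv_cst z s) (rderivM (rderiv_id s) (rderiv_cst k s)).
  by rewrite add0r mul1r mulr0 addr0 in h.
pose M := 1 + N z + N k.
have M0 : 0 < M by rewrite /M; have := N_ge0 z; have := N_ge0 k; lra.
have coneE t s : cone 0 c t s = (t%:C : R[i]^o) * c s by rewrite /cone add0r subr0.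
have := @cone_goursat _ 0 c (fun=> k) 0 1 0 1 M (lexx 0) ler01 (lexx 1) ler01 M0 dc (@ccontC _ k 0 1).
move=> /(_ _ _ Q) H.
have {H} : cone_form 0 c (fun=> k) Q 0 1 0 1 = 0.
  apply: H.
  - by move=> s _; rewrite /M; have := N_ge0 z; lra.
  - move=> s hs; rewrite subr0; apply: le_trans (ND _ _) _; rewrite Normc.normcM NR.
    case/andP: hs => s0 s1; rewrite ger0_norm//.
    have : s * N k <= N k by rewrite ler_piMl ?N_ge0.
    by rewrite /M; lra.
  - move=> t s ht hs; apply: dQ; rewrite coneE; exact: N_ray (seg s hs) ht.
rewrite /cone_form.
have -> : cint 0 1 (fun u => Q (cone 0 c u 1) * (c 1 - 0)) = ray_int Q w.
  by apply: cint_eq => t _; rewrite coneE subr0 /c mul1r -wz.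
have -> : cint 0 1 (fun u => Q (cone 0 c u 0) * (c 0 - 0)) = ray_int Q z.
  by apply: cint_eq => t _; rewrite coneE subr0 /c mul0r addr0.
have -> : cint 0 1 (fun v => Q (cone 0 c 0 v) * (0%:C * k)) = 0.
  transitivity (cint 0 1 (fun=> 0 : R[i]^o)); last by rewrite cintC ?ler01// mul0r.
  by apply: cint_eq => t _; rewrite mul0r mulr0.
have cc : ccont (fun v => Q (c v)) 0 1.
  move=> s hs; have [m /cderiv_cont cQs] := dQ _ (seg s hs).
  exact: (@continuous_comp _ _ _ c Q s (rderiv_cont (dc s hs)) cQs).
have -> : cint 0 1 (fun v => Q (cone 0 c 1 v) * (1%:C * k)) = k * cint 0 1 (fun v => Q (c v)).
  rewrite -(cintZ _ cc); apply: cint_eq => t _.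
  by rewrite coneE !mul1r mulrC.
rewrite subr0 => /eqP; rewrite subr_eq0 => /eqP ->.
have -> : k * cint 0 1 (fun v => Q (c v)) - Q z * k = k * cint 0 1 (fun v => Q (c v) - Q z).
  rewrite (cintB cc (@ccontC _ (Q z) 0 1)) cintC ?ler01// subr0 mulr1; ring.
rewrite Normc.normcM mulrC ler_wpM2r ?N_ge0//.
have := @cint_bnd _ (fun v => Q (c v) - Q z) 0 1 (e / 2) ler01 (ccontB cc (@ccontC _ (Q z) 0 1)).
rewrite subr0 mulr1 (_ : 2 * (e / 2) = e); last by field.
apply=> s /andP[s0 s1]; apply/ltW/hd; rewrite /c addrAC subrr add0r Normc.normcM NR ger0_norm//.
by apply: le_lt_trans wd; rewrite ler_piMl ?N_ge0.
Qed.

Lemma N_sqr z : N z ^+ 2 = complex.Re z ^+ 2 + complex.Im z ^+ 2.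
Proof. by case: z => a b /=; rewrite sqr_sqrtr// addr_ge0// sqr_ge0. Qed.

(** Computed from half the logarithm of [Re ^ 2 + Im ^ 2], which avoids differentiating the square
    root in the modulus. *)
Lemma lnN_deriv (g : R -> R[i]^o) t (l : R[i]^o) : g t != 0 -> rderiv g t l ->
  is_derive t (1 : R) (fun u => ln (N (g u))) (complex.Re (l / g t)).
Proof.
move=> g0 dg; have d1 := rderiv_Re dg; have d2 := rderiv_Im dg.
have cg := rderiv_cont dg.
pose f u := complex.Re (g u) ^+ 2 + complex.Im (g u) ^+ 2.
have fN u : f u = N (g u) ^+ 2 by rewrite N_sqr.
have f0 : 0 < f t by rewrite fN exprn_gt0// N_gt0.
have df : is_derive t (1 : R) f (2 * (complex.Re (g t) * complex.Re l + complex.Im (g t) * complex.Im l)).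
  have h := is_deriveD (is_deriveM d1 d1) (is_deriveM d2 d2).
  rewrite (_ : f = (fun u => complex.Re (g u)) * (fun u => complex.Re (g u)) + (fun u => complex.Im (g u)) * (fun u => complex.Im (g u))); last first.
    by apply/funext.
  rewrite (_ : 2 * _ = complex.Re (g t) *: complex.Re l + complex.Re (g t) *: complex.Re l +
   (complex.Im (g t) *: complex.Im l + complex.Im (g t) *: complex.Im l)); first exact: h.
  by rewrite /GRing.scale/=; ring.
have h := is_deriveZ (2^-1) (@is_derive1_comp _ (@ln R) f t _ _ (is_derive1_ln f0) df).
rewrite (_ : complex.Re (l / g t) = 2^-1 *: ((f t)^-1 *: (2 * (complex.Re (g t) * complex.Re l + complex.Im (g t) * complex.Im l)))).
  apply: near_eq_is_derive h.
  have : \forall u \near t, g u != 0.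
    have /contRCP/(_ (N (g t))) := cg; rewrite N_gt0 => /(_ g0) [d dp hd].
    apply/nbhs_ballP; exists d => //= u; rewrite -ball_normE /= distrC => /hd.
    by apply: contraTneq => ->; rewrite sub0r NN ltxx.
  apply: filterS => u gu; rewrite [LHS](_ : _ = 2^-1 * ln (f u))// fN lnXn ?N_gt0//.
  by rewrite -mulr_natr; field.
rewrite /f /GRing.scale /=; move: f0 g0; rewrite /f; clear; case: (g t) l => a b [c d] /= f0 g0.
by field; rewrite gt_eqF.
Qed.

Variables (h : R[i]^o -> R[i]^o) (rho : R).
Hypothesis dh : forall z, N z <= rho -> exists l, cderiv h z l.
Hypothesis h0 : forall z, N z <= rho -> h z != 0.

(** [L] is a primitive of [h' / h], shifted to be right at [0]. Along each ray from [0] the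
    functions [Re L] and [ln |h|] have the same derivative. *)
Lemma log_primitive : 0 < rho -> exists L : R[i]^o -> R[i]^o,
  (forall z, N z < rho -> exists l, cderiv L z l) /\
  forall z, N z < rho -> complex.Re (L z) = ln (N (h z)).
Proof.
move=> r0; have hd : hol_disc h 0 rho by move=> z; rewrite subr0 => /dh.
have [h' hh'] := hol_deriv2 r0 hd.
pose Q z := h' z / h z.
have dQ z : N z < rho -> exists l, cderiv Q z l.
  move=> hz; have := hh' z; rewrite subr0 => /(_ hz) [d1 [l d2]].
  by eexists; exact: (cderivM d2 (cderivV (h0 (ltW hz)) d1)).
have dL := primitive dQ.
exists (fun z => ray_int Q z + (ln (N (h 0)))%:C); split.
  by move=> z hz; eexists; exact: (cderivD (dL z hz) (cderiv_cst _ z)).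
move=> z hz; rewrite raddfD /= -[X in _ = X](subrK (ln (N (h 0)))); congr (_ + _).
have cQ : ccont (fun t => Q ((t%:C : R[i]^o) * z) * z) 0 1.
  move=> t ht; have [m /cderiv_cont cm] := dQ _ (N_ray hz ht).
  have dt := rderivM (rderiv_id t) (rderiv_cst z t).
  exact: (contM (@continuous_comp _ _ _ (fun u : R => (u%:C : R[i]^o) * z) Q t (rderiv_cont dt) cm) (@contK _ _ z t)).
have -> : ln (N (h z)) - ln (N (h 0)) = ln (N (h ((1%:C : R[i]^o) * z))) - ln (N (h ((0%:C : R[i]^o) * z))).
  by rewrite mul1r mul0r.
apply: (rint_ftc ler01 (ccont_Re cQ) (F := fun t => ln (N (h ((t%:C : R[i]^o) * z))))) => t ht.
have hz' := N_ray hz ht.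
have [d1 _] : cderiv h ((t%:C : R[i]^o) * z) (h' ((t%:C : R[i]^o) * z)) /\ True.
  by split=> //; have := hh' ((t%:C : R[i]^o) * z); rewrite subr0 => /(_ hz') [].
have dt := rderivM (rderiv_id t) (rderiv_cst z t).
have := lnN_deriv (h0 (ltW hz')) (rderiv_comp d1 dt).
by rewrite mul1r mulr0 addr0 /Q mulrAC.
Qed.

Lemma lnN_ccont S : 0 < S -> S < rho -> contab (fun t => ln (N (h (circ 0 S t)))) 0 (2 * pi).
Proof.
move=> S0 Sr t _; have NS : N (circ 0 S t) <= rho by rewrite -[circ _ _ _]subr0 N_circ ltW.
have [l d1] := dh NS.
have [dd _] := lnN_deriv (h0 NS) (rderiv_comp d1 (circ_deriv 0 S t)).
exact/differentiable_continuous/derivable1_diffP.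
Qed.

Lemma jensen_nonvanishing S : 0 < S -> S < rho ->
  rint 0 (2 * pi) (fun t => ln (N (h (circ 0 S t)))) = 2 * pi * ln (N (h 0)).
Proof.
move=> S0 Sr; have r0 : 0 < rho by apply: lt_trans Sr.
have [L [dL LE]] := log_primitive r0.
have dLS : hol_disc L 0 S by move=> z; rewrite subr0 => hz; apply: dL; apply: le_lt_trans Sr.
have := cauchy_center S0 dLS => /(congr1 (@complex.Re R)); rewrite Re_mean LE ?Normc.normc0//.
rewrite (@rint_eq _ _ (fun t => ln (N (h (circ 0 S t))))); last first.
  by move=> t _; rewrite LE// -[circ _ _ _]subr0 N_circ// ltW.
move=> <-; rewrite mulrA divff ?mul1r// gt_eqF//; exact: twopi_gt0.
Qed.

(** The gain [|x - y| / S] is that of the difference of kernels [c (x - y) / ((c - x) (c - y))], at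
    most [4 |x - y| / S] because [x] and [y] stay at distance [S / 2] from the circle. The remaining
    factor 2 comes from writing [2 Re L] as [L] plus its conjugate. *)
Lemma poisson_bound S (x y : R[i]^o) : 0 < S -> S < rho -> N x <= S / 2 -> N y <= S / 2 ->
  `|ln (N (h x)) - ln (N (h y))| <= 8 * N (x - y) / S * ((2 * pi)^-1 * rint 0 (2 * pi) (fun t => `|ln (N (h (circ 0 S t)))|)).
Proof.
move=> S0 Sr hx hy; have r0 : 0 < rho by apply: lt_trans Sr.
have S20 : S / 2 < S by lra.
have [L [dL LE]] := log_primitive r0.
have dLS : hol_disc L 0 S by move=> z; rewrite subr0 => hz; apply: dL; apply: le_lt_trans Sr.
pose c := circ 0 S.
have NS t : N (c t) = S by rewrite -[c t]subr0 N_circ// ltW.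
pose k (z : R[i]^o) t : R[i]^o := (c t - 0) / (c t - z).
have kc z : N z <= S / 2 -> ccont (k z) 0 (2 * pi).
  move=> hz t _; apply: (contM (contB (@circ_cont R 0 S t) (@contK _ _ 0 t))); apply: contV.
    by apply: circ_off0; rewrite subr0; apply: le_lt_trans S20.
  exact: (contB (@circ_cont R 0 S t) (@contK _ _ z t)).
have Lc := hol_disc_ccont (ltW S0) dLS; rewrite -/c in Lc.
have LcJ : ccont (fun t => (L (c t))^*%C) 0 (2 * pi).
  move=> t ht; apply/contRCP => e e0; have /contRCP/(_ _ e0) [d d0 hd] := Lc t ht.
  by exists d => // u /hd; rewrite -cjB N_conj.
have E1 z : N z <= S / 2 -> mean (fun t => L (c t) * k z t) = L z.
  by move=> hz; apply: cauchy => //; rewrite subr0; apply: le_lt_trans S20.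
(* Adding the conjugate of [L], whose Cauchy integral is the constant
   [conj (L 0)], leaves the real part of [L] under the integral sign. *)
have E2 z : N z <= S / 2 -> mean (fun t => (L (c t))^*%C * k z t) = (L 0)^*%C.
  move=> hz; have hz' : N (z - 0) < S by rewrite subr0; apply: le_lt_trans S20.
  have [H [dH H1 HE]] := conj_kernel S0 hz'.
  have dLH : hol_disc (fun z => L z * H z) 0 S.
    by move=> v hv; have [a ha] := dLS v hv; have [b hb] := dH v hv; eexists; exact: (cderivM ha hb).
  have := cauchy_center S0 dLH; rewrite H1 mulr1 => <-.
  rewrite -mean_conj; last exact: (ccontM Lc (hol_disc_ccont (ltW S0) dH)).
  by apply: mean_eq => t _; rewrite cjM -HE conjcK.
have E : L x - L y = mean (fun t => (2 * ln (N (h (c t))))%:C * (k x t - k y t)).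
  transitivity ((L x + (L 0)^*%C) - (L y + (L 0)^*%C)); first by ring.
  have A z : N z <= S / 2 -> L z + (L 0)^*%C = mean (fun t => (2 * ln (N (h (c t))))%:C * k z t).
    move=> hz; rewrite -E1// -(E2 z)// -meanD; last 2 first.
    - exact: (ccontM Lc (kc z hz)).
    - exact: (ccontM LcJ (kc z hz)).
    apply: mean_eq => t _; rewrite -mulrDl addcJ LE ?NS// rmorphM/=; congr (_ * _ * _).
    by rewrite rmorph_nat.
  rewrite !A// -meanB; last 2 first.
  - move=> t ht; apply: (contM _ (kc x hx t ht)).
    have cl := lnN_ccont S0 Sr ht.
    apply: (@continuous_comp _ _ _ (fun t => 2 * ln (N (h (c t)))) (fun u : R => u%:C : R[i]^o)); last exact: ofR_cont.
    exact: (contabM (@contabC _ 2 0 (2 * pi)) (lnN_ccont S0 Sr) ht).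
  - move=> t ht; apply: (contM _ (kc y hy t ht)).
    apply: (@continuous_comp _ _ _ (fun t => 2 * ln (N (h (c t)))) (fun u : R => u%:C : R[i]^o)); last exact: ofR_cont.
    exact: (contabM (@contabC _ 2 0 (2 * pi)) (lnN_ccont S0 Sr) ht).
  by apply: mean_eq => t _; rewrite mulrBr.
have r2 : S / 2 < rho by apply: lt_trans Sr.
rewrite -!LE; [|exact: le_lt_trans r2|exact: le_lt_trans r2].
rewrite -raddfB/= E Re_mean normrM ger0_norm ?invr_ge0 ?twopi_ge0//.
rewrite mulrCA ler_wpM2l ?invr_ge0 ?twopi_ge0//.
have cu := lnN_ccont S0 Sr; rewrite -/c in cu.
have cK : contab (fun t => complex.Re (k x t - k y t)) 0 (2 * pi) := ccont_Re (ccontB (kc x hx) (kc y hy)).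
rewrite -rintZ; last exact: contab_norm.
rewrite (@rint_eq _ _ (fun t => 2 * ln (N (h (c t))) * complex.Re (k x t - k y t))); last first.
  by move=> t _; case: (k x t - k y t) => a b /=; rewrite mul0r subr0.
have c2 : contab (fun t => 2 * ln (N (h (c t))) * complex.Re (k x t - k y t)) 0 (2 * pi).
  exact: (contabM (contabM (@contabC _ 2 0 (2 * pi)) cu) cK).
apply: le_trans (rint_norm c2) _; apply: rint_le.
- exact: contab_norm.
- exact: (contabM (@contabC _ _ 0 (2 * pi)) (contab_norm cu)).
move=> t _; rewrite !normrM ger0_norm// mulrAC ler_wpM2r//.
apply: (@le_trans _ _ (2 * (4 * N (x - y) / S))); last by rewrite le_eqVlt; apply/orP; left; apply/eqP; ring.
rewrite ler_wpM2l//; apply: le_trans (N_Re _) _.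
have off z : N z <= S / 2 -> S / 2 <= N (c t - z).
  move=> hz; have := @circ_off R 0 S z t; rewrite subr0 => H; apply: le_trans (H _); lra.
have n0 z : N z <= S / 2 -> c t - z != 0.
  by move=> /off; rewrite -N_gt0; apply: lt_le_trans; rewrite divr_gt0.
rewrite /k subr0 (_ : _ - _ = c t * (x - y) / ((c t - x) * (c t - y))); last first.
  by field; rewrite !n0.
rewrite Normc.normcM Normc.normcV !Normc.normcM NS.
rewrite (_ : 4 * N (x - y) / S = S * N (x - y) * ((S / 2) * (S / 2))^-1); last by field; rewrite gt_eqF.
apply: ler_wpM2l; first by rewrite mulr_ge0 ?N_ge0// ltW.
rewrite lef_pV2 ?posrE ?mulr_gt0 ?divr_gt0// ?N_gt0 ?n0//.
have S2 : 0 <= S / 2 by lra.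
by apply: ler_pM; [exact: S2|exact: S2|exact: off|exact: off].
Qed.
End Primitive.

(** * Orders of meromorphic functions and Blaschke factors *)

Section Order.
Context {R : realType}.
Implicit Types (p z w : R[i]^o) (f g h : R[i]^o -> R[i]^o) (k : int).

Lemma dnbhsN p (P : set R[i]^o) : nbhs (p^') P <->
  exists2 d : R, 0 < d & forall w, w != p -> N (w - p) < d -> P w.
Proof.
split; first by move=> /nbhsN [d d0 hd]; exists d => // w wp /hd; apply.
by move=> [d d0 hd]; apply/nbhsN; exists d => // w hw wp; apply: hd.
Qed.

Lemma dnbhs_ex p (P : set R[i]^o) : nbhs (p^') P -> exists2 w, w != p & P w.
Proof.
move=> /dnbhsN [d d0 hd]; exists (p + (d / 2)%:C).
  rewrite -subr_eq0 addrAC subrr add0r -N_eq0 NR normr_eq0.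
  by rewrite gt_eqF// divr_gt0.
apply: hd; last by rewrite addrAC subrr add0r NR gtr0_norm ?divr_gt0//; lra.
by rewrite -subr_eq0 addrAC subrr add0r -N_eq0 NR normr_eq0 gt_eqF// divr_gt0.
Qed.

Lemma dnbhs_and p (P Q : set R[i]^o) : nbhs (p^') P -> nbhs (p^') Q -> nbhs (p^') (fun z => P z /\ Q z).
Proof.
move=> /dnbhsN [d d0 hd] /dnbhsN [e e0 he]; apply/dnbhsN; exists (Num.min d e); first by rewrite lt_min d0.
by move=> w wp; rewrite lt_min => /andP[h1 h2]; split; [exact: hd|exact: he].
Qed.
Lemma dnbhs_sub p (P Q : set R[i]^o) : (forall z, z != p -> P z -> Q z) -> nbhs (p^') P -> nbhs (p^') Q.
Proof.
move=> PQ /dnbhsN [d d0 hd]; apply/dnbhsN; exists d => // w wp hw; apply: PQ => //; exact: hd.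
Qed.
Lemma nbhs_dnbhsN p (P : set R[i]^o) : nbhs p P -> nbhs (p^') P.
Proof. by move=> /nbhsN [d d0 hd]; apply/dnbhsN; exists d => // w _; exact: hd. Qed.
Lemma dnbhs_open p (P : set R[i]^o) : nbhs (p^') P -> nbhs (p^') (fun z => nbhs z P).
Proof.
move=> /dnbhsN [d d0 hd]; apply/dnbhsN; exists d => // w wp hw; apply/nbhsN.
have wp0 : 0 < N (w - p) by rewrite N_gt0 subr_eq0.
exists (Num.min (d - N (w - p)) (N (w - p))); first by rewrite lt_min subr_gt0 hw.
move=> v; rewrite lt_min => /andP[h1 h2]; apply: hd.
  by apply: contraTneq h2 => ->; rewrite NBC ltxx.
have -> : v - p = (v - w) + (w - p) by ring.
by apply: le_lt_trans (ND _ _) _; lra.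
Qed.

Lemma cont_near_eq f g p : {for p, continuous f} -> {for p, continuous g} ->
  nbhs (p^') (fun z => f z = g z) -> f p = g p.
Proof.
move=> /contCP cf /contCP cg H; apply/eqP; rewrite -subr_eq0; apply/eqP; apply: contR_eq0 => e e0.
have e20 : 0 < e / 2 by rewrite divr_gt0.
have [d d0 hd] := cf _ e20; have [d' d'0 hd'] := cg _ e20.
have D : nbhs (p^') (fun z => N (f z - f p) < e / 2) by apply/dnbhsN; exists d => // w _; exact: hd.
have D' : nbhs (p^') (fun z => N (g z - g p) < e / 2) by apply/dnbhsN; exists d' => // w _; exact: hd'.
have [w wp [h1 [h2 h3]]] := dnbhs_ex (dnbhs_and H (dnbhs_and D D')).
have -> : f p - g p = (g w - g p) - (f w - f p) by rewrite h1; ring.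
apply: le_trans (NB _ _) _; lra.
Qed.

Definition hol_near g p := nbhs p (fun z => exists l : R[i]^o, cderiv g z l).

Lemma hol_nearP g p : hol_near g p <-> holomorphic_at g p.
Proof.
split => /nbhsN [d d0 hd]; apply/nbhsN; exists d => // w /hd.
  by move/derivableP.
by move/derivableP.
Qed.
Lemma hol_near_self g p : hol_near g p -> exists l : R[i]^o, cderiv g p l.
Proof. by move=> /nbhs_singleton. Qed.
Lemma hol_near_cont g p : hol_near g p -> {for p, continuous g}.
Proof. by move=> /hol_near_self [l /cderiv_cont]. Qed.
Lemma nbhs_and p (P Q : set R[i]^o) : nbhs p P -> nbhs p Q -> nbhs p (fun z => P z /\ Q z).
Proof. by move=> hP hQ; apply: filterI. Qed.
Lemma nbhs_sub p (P Q : set R[i]^o) : (forall z, P z -> Q z) -> nbhs p P -> nbhs p Q.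
Proof. by move=> H; apply: filterS. Qed.
Lemma hol_near_open g p : hol_near g p -> nbhs p (fun z => hol_near g z).
Proof.
move=> /nbhsN [d d0 hd]; apply/nbhsN; exists d => // w hw.
have := @open_disc R p d w _ hw hd; exact.
Qed.
Lemma hol_near_disc g p : hol_near g p -> exists2 d, 0 < d & hol_disc g p d.
Proof.
move=> /nbhsN [d d0 hd]; exists (d / 2); first by rewrite divr_gt0.
by move=> z hz; apply: hd; apply: le_lt_trans hz _; lra.
Qed.
Lemma hol_nearM f g p : hol_near f p -> hol_near g p -> hol_near (fun z => f z * g z) p.
Proof.
move=> hf hg; apply: nbhs_sub (nbhs_and hf hg) => z [[l hl] [m hm]].
by eexists; exact: (cderivM hl hm).
Qed.
Lemma cont_neq0 g p : {for p, continuous g} -> g p != 0 -> nbhs p (fun z => g z != 0).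
Proof.
move=> /contCP cg g0; have gp : 0 < N (g p) by rewrite N_gt0.
have [d d0 hd] := cg _ gp; apply/nbhsN; exists d => // w /hd.
by apply: contraTneq => ->; rewrite sub0r NN ltxx.
Qed.
Lemma hol_nearV g p : g p != 0 -> hol_near g p -> hol_near (fun z => (g z)^-1) p.
Proof.
move=> g0 hg; apply: nbhs_sub (nbhs_and hg (cont_neq0 (hol_near_cont hg) g0)) => z [[l hl] gz].
by eexists; exact: (cderivV gz hl).
Qed.
Lemma hol_near_cst c p : hol_near (fun=> c) p.
Proof. by apply/nbhsN; exists 1 => // w _; exists 0; exact: cderiv_cst. Qed.
Lemma hol_near_sub c p : hol_near (fun z => z - c) p.
Proof. by apply/nbhsN; exists 1 => // w _; exists 1; exact: cderiv_sub. Qed.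
Lemma hol_nearX g p n : hol_near g p -> hol_near (fun z => g z ^+ n) p.
Proof. by apply: nbhs_sub => z [l hl]; exact: cderivX hl. Qed.
Lemma hol_nearXz g p k : g p != 0 -> hol_near g p -> hol_near (fun z => g z ^ k) p.
Proof.
case: k => n g0 hg; first exact: hol_nearX.
apply: hol_nearV; first by rewrite expf_neq0.
exact: hol_nearX.
Qed.
Lemma hol_nearB f g p : hol_near f p -> hol_near g p -> hol_near (fun z => f z - g z) p.
Proof.
move=> hf hg; apply: nbhs_sub (nbhs_and hf hg) => z [[l hl] [m hm]].
by eexists; exact: (cderivB hl hm).
Qed.
Lemma hol_near_eq f g p : nbhs p (fun z => f z = g z) -> hol_near f p -> hol_near g p.
Proof.
move=> H hf.
have H' : nbhs p (fun z => nbhs z (fun z => f z = g z)) by apply: nbhs_interior.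
apply: nbhs_sub (nbhs_and H' hf) => z [e [l hl]]; exists l; exact: cderiv_near hl.
Qed.

(** The order of the Laurent expansion: positive at zeros, negative at poles, and blind to the
    arbitrary value [f p]. *)
Definition ord_at f p k := exists g, [/\ hol_near g p, g p != 0 & nbhs (p^') (fun z => f z = g z * (z - p) ^ k)].

Lemma sub_neq0 z p : z != p -> z - p != 0. Proof. by rewrite subr_eq0. Qed.

Lemma ord_at_near f g p k : nbhs (p^') (fun z => f z = g z) -> ord_at f p k -> ord_at g p k.
Proof.
move=> H [u [hu u0 fu]]; exists u; split=> //; apply: dnbhs_sub (dnbhs_and H fu) => z _ [<- //].
Qed.
Lemma ord_atM f g p k (l : int) : ord_at f p k -> ord_at g p l -> ord_at (fun z => f z * g z) p (k + l).
Proof.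
move=> [u [hu u0 fu]] [v [hv v0 gv]]; exists (fun z => u z * v z); split.
- exact: hol_nearM.
- by rewrite mulf_neq0.
- apply: dnbhs_sub (dnbhs_and fu gv) => z zp [-> ->].
  by rewrite (expfzDr _ _ (sub_neq0 zp)); ring.
Qed.
Lemma ord_at_good g p : hol_near g p -> g p != 0 -> ord_at g p 0.
Proof.
by move=> hg g0; exists g; split=> //; apply/dnbhsN; exists 1 => // w _ _; rewrite expr0z mulr1.
Qed.
Lemma ord_at_sub p : ord_at (fun z => z - p) p 1.
Proof.
exists (fun=> 1); split; [exact: hol_near_cst|exact: oner_neq0|].
by apply/dnbhsN; exists 1 => // w _ _; rewrite mul1r expr1z.
Qed.
Lemma ord_atXz f p k (l : int) : ord_at f p k -> ord_at (fun z => f z ^ l) p (k * l).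
Proof.
move=> [u [hu u0 fu]]; exists (fun z => u z ^ l); split.
- exact: hol_nearXz.
- by rewrite expfz_neq0.
- apply: dnbhs_sub fu => z zp ->; by rewrite expfzMl exprz_exp.
Qed.
Lemma ord_at_prod (I : eqType) (s : seq I) (F : I -> R[i]^o -> R[i]^o) (m : I -> int) p :
  (forall i, i \in s -> ord_at (F i) p (m i)) ->
  ord_at (fun z => \prod_(i <- s) F i z) p (\sum_(i <- s) m i).
Proof.
elim: s => [_|i s IH H].
  rewrite big_nil; apply: (@ord_at_near (fun=> 1)).
    by apply/dnbhsN; exists 1 => // w _ _; rewrite big_nil.
  by apply: ord_at_good; [exact: hol_near_cst|exact: oner_neq0].
rewrite big_cons; apply: (@ord_at_near (fun z => F i z * \prod_(i <- s) F i z)).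
  by apply/dnbhsN; exists 1 => // w _ _; rewrite big_cons.
apply: ord_atM; first by apply: H; rewrite mem_head.
by apply: IH => j js; apply: H; rewrite inE js orbT.
Qed.
Lemma ord_at_neq0 f p k : ord_at f p k -> nbhs (p^') (fun z => f z != 0).
Proof.
move=> [u [hu u0 fu]].
apply: dnbhs_sub (dnbhs_and fu (nbhs_dnbhsN (cont_neq0 (hol_near_cont hu) u0))) => z zp [-> uz].
by rewrite mulf_neq0// expfz_neq0// sub_neq0.
Qed.
(** If [k < l], then [u] agrees near [p] with [v] times a positive power of [z - p], and continuity
    forces [u p = 0]. *)
Lemma ord_at_uniq f p k (l : int) : ord_at f p k -> ord_at f p l -> k = l.
Proof.
wlog kl : k l / k <= l.
  move=> H hk hl; have [h|/ltW h] := leP k l; first exact: H.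
  by apply/esym; exact: H.
move=> [u [hu u0 fu]] [v [hv v0 fv]]; apply/eqP; rewrite eq_le kl /=; apply: contrapT => /negP; rewrite -ltNge => kl'.
move/eqP: u0; apply.
have [n ln] : exists n : nat, l - k = n.+1%:Z.
  move: kl'; rewrite -subr_gt0; case: (l - k) => [[|n]|n]//; by exists n.
rewrite (@cont_near_eq u (fun z => v z * (z - p) ^+ n.+1) p).
- by rewrite subrr expr0n mulr0.
- exact: hol_near_cont.
- by apply: hol_near_cont; apply: hol_nearM => //; apply: hol_nearX; exact: hol_near_sub.
apply: dnbhs_sub (dnbhs_and fu fv) => z zp [-> e].
have z0 := sub_neq0 zp; apply: (mulIf (expfz_neq0 k z0)); rewrite e -mulrA; congr (_ * _).
by rewrite -[(z - p) ^+ n.+1]/((z - p) ^ n.+1%:Z) -ln -expfzDr// subrK.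
Qed.

Lemma hol_order g p : hol_near g p -> nbhs p (fun z => g z = 0) \/ exists n : nat, ord_at g p n.
Proof.
move=> /hol_near_disc [d d0 hd]; case: (local_order d0 hd) => [H|[n [G [G0 dG gG]]]].
  by left; apply/nbhsN; exists d.
right; exists n, G; split=> //; first by apply/nbhsN; exists d.
by apply/dnbhsN; exists d => // w _ /gG ->; rewrite mulrC.
Qed.

Lemma pole_order_le_ord f p n : pole_order_le f p n -> nbhs (p^') (fun z => f z = 0) \/
  exists m : nat, ord_at f p (m%:Z - n%:Z).
Proof.
move=> [g [/hol_nearP hg fg]]; case: (hol_order hg) => [H|[m om]].
  left; apply: dnbhs_sub (dnbhs_and fg (nbhs_dnbhsN H)) => z _ [-> ->]; by rewrite mul0r.
right; exists m; apply: (@ord_at_near (fun z => g z * (z - p) ^ (- n%:Z))).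
  by apply: dnbhs_sub fg => z zp ->; rewrite -exprnN.
apply: ord_atM => //; rewrite -[X in ord_at _ _ X]mul1r; apply: ord_atXz; exact: ord_at_sub.
Qed.
Lemma mero_order f p : meromorphic f -> nbhs (p^') (fun z => f z = 0) \/ exists k, ord_at f p k.
Proof.
move=> /(_ p) [n /pole_order_le_ord [|[m h]]]; first by left.
by right; exists (m%:Z - n%:Z).
Qed.

(** Applied to an order, [negp] is the multiplicity of the pole and [posp] that of the zero;
    [Negz n] means [- n.+1], hence the shift. *)
Definition negp k : nat := if k is Negz n then n.+1 else 0%N.
Definition posp k : nat := if k is Posz n then n else 0%N.

Lemma pole_orderE f p k : ord_at f p k -> pole_order f p = negp k.
Proof.
move=> ok; have leP n : pole_order_le f p n <-> (negp k <= n)%N.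
  split => [/pole_order_le_ord [H|[m om]]|kn].
    have [w _ [h1]] := dnbhs_ex (dnbhs_and H (ord_at_neq0 ok)); by rewrite h1 eqxx.
  have := ord_at_uniq ok om; case: (k) => [j|j] //= e.
  move: e; rewrite NegzE; lia.
have [u [hu u0 fu]] := ok.
  have [j kj] : exists j : nat, k + n%:Z = j%:Z.
    by move: kn; case: (k) => [j|j] /= h; [exists (j + n)%N|exists (n - j.+1)%N]; rewrite ?NegzE; lia.
  exists (fun z => u z * (z - p) ^+ j); split.
    by apply/hol_nearP; apply: hol_nearM => //; apply: hol_nearX; exact: hol_near_sub.
  apply: dnbhs_sub fu => z zp ->; have z0 := sub_neq0 zp.
  rewrite -[(z - p) ^+ j]/((z - p) ^ j%:Z) -kj expfzDr// mulrA mulfK//.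
  by rewrite expf_neq0.
rewrite /pole_order; case: xgetP => [n _ [/leP h1 h2]|H].
  by apply/eqP; rewrite eqn_leq h1 andbT; apply: h2; apply/leP.
exfalso; apply: (H (negp k)); split; first by apply/leP.
by move=> j /leP.
Qed.

(* [~ good f p] holds at the zeros and poles of [f], but also at the isolated
   points where the value of [f] is arbitrary. *)
Definition good f p := hol_near f p /\ f p != 0.
Lemma good_ord f p : good f p -> ord_at f p 0. Proof. by case; exact: ord_at_good. Qed.
Lemma ord_at_good_near f p k : ord_at f p k -> nbhs (p^') (fun z => good f z).
Proof.
move=> ok; have fn0 := ord_at_neq0 ok; have [u [hu u0 fu]] := ok.
have H1 := dnbhs_open fu; have H2 := nbhs_dnbhsN (hol_near_open hu).
apply: dnbhs_sub (dnbhs_and fn0 (dnbhs_and H1 H2)) => z zp [f0 [e hz]]; split=> //.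
apply: (@hol_near_eq (fun z => u z * (z - p) ^ k)).
  by apply: nbhs_sub e => w ->.
apply: hol_nearM => //; apply: hol_nearXz; [exact: sub_neq0|exact: hol_near_sub].
Qed.

Lemma seg_cont p w (t : R) : {for t, continuous (fun u : R => p + (u%:C : R[i]^o) * w : R[i]^o)}.
Proof.
exact: (rderiv_cont (rderivD (rderiv_cst p t) (rderivM (rderiv_id t) (rderiv_cst w t)))).
Qed.

Lemma mero_identity f p : meromorphic f -> nbhs (p^') (fun z => f z = 0) -> forall w, nbhs (w^') (fun z => f z = 0).
Proof.
move=> mf fp w; pose zt t : R[i]^o := p + (t%:C : R[i]^o) * (w - p).
(* Connectedness of the segment from [p] to [w]. *)
pose A : set R := [set t | nbhs ((zt t)^') (fun z => f z = 0)].
have ct (t : R) (P : set R[i]^o) : nbhs (zt t) P -> nbhs t (fun u => P (zt u)).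
  by move=> hP; exact: (@seg_cont p (w - p) t P hP).
have oA : open A.
  rewrite openE => t At; rewrite /interior.
  have h := dnbhs_open At.
  have h2 : nbhs (zt t) (fun z => nbhs (z^') (fun v => f v = 0)).
    move/dnbhsN : h => [d d0 hd]; apply/nbhsN; exists d; first exact: d0.
    move=> z hz.
    have [->|zp] := eqVneq z (zt t); first exact: At.
    exact: nbhs_dnbhsN (hd z zp hz).
  exact: ct h2.
(* At a point outside [A] the function has an order, so it is zero-free in a punctured neighbourhood
   and no nearby point can belong to [A]. *)
have cA : closed A.
  rewrite -[A]setCK; apply: open_closedC; rewrite openE => t At; rewrite /interior.
  have [//|[k ok]] := mero_order (zt t) mf.
  have h2 : nbhs (zt t) (fun z => ~ nbhs (z^') (fun v => f v = 0)).
    move/dnbhsN : (dnbhs_open (ord_at_neq0 ok)) => [d d0 hd]; apply/nbhsN; exists d; first exact: d0.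
    move=> z hz.
    have [->|zp] := eqVneq z (zt t); first exact: At.
    move=> H; have [v _ [h1 h2]] := dnbhs_ex (dnbhs_and H (nbhs_dnbhsN (hd z zp hz))).
    by rewrite h1 eqxx in h2.
  exact: ct h2.
have conn : connected [set: R] by apply/connected_intervalP.
have AT : A = setT.
  apply: conn.
  - by exists 0; rewrite /A /= /zt mul0r addr0.
  - by exists A => //; rewrite setTI.
  - by exists A => //; rewrite setTI.
have : A 1 by rewrite AT.
by rewrite /A /= /zt mul1r addrC subrK.
Qed.

Lemma compact_disc (S : R) : compact [set z : R[i]^o | N z <= S].
Proof.
pose K : set (R * R) := `[-S, S]%classic `*` `[-S, S]%classic.
have cK : compact K by apply: compact_setX; exact: segment_compact.
pose F (u : R * R) : R[i]^o := (u.1 +i* u.2)%C.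
have cF : {within K, continuous F}.
  apply: continuous_subspaceT => u; apply/(@cvg_ballP _ R[i]^o) => e e0.
  have e0' : 0 < complex.Re e / 2 by move: e0; rewrite ltcE /= => /andP[_ h]; rewrite divr_gt0.
  have h12 : \forall v \near u, `|u.1 - v.1| < complex.Re e / 2 /\ `|u.2 - v.2| < complex.Re e / 2.
    exists (ball u.1 (complex.Re e / 2), ball u.2 (complex.Re e / 2)).
      by split; apply: nbhsx_ballx.
    by move=> v /= []; rewrite -!ball_normE /=.
  near=> v; rewrite -ball_normE /= NE ltcE /=; move: e0; rewrite ltcE /= => /andP[/eqP -> _]; rewrite eqxx /=.
  apply: (@le_lt_trans _ _ (`|u.1 - v.1| + `|u.2 - v.2|)); first exact: (N_ReIm ((u.1 - v.1) +i* (u.2 - v.2))%C).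
  have [a1 a2] : `|u.1 - v.1| < complex.Re e / 2 /\ `|u.2 - v.2| < complex.Re e / 2 by near: v.
  lra.
have cFK := continuous_compact cF cK.
apply: subclosed_compact cFK _.
  have : closed ((@Normc.normc R : R[i]^o -> R) @^-1` [set x | x <= S]).
    apply: closed_comp; last exact: closed_le.
    by move=> z _; exact: N_cont.
  exact.
move=> z /= hz; exists (complex.Re z, complex.Im z); last by case: (z).
split; rewrite /= in_itv /= -ler_norml.
  exact: le_trans (N_Re z) hz.
exact: le_trans (N_Im z) hz.
Unshelve. all: by end_near. Qed.

(** Each open set of the cover contains at most one point of [P], namely its own index. The indices
    of a finite subcover therefore list all points of [P] in the disc. *)
Lemma disc_finite (P : R[i]^o -> Prop) (S : R) : (forall p, nbhs (p^') (fun z => ~ P z)) ->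
  exists bs : seq R[i]^o, uniq bs /\ forall p, N p <= S -> P p -> p \in bs.
Proof.
move=> HP; have := @compact_disc S; rewrite compact_cover => /(_ _ [set z | N z <= S]
   (fun p => ([set v | v = p \/ ~ P v])°)) [||D' _ H].
- by move=> p _; exact: open_interior.
- move=> z hz; exists z => //; rewrite /interior /=.
  have /dnbhsN [d d0 hd] := HP z; apply/nbhsN; exists d => // w hw.
  by have [->|wz] := eqVneq w z; [left|right; exact: hd].
exists (finmap.enum_fset D'); split; first exact: finmap.fset_uniq.
move=> p hp Pp; have [q qD] := H p hp; move/interior_subset => [-> //|/(_ Pp)//].
Qed.

(** Compactness gives a uniform distance [d] within which [U] holds around the disc; a point
    slightly outside is close to its radial projection [(S / |z|) z]. *)
Lemma disc_enlarge (U : R[i]^o -> Prop) (S : R) : 0 <= S -> (forall z, N z <= S -> nbhs z U) ->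
  exists2 rho, S < rho & forall z, N z <= rho -> U z.
Proof.
move=> S0 HU; have /compact_near_coveringP H := @compact_disc S.
have {}H := H R (nbhs (0 : R)) (fun d z => forall w, N (w - z) <= `|d| -> U w) _.
have : \forall d \near (0 : R), [set z : R[i]^o | N z <= S] `<=` (fun z => forall w, N (w - z) <= `|d| -> U w).
  apply: H => z /HU /nbhsN [d d0 hd]; exists ([set w | N (w - z) < d / 2], [set t | `|t| < d / 2]).
    split => /=; first by apply/nbhsN; exists (d / 2); rewrite ?divr_gt0.
    apply/nbhs_ballP; exists (d / 2) => /=; first by rewrite divr_gt0.
    by move=> t; rewrite -ball_normE /= sub0r normrN.
  move=> [v t] /= [h1 h2] w h3; apply: hd.
  have -> : w - z = (w - v) + (v - z) by ring.
  apply: le_lt_trans (ND _ _) _; lra.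
move=> /nbhs_ballP [d /= d0 hd]; exists (S + d / 2); first by rewrite ltrDl divr_gt0.
move=> z hz; have Hd : ball (0 : R) d (d / 2).
  by rewrite -ball_normE /= sub0r normrN gtr0_norm ?divr_gt0//; lra.
have [zS|Sz] := leP (N z) S.
  by apply: (hd _ Hd z zS); rewrite subrr Normc.normc0.
have nz : 0 < N z by apply: le_lt_trans Sz.
have zn0 : z != 0 by rewrite -N_gt0.
apply: (hd _ Hd ((S / N z)%:C * z)).
  by rewrite /= Normc.normcM NR ger0_norm ?divr_ge0 ?N_ge0// divfK ?gt_eqF.
have -> : z - (S / N z)%:C * z = (1 - S / N z)%:C * z by rewrite rmorphB /=; ring.
rewrite Normc.normcM NR ger0_norm; last by rewrite subr_ge0 ler_pdivrMr// mul1r ltW.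
rewrite mulrBl mul1r divfK ?gt_eqF// gtr0_norm ?divr_gt0//; lra.
Qed.

(* Removes all removable singularities of [f0] in the disc at once. *)
Lemma glue f0 (S : R) : 0 <= S -> (forall z, N z <= S -> ord_at f0 z 0) ->
  exists h, forall z, N z <= S -> [/\ hol_near h z, h z != 0 & nbhs (z^') (fun v => f0 v = h v)].
Proof.
move=> S0 H0.
have [G GP] : exists G : R[i]^o -> R[i]^o -> R[i]^o, forall z, ord_at f0 z 0 ->
    [/\ hol_near (G z) z, G z z != 0 & nbhs (z^') (fun v => f0 v = G z v)].
  have H z : exists g, ord_at f0 z 0 -> [/\ hol_near g z, g z != 0 & nbhs (z^') (fun v => f0 v = g v)].
    case: (pselect (ord_at f0 z 0)) => [[g [h1 h2 h3]]|n]; last by exists (fun=> 0) => /n.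
    by exists g => _; split=> //; apply: dnbhs_sub h3 => v _ ->; rewrite expr0z mulr1.
  by have [G GP] := choice H; exists G.
exists (fun z => G z z) => z hz; have [h1 h2 h3] := GP z (H0 z hz).
have E : nbhs z (fun v => G z v = G v v).
  have A1 := nbhs_and (hol_near_open h1) (cont_neq0 (hol_near_cont h1) h2).
  have /dnbhsN [d d0 hd] := dnbhs_and (dnbhs_open h3) (nbhs_dnbhsN A1).
  apply/nbhsN; exists d => // v hv; have [->//|vz] := eqVneq v z.
  have [e [a1 a2]] := hd v vz hv.
  have ov : ord_at f0 v 0.
    apply: (@ord_at_near (G z)); last exact: ord_at_good.
    by apply: nbhs_dnbhsN; apply: nbhs_sub e => u ->.
  have [b1 b2 b3] := GP v ov.
  apply: cont_near_eq; [exact: hol_near_cont|exact: hol_near_cont|].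
  by apply: dnbhs_sub (dnbhs_and (nbhs_dnbhsN e) b3) => u _ [<- <-].
split; [exact: hol_near_eq E h1|by []|].
by apply: dnbhs_sub (dnbhs_and h3 (nbhs_dnbhsN E)) => v _ [-> ->].
Qed.
End Order.

(** * Blaschke factors and the zero-free quotient *)

Section Factor.
Context {R : realType}.
Implicit Types (p z w : R[i]^o) (S : R).

Definition blaschke S p z : R[i]^o := (S%:C : R[i]^o) * (z - p) / (((S ^+ 2)%:C : R[i]^o) - p^*%C * z).

Lemma blaschke_den S p z : N p < S -> N z <= S -> ((S ^+ 2)%:C : R[i]^o) - p^*%C * z != 0.
Proof.
move=> pS zS; have S0 : 0 < S by apply: le_lt_trans pS; exact: N_ge0.
rewrite -N_gt0; apply: lt_le_trans (NB_le _ _); rewrite subr_gt0 Normc.normcM N_conj NR ger0_norm ?sqr_ge0//.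
apply: (@le_lt_trans _ _ (N p * S)); first by rewrite ler_wpM2l ?N_ge0.
by rewrite expr2 ltr_pM2r.
Qed.
Lemma realC_neq0 (x : R) : x != 0 -> (x%:C : R[i]^o) != 0.
Proof. by move=> x0; rewrite -N_eq0 NR normr_eq0. Qed.

(** On the circle [S ^ 2] is [z] times its conjugate, so the denominator is [z] times the conjugate
    of [z - p]. *)
Lemma N_blaschke_circ S p z : N p < S -> N z = S -> N (blaschke S p z) = 1.
Proof.
move=> pS zS; have S0 : 0 < S by apply: le_lt_trans pS; exact: N_ge0.
have zS' : N z <= S by rewrite zS.
have d0 := blaschke_den pS zS'.
have e : ((S ^+ 2)%:C : R[i]^o) - p^*%C * z = z * (z - p)^*%C.
  rewrite cjB mulrBr [p^*%C * z]mulrC; congr (_ - _).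
  by rewrite -sqr_normc NE zS rmorphXn.
have zn : N (z - p) != 0.
  by rewrite N_eq0 subr_eq0; apply: contraTneq pS => <-; rewrite zS ltxx.
rewrite /blaschke e Normc.normcM Normc.normcV !Normc.normcM N_conj NR gtr0_norm// zS.
by rewrite divff// mulf_neq0// gt_eqF.
Qed.
Lemma hol_blaschke S p z : N p < S -> N z <= S -> hol_near (blaschke S p) z.
Proof.
move=> pS zS; have d0 := blaschke_den pS zS.
apply: hol_nearM.
  by apply: hol_nearM; [exact: hol_near_cst|exact: hol_near_sub].
apply: (@hol_nearV _ (fun w => ((S ^+ 2)%:C : R[i]^o) - p^*%C * w)); first exact: d0.
apply: hol_nearB; first exact: hol_near_cst.
apply: hol_nearM; first exact: hol_near_cst.
by have := hol_near_sub 0 z; under eq_fun do rewrite subr0.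
Qed.
Lemma hol_near_prod (I : eqType) (s : seq I) (F : I -> R[i]^o -> R[i]^o) z :
  (forall i, i \in s -> hol_near (F i) z) -> hol_near (fun w => \prod_(i <- s) F i w) z.
Proof.
elim: s => [|i s IH] H.
  apply: (@hol_near_eq _ (fun=> 1)); last exact: hol_near_cst.
  by apply/nbhsN; exists 1 => // w _; rewrite big_nil.
apply: (@hol_near_eq _ (fun w => F i w * \prod_(j <- s) F j w)).
  by apply/nbhsN; exists 1 => // w _; rewrite big_cons.
apply: hol_nearM; first by apply: H; rewrite mem_head.
by apply: IH => j js; apply: H; rewrite inE js orbT.
Qed.
Lemma ord_blaschke S p z : N p < S -> N z <= S -> ord_at (blaschke S p) z (z == p)%:Z.
Proof.
move=> pS zS; have S0 : 0 < S by apply: le_lt_trans pS; exact: N_ge0.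
have d0 := blaschke_den pS zS.
have Sn : (S%:C : R[i]^o) != 0 by rewrite realC_neq0 ?gt_eqF.
have hden : hol_near (fun z => ((S ^+ 2)%:C : R[i]^o) - p^*%C * z) z.
  apply: hol_nearB; first exact: hol_near_cst.
  apply: hol_nearM; first exact: hol_near_cst.
  by have := hol_near_sub 0 z; under eq_fun do rewrite subr0.
have hq : hol_near (fun z => (S%:C : R[i]^o) / (((S ^+ 2)%:C : R[i]^o) - p^*%C * z)) z.
  by apply: hol_nearM; [exact: hol_near_cst|apply: (@hol_nearV _ (fun w => ((S ^+ 2)%:C : R[i]^o) - p^*%C * w)); [exact: d0|exact: hden]].
have [zp|zp] := eqVneq z p.
  rewrite zp /= in hq d0 *; have h := ord_atM (ord_at_sub p) (ord_at_good hq (mulf_neq0 Sn (invr_neq0 d0))).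
  rewrite addr0 in h; apply: ord_at_near h; apply/dnbhsN; exists 1 => // w _ _.
  by rewrite /blaschke; ring.
apply: (@ord_at_near _ (fun w => (w - p) * ((S%:C : R[i]^o) / (((S ^+ 2)%:C : R[i]^o) - p^*%C * w)))).
  by apply/dnbhsN; exists 1 => // w _ _; rewrite /blaschke; ring.
apply: ord_at_good; first by apply: hol_nearM => //; exact: hol_near_sub.
by rewrite !mulf_neq0 ?subr_eq0 ?invr_neq0.
Qed.

Lemma blaschke_neq0 S p z : N p < S -> N z <= S -> z != p -> blaschke S p z != 0.
Proof.
move=> pS zS zp; have S0 : 0 < S by apply: le_lt_trans pS; exact: N_ge0.
rewrite /blaschke mulf_neq0 ?invr_neq0 ?blaschke_den// mulf_neq0 ?subr_eq0//.
by rewrite realC_neq0// gt_eqF.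
Qed.

Lemma lnN_exprz z (k : int) : z != 0 -> ln (N (z ^ k)) = k%:~R * ln (N z).
Proof.
rewrite -N_gt0 => z0; case: k => n.
  by rewrite -[z ^ n]/(z ^+ n) NX lnXn// -mulr_natl.
rewrite NegzE -exprnN Normc.normcV NX lnV ?posrE ?exprn_gt0// lnXn//.
by rewrite -mulr_natl mulrNz mulNr.
Qed.
Lemma lnNM z w : z != 0 -> w != 0 -> ln (N (z * w)) = ln (N z) + ln (N w).
Proof. by rewrite -!N_gt0 Normc.normcM => z0 w0; rewrite lnM. Qed.
Lemma lnN_prod (I : eqType) (s : seq I) (F : I -> R[i]^o) : (forall i, i \in s -> F i != 0) ->
  \prod_(i <- s) F i != 0 /\ ln (N (\prod_(i <- s) F i)) = \sum_(i <- s) ln (N (F i)).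
Proof.
elim: s => [|i s IH] H; first by rewrite !big_nil oner_neq0 Normc.normc1 ln1.
have [j js|a b] := IH; first by apply: H; rewrite inE js orbT.
have i0 : F i != 0 by apply: H; rewrite mem_head.
by rewrite !big_cons mulf_neq0// lnNM// b.
Qed.

Variables (f : R[i]^o -> R[i]^o) (k : R[i]^o -> int).
Hypothesis ok : forall p, ord_at f p (k p).

(* [0] is always listed: its factor is treated apart in Jensen's formula. *)
Definition covers S (bs : seq R[i]^o) :=
  [/\ uniq bs, 0 \in bs, forall p, p \in bs -> N p < S & forall p, N p <= S -> ~ good f p -> p \in bs].

Definition bl_quot S bs z : R[i]^o := f z * \prod_(p <- bs) blaschke S p z ^ (- k p).

Lemma covers_k S bs p : covers S bs -> N p <= S -> p \notin bs -> good f p /\ k p = 0.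
Proof.
move=> [_ _ _ H] pS pb; have g : good f p.
  by apply: contrapT => ng; move/negP: pb; apply; exact: H.
by split=> //; exact: ord_at_uniq (ok p) (good_ord g).
Qed.

Lemma ord_bl_quot S bs z : covers S bs -> N z <= S -> ord_at (bl_quot S bs) z 0.
Proof.
move=> cov zS; have [ub _ bS _] := cov.
have := ord_atM (ok z) (@ord_at_prod _ _ bs (fun p z => blaschke S p z ^ (- k p)) (fun p => (z == p)%:Z * (- k p)) z _).
rewrite (_ : k z + _ = 0); first by apply => p /bS pS; apply: ord_atXz; exact: ord_blaschke.
have [zb|zb] := boolP (z \in bs).
  rewrite (bigD1_seq z)//= eqxx mul1r big1 ?addr0 ?subrr// => p; rewrite eq_sym => /negPf ->.
  by rewrite mul0r.
rewrite (covers_k cov zS zb).2 add0r big1_seq// => p /= pb.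
by case: eqP => [e|_]; [rewrite e pb in zb|rewrite mul0r].
Qed.

(** Minus the logarithm of the modulus of the Blaschke factor at [0]. For [p = 0] the factor is
    [z / S], and its leading coefficient [1 / S] replaces the vanishing value. *)
Definition lam (p : R[i]^o) S : R := if p == 0 then ln S else ln (S / N p).

(** [bl_quot] has order [0] throughout the closed disc, so gluing makes it holomorphic and zero-free
    there, and compactness extends this to a larger disc. Off [bs] the glued function still equals
    the quotient pointwise; at [0] its value comes from the leading coefficient of [f]. *)
Lemma blaschke_quotient S bs (g0 : R[i]^o -> R[i]^o) : 0 < S -> covers S bs ->
  hol_near g0 0 -> g0 0 != 0 -> nbhs ((0 : R[i]^o)^') (fun z => f z = g0 z * (z - 0) ^ (k 0)) ->
  exists (h : R[i]^o -> R[i]^o) (rho : R), [/\ S < rho,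
    forall z, N z <= rho -> exists l : R[i]^o, cderiv h z l,
    forall z, N z <= rho -> h z != 0,
    forall z, N z <= S -> z \notin bs ->
      ln (N (h z)) = ln (N (f z)) - \sum_(p <- bs) (k p)%:~R * ln (N (blaschke S p z)) &
    ln (N (h 0)) = ln (N (g0 0)) + \sum_(p <- bs) (k p)%:~R * lam p S].
Proof.
move=> S0 cov hg0 g00 fg0; have [ub b0 bS bg] := cov.
have [h hP] := glue (ltW S0) (fun z zS => ord_bl_quot cov zS).
have [rho Srho rP] : exists2 rho, S < rho & forall z, N z <= rho -> (exists l : R[i]^o, cderiv h z l) /\ h z != 0.
  apply: disc_enlarge (ltW S0) _ => z /hP [h1 h2 _].
  exact: nbhs_and h1 (cont_neq0 (hol_near_cont h1) h2).
exists h, rho; split=> //; [by move=> z /rP []|by move=> z /rP []| |].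
  move=> z zS zb; have [[hf fz0] _] := covers_k cov zS zb.
  have nz p : p \in bs -> blaschke S p z != 0.
    move=> pb; apply: blaschke_neq0 => //; first exact: bS.
    by apply: contraNneq zb => ->.
  have hq : hol_near (bl_quot S bs) z.
    apply: (hol_nearM hf); apply: hol_near_prod => p pb.
    by apply: hol_nearXz; [exact: nz|exact: (hol_blaschke (bS _ pb))].
  have [h1 h2 h3] := hP z zS.
  have -> : h z = bl_quot S bs z.
    apply: cont_near_eq; [exact: hol_near_cont|exact: hol_near_cont|].
    by apply: dnbhs_sub h3 => v _ ->.
  have nzk p : p \in bs -> blaschke S p z ^ (- k p) != 0 by move=> /nz; exact: expfz_neq0.
  have [p0 pE] := lnN_prod nzk.
  rewrite lnNM// pE; congr (_ + _); rewrite -sumrN; apply: eq_big_seq => p /nz pz.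
  by rewrite lnN_exprz// mulrNz mulNr.
(* This is [bl_quot] near [0] after cancelling [z ^ (k 0)] from [f] against [(z / S) ^ (- k 0)]. *)
pose F z : R[i]^o := g0 z * ((S%:C : R[i]^o) ^ (k 0) * \prod_(p <- rem 0 bs) blaschke S p z ^ (- k p)).
have z0S : N (0 : R[i]^o) <= S by rewrite Normc.normc0 ltW.
have remP p : p \in rem 0 bs -> p \in bs /\ p != 0.
  by rewrite (mem_rem_uniq _ ub) !inE => /andP[].
have nz p : p \in rem 0 bs -> blaschke S p 0 != 0.
  by move=> /remP [pb p0]; apply: blaschke_neq0 => //; [exact: bS|rewrite eq_sym].
have Sn : (S%:C : R[i]^o) != 0 by rewrite realC_neq0 ?gt_eqF.
have hF : hol_near F 0.
  apply: (hol_nearM hg0); apply: hol_nearM; first exact: hol_near_cst.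
  apply: hol_near_prod => p pb; apply: hol_nearXz; first exact: nz.
  by apply: hol_blaschke => //; apply: bS; case: (remP p pb).
have [h1 h2 h3] := hP 0 z0S.
have hF0 : h 0 = F 0.
  apply: cont_near_eq; [exact: hol_near_cont|exact: hol_near_cont|].
  apply: dnbhs_sub (dnbhs_and h3 fg0) => z zn0 [<-]; rewrite subr0 => fz.
  rewrite /bl_quot /F fz (big_rem _ b0) /= -!mulrA; congr (_ * _); rewrite mulrA; congr (_ * _).
  have -> : blaschke S 0 z = z / (S%:C : R[i]^o).
    rewrite /blaschke conjc0 mul0r !subr0 rmorphXn /=; field; exact: Sn.
  by rewrite expfzMl mulrA -expfzDr// subrr expr0z mul1r exprz_inv opprK.
have nzk p : p \in rem 0 bs -> blaschke S p 0 ^ (- k p) != 0 by move=> /nz; exact: expfz_neq0.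
have [p0 pE] := lnN_prod nzk.
rewrite hF0 /F lnNM ?mulf_neq0 ?expfz_neq0// lnNM ?expfz_neq0// pE lnN_exprz//; congr (_ + _).
rewrite NR (gtr0_norm S0) [in RHS](big_rem _ b0) /= {1}/lam eqxx; congr (_ + _).
apply: eq_big_seq => p pb; have [pb' pn0] := remP p pb.
rewrite lnN_exprz ?nz// /lam (negPf pn0) mulrNz mulNr -mulrN; congr (_ * _).
have Np : 0 < N p by rewrite N_gt0.
rewrite /blaschke mulr0 subr0 sub0r mulrN Normc.normcM Normc.normcV NN Normc.normcM !NR.
rewrite !gtr0_norm ?exprn_gt0// (_ : S * N p / S ^+ 2 = (S / N p)^-1); last by field; rewrite !gt_eqF.
by rewrite lnV ?opprK// posrE divr_gt0.
Qed.
End Factor.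

(** * Jensen's formula and Nevanlinna's first fundamental theorem *)

Section StepInt.
Context {R : realType}.
Notation mu := (@lebesgue_measure R).

(** The contribution of a simple pole of modulus [a] to the integrand [(n(t, f) - n(0, f)) / t]. *)
Definition inv_from (a t : R) : R := if a <= t then t^-1 else 0.

Lemma inv_from_int (a S : R) : 0 < a -> a <= S ->
  mu.-integrable `[0, S] (EFin \o inv_from a) /\ \int[mu]_(t in `[0, S]) inv_from a t = ln (S / a).
Proof.
move=> a0 aS.
have cinv : contab (fun t : R => t^-1) a S.
  move=> t /andP[h1 h2]; apply: (@inv_continuous R t).
  by rewrite gt_eqF// (lt_le_trans a0).
have E : inv_from a \_ `[0, S] = (fun t : R => t^-1) \_ `[a, S].
  apply/funext => t; rewrite !patchE /inv_from !mem_setE !in_itv /=.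
  case: (leP a t) => h1 /=; last by rewrite if_same.
  by rewrite (le_trans (ltW a0) h1).
split.
  apply/integrable_mkcond; first by [].
  rewrite restrict_EFin E -restrict_EFin.
  exact: ((@integrable_mkcond _ _ _ mu `[a, S]%classic (EFin \o (fun t : R => t^-1)) (measurable_itv _)).1 (contab_int cinv)).
rewrite Rintegral_mkcond E -Rintegral_mkcond -/(rint a S _).
transitivity (ln S - ln a); last by rewrite ln_div// posrE// (lt_le_trans a0).
apply: (rint_ftc aS cinv).
by move=> t /andP[h1 h2]; apply: is_derive1_ln; exact: lt_le_trans h1.
Qed.

Lemma Rint_sum (I : eqType) (s : seq I) (c : I -> R) (u : I -> R -> R) (S : R) :
  (forall i, i \in s -> mu.-integrable `[0, S] (EFin \o u i)) ->
  mu.-integrable `[0, S] (EFin \o (fun t => \sum_(i <- s) c i * u i t)) /\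
  \int[mu]_(t in `[0, S]) (\sum_(i <- s) c i * u i t) = \sum_(i <- s) c i * \int[mu]_(t in `[0, S]) u i t.
Proof.
elim: s => [|i s IH] H.
  split.
    rewrite (_ : _ \o _ = cst 0%E); first exact: integrable0.
    by apply/funext => t; rewrite /= big_nil.
  rewrite big_nil; under eq_Rintegral do rewrite big_nil.
  by rewrite Rintegral_cst// mul0r.
have [|i1 i2] := IH; first by move=> j js; apply: H; rewrite inE js orbT.
have i3 : mu.-integrable `[0, S] (EFin \o (fun t => c i * u i t)).
  have := @integrableZl _ _ _ mu _ _ (c i) _ (H i (mem_head _ _)); apply => //.
have E : (fun t => \sum_(j <- i :: s) c j * u j t) = (fun t => c i * u i t + \sum_(j <- s) c j * u j t).
  by apply/funext => t; rewrite big_cons.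
rewrite E; split.
  exact: (@integrableD _ _ _ mu _ _ _ _ i3 i1).
rewrite RintegralD// big_cons i2; congr (_ + _).
by rewrite RintegralZl//; apply: H; rewrite mem_head.
Qed.
End StepInt.

Section Nevanlinna.
Context {R : realType}.
Notation mu := (@lebesgue_measure R).
Implicit Types (p z w : R[i]^o) (S : R).
Variables (f : R[i]^o -> R[i]^o) (k : R[i]^o -> int) (g0 : R[i]^o -> R[i]^o).
Hypothesis ok : forall p, ord_at f p (k p).
Hypothesis hg0 : hol_near g0 0.
Hypothesis g00 : g0 0 != 0.
Hypothesis fg0 : nbhs ((0 : R[i]^o)^') (fun z => f z = g0 z * (z - 0) ^ (k 0)).

(** The logarithm of the modulus of the leading Laurent coefficient of [f] at [0], which plays the
    role of [log |f(0)|] in Jensen's formula. *)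
Definition clead := ln (N (g0 0)).
Definition generic S := 0 < S /\ forall p, N p = S -> good f p.
Notation covers := (covers f).

Lemma generic_covers S : generic S -> exists bs, covers S bs.
Proof.
move=> [S0 gS]; have [|bs [ub bP]] := @disc_finite R (fun p => ~ good f p) S.
  by move=> p; apply: dnbhs_sub (ord_at_good_near (ok p)) => z _ h /(_ h).
exists (undup (0 :: [seq p <- bs | N p < S])); split.
- exact: undup_uniq.
- by rewrite mem_undup mem_head.
- move=> p; rewrite mem_undup inE mem_filter => /orP[/eqP ->|/andP[]//].
  by rewrite Normc.normc0.
- move=> p pS ng; rewrite mem_undup inE mem_filter (bP p pS ng) andbT; apply/orP; right.
  rewrite lt_neqAle pS andbT; apply/eqP => e; exact: ng (gS p e).
Qed.

Variables (S : R) (bs : seq R[i]^o).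
Hypothesis S0 : 0 < S.
Hypothesis cov : covers S bs.

Lemma circ_notin t : circ 0 S t \notin bs /\ N (circ 0 S t) = S.
Proof.
have NS : N (circ 0 S t) = S by rewrite -[circ _ _ _]subr0 N_circ// ltW.
split=> //; apply/negP => h; case: cov => _ _ /(_ _ h); by rewrite NS ltxx.
Qed.

Lemma bl_circ0 t : \sum_(p <- bs) (k p)%:~R * ln (N (blaschke S p (circ 0 S t))) = 0 :> R.
Proof.
have [_ _ bS _] := cov; rewrite big1_seq// => p /= pb.
by rewrite N_blaschke_circ ?ln1 ?mulr0//; [exact: bS|case: (circ_notin t)].
Qed.

(** Inherited from the zero-free quotient, which has the same modulus as [f] on the circle. *)
Lemma lnf_contab : contab (fun t => ln (N (f (circ 0 S t)))) 0 (2 * pi).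
Proof.
have [h [rho [Sr dh h0 hf _]]] := blaschke_quotient ok S0 cov hg0 g00 fg0.
have := lnN_ccont dh h0 S0 Sr; congr contab; apply/funext => t.
have [nb NS] := circ_notin t.
by rewrite hf ?NS// bl_circ0 subr0.
Qed.

(** The Blaschke factors have modulus 1 on the circle, so [h] may replace [f] under the integral;
    the zeros and poles reappear in the value of [ln |h|] at the centre. *)
Lemma jensen : rint 0 (2 * pi) (fun t => ln (N (f (circ 0 S t)))) =
  2 * pi * (clead + \sum_(p <- bs) (k p)%:~R * lam p S).
Proof.
have [h [rho [Sr dh h0 hf h00]]] := blaschke_quotient ok S0 cov hg0 g00 fg0.
rewrite -h00 -(jensen_nonvanishing dh h0 S0 Sr); apply: rint_eq => t _.
have [nb NS] := circ_notin t.
by rewrite hf ?NS// bl_circ0 subr0.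
Qed.

Lemma poisson_jensen x y : N x <= S / 2 -> N y <= S / 2 -> x \notin bs -> y \notin bs ->
  ln (N (f x)) - ln (N (f y)) <=
  \sum_(p <- bs) (k p)%:~R * (ln (N (blaschke S p x)) - ln (N (blaschke S p y))) +
  8 * N (x - y) / S * ((2 * pi)^-1 * rint 0 (2 * pi) (fun t => `|ln (N (f (circ 0 S t)))|)).
Proof.
move=> xS yS xb yb.
have [h [rho [Sr dh h0 hf h00]]] := blaschke_quotient ok S0 cov hg0 g00 fg0.
have := poisson_bound dh h0 S0 Sr xS yS.
rewrite (@rint_eq _ (fun t => `|ln (N (h (circ 0 S t)))|) (fun t => `|ln (N (f (circ 0 S t)))|)); last first.
  move=> t _; have [nb NS] := circ_notin t; by rewrite hf ?NS// bl_circ0 subr0.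
move=> H; have {}H := le_trans (ler_norm _) H; move: H.
rewrite !hf//; try (by move: xS yS S0; lra).
under [X in _ -> _ <= X + _]eq_bigr do rewrite mulrBr.
rewrite sumrB; lra.
Qed.

Lemma proximityE : proximity S f = (2 * pi)^-1 * rint 0 (2 * pi) (fun t => Num.max 0 (ln (N (f (circ 0 S t))))).
Proof.
rewrite /proximity; congr (_ * _); apply: eq_Rintegral => t _; rewrite /log_plus.
congr (Num.max _ (ln (N (f _)))); rewrite /circ add0r.
by apply/eqP; rewrite eq_complex /= !mul0r subr0 addr0 !eqxx.
Qed.

Lemma lam_ge0 p : 1 <= S -> p \in bs -> 0 <= lam p S.
Proof.
move=> S1 pb; have [_ _ bS _] := cov; rewrite /lam; case: eqP => [_|/eqP p0]; first exact: ln_ge0.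
apply: ln_ge0; rewrite ler_pdivlMr ?N_gt0// mul1r ltW//; exact: bS.
Qed.

Lemma pole_countE t : 0 <= t -> t <= S ->
  pole_count f t = \sum_(p <- bs) (if N p <= t then (negp (k p))%:R else 0).
Proof.
move=> t0 tS; have [ub b0 bS bg] := cov; rewrite /pole_count.
have -> : \sum_(p \in [set p : R[i]^o | N p <= t]) ((pole_order f p)%:R : R) =
          \sum_(p \in [set p : R[i]^o | N p <= t]) ((negp (k p))%:R : R).
  by apply: eq_fsbigr => p _; rewrite (pole_orderE (ok p)).
rewrite fsbig_mkcond (@fsbigE _ _ _ _ _ bs)//.
  rewrite big_seq_cond [in RHS]big_seq_cond.
  apply: eq_big => [p|p _]; first by rewrite in_setT.
  by rewrite patchE mem_setE.
move=> p _ pb; rewrite patchE mem_setE; case: ifP => // pt.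
by have [_ ->] := covers_k ok cov (le_trans pt tS) pb.
Qed.

Lemma pole_countingE : pole_counting f S = \sum_(p <- bs) (negp (k p))%:R * lam p S.
Proof.
have [ub b0 bS bg] := cov; rewrite /pole_counting.
have pc0 : pole_count f 0 = (negp (k 0))%:R.
  rewrite pole_countE ?lexx ?ltW//.
  transitivity (\sum_(p <- bs) (if p == 0 then (negp (k p))%:R else 0 : R)).
    by apply: eq_bigr => p _; rewrite -N_eq0 eq_le N_ge0 andbT.
  rewrite (bigD1_seq 0)//= eqxx big1 ?addr0// => p /negPf ->//.
have remP p : p \in rem 0 bs -> p \in bs /\ p != 0.
  by rewrite (mem_rem_uniq _ ub) !inE => /andP[].
(* The point [0] is counted for every [t >= 0] and cancels against [pole_count f 0]. What is left is
   a finite sum over the other points of [bs], integrated term by term. *)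
rewrite (@eq_Rintegral _ _ _ mu _ (fun t => \sum_(p <- rem 0 bs) (negp (k p))%:R * inv_from (N p) t)); last first.
  move=> t; rewrite inE /= in_itv /= => /andP[t0 tS].
  have n0 : N (0 : R[i]^o) <= t by rewrite Normc.normc0.
  rewrite pole_countE// pc0 (big_rem _ b0) n0 [X in X - _]addrC addrK mulr_suml.
  apply: eq_big_seq => p _; rewrite /inv_from; case: ifP => _; [by []|by rewrite mul0r mulr0].
have [|_ ->] := @Rint_sum R _ (rem 0 bs) (fun p => (negp (k p))%:R) (fun p => inv_from (N p)) S.
  move=> p /remP [pb p0]; have [||] // := @inv_from_int R (N p) S; first by rewrite N_gt0.
  by rewrite ltW// bS.
rewrite pc0 [in RHS](big_rem _ b0) /= addrC /lam eqxx; congr (_ + _).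
apply: eq_big_seq => p /remP [pb p0]; rewrite (negPf p0); congr (_ * _).
have [||_ ->] // := @inv_from_int R (N p) S; first by rewrite N_gt0.
by rewrite ltW// bS.
Qed.

Lemma kE p : (k p)%:~R = (posp (k p))%:R - (negp (k p))%:R :> R.
Proof. by case: (k p) => n /=; [rewrite subr0|rewrite sub0r NegzE mulrNz]. Qed.

(** This is [|k p|], split into zeros and poles to match the sums in Jensen's formula. *)
Definition kabs p : R := (posp (k p))%:R + (negp (k p))%:R.

(** Write [Z] and [Nn] for the sums over zeros and poles, [P] for the proximity term and [A] for the
    mean of [|ln |f||]. Since [|u| = 2 max(0, u) - u], Jensen's formula reads
    [A = 2 P - (clead + Z - Nn)]. With [0 <= P <= A] and [T = P + Nn] all three bounds are linear
    consequences. *)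
Lemma nevanlinna_bounds : 1 <= S ->
  [/\ \sum_(p <- bs) kabs p * lam p S <= 2 * characteristic S f + `|clead|,
   (2 * pi)^-1 * rint 0 (2 * pi) (fun t => `|ln (N (f (circ 0 S t)))|) <= 2 * characteristic S f + `|clead| &
   \sum_(p <- bs) (posp (k p))%:R * lam p S + clead <= characteristic S f].
Proof.
move=> S1; rewrite /characteristic proximityE pole_countingE.
set P := (2 * pi)^-1 * rint _ _ _; set Nn := \sum_(p <- bs) (negp _)%:R * _.
pose Z : R := \sum_(p <- bs) (posp (k p))%:R * lam p S.
have c1 := lnf_contab.
have cm : contab (fun t => Num.max 0 (ln (N (f (circ 0 S t))))) 0 (2 * pi).
  by move=> t ht; apply: (@continuous_max _ _ (fun=> 0) _ t); [exact: cst_continuous|exact: c1].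
have J := jensen.
have kap : \sum_(p <- bs) (k p)%:~R * lam p S = Z - Nn.
  by rewrite /Z /Nn -sumrB; apply: eq_bigr => p _; rewrite kE mulrBl.
have Z0 : 0 <= Z by rewrite /Z big_seq sumr_ge0// => p pb; rewrite mulr_ge0// lam_ge0.
have Nn0 : 0 <= Nn by rewrite /Nn big_seq sumr_ge0// => p pb; rewrite mulr_ge0// lam_ge0.
have tp : 0 < (2 * pi)^-1 :> R by rewrite invr_gt0 twopi_gt0.
pose A := (2 * pi)^-1 * rint 0 (2 * pi) (fun t => `|ln (N (f (circ 0 S t)))|).
have AE : A = 2 * P - (clead + (Z - Nn)).
  rewrite /A /P -kap.
  have -> : clead + \sum_(p <- bs) (k p)%:~R * lam p S = (2 * pi)^-1 * rint 0 (2 * pi) (fun t => ln (N (f (circ 0 S t)))).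
    rewrite J mulrA mulVf ?mul1r// gt_eqF// twopi_gt0//.
  rewrite (@rint_eq _ (fun t => `|ln (N (f (circ 0 S t)))|) (fun t => 2 * Num.max 0 (ln (N (f (circ 0 S t)))) + (-1) * ln (N (f (circ 0 S t))))); last first.
    move=> t _; rewrite /Num.max; case: ltP => h; [rewrite gtr0_norm//|rewrite ler0_norm//]; lra.
  rewrite rintD; [|exact: (contabM (@contabC _ 2 0 (2 * pi)) cm)|exact: (contabM (@contabC _ (-1) 0 (2 * pi)) c1)].
  rewrite (rintZ 2 cm) (rintZ (-1) c1); ring.
have PA : P <= A.
  rewrite /P /A ler_pM2l//; apply: rint_le => //; first exact: contab_norm.
  by move=> t _; rewrite ge_max normr_ge0 ler_norm.
have cl := ler_norm (- clead); rewrite normrN in cl.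
have -> : \sum_(p <- bs) kabs p * lam p S = Z + Nn.
  by rewrite /Z /Nn -big_split; apply: eq_bigr => p _; rewrite /kabs mulrDl.
have P0 : 0 <= P.
  rewrite /P mulr_ge0 ?(ltW tp)//; apply: Rintegral_ge0 => t _; by rewrite le_max lexx.
rewrite -/A -/Z; split; lra.
Qed.
End Nevanlinna.

(** * Logarithmic singularities on the circle *)

Section Kernel.
Context {R : realType}.
Notation mu := (@lebesgue_measure R).
Implicit Types (p z w : R[i]^o) (t u : R).

(* [f] need not be measurable: the integral is a supremum over simple minorants.
   This matters because the branch [zeta] of the theorem is arbitrary. *)
Lemma le_integral_nomeas (D : set R) (f g : R -> \bar R) :
  (forall x, D x -> 0 <= f x)%E -> (forall x, D x -> f x <= g x)%E ->
  (\int[mu]_(x in D) f x <= \int[mu]_(x in D) g x)%E.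
Proof.
move=> f0 fg; have g0 x : D x -> (0 <= g x)%E by move=> Dx; exact: le_trans (f0 x Dx) (fg x Dx).
rewrite (@ge0_integralE _ _ _ mu D f f0) (@ge0_integralE _ _ _ mu D g g0).
apply: le_ereal_sup => _ [h hf <-]; exists h => // x; apply: le_trans (hf x) _.
rewrite !patchE; case: ifPn => // /set_mem; exact: fg.
Qed.

(** On [[0, pi / 4]] the cosine is at least [1 / 2], so the mean value theorem gives [u / 2]; beyond
    [pi / 4] the sine increases while [u] at most doubles. *)
Lemma sin_ge u : 0 <= u <= pi / 2 -> u / 4 <= sin u.
Proof.
have pi0 := pi_gt0 R.
have c4 : (1 / 2 : R) <= cos (pi / 4).
  have h : cos (pi / 2) = cos (pi / 4) ^+ 2 *+ 2 - 1 :> R.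
    by rewrite -cos_mulr2n -mulr_natl; congr cos; field.
  have c0 : 0 <= cos (pi / 4) :> R by apply: cos_ge0_pihalf; lra.
  rewrite cos_pihalf in h; rewrite leNgt; apply/negP => c1.
  have : cos (pi / 4 : R) ^+ 2 < 1 / 2 by nra.
  move: h; rewrite -mulr_natl; lra.
have low (v : R) : 0 <= v <= pi / 4 -> v / 2 <= sin v.
  move=> /andP[u0 u4]; have [|c /andP[]] := @MVT_segment R sin cos 0 v u0 (fun x _ => is_derive_sin x).
    exact/continuous_subspaceT/continuous_sin.
  rewrite !bnd_simp => c0 cu; rewrite sin0 !subr0 => ->.
  rewrite mulrC ler_wpM2r//; apply: (@le_trans _ _ (cos (pi / 4))); first lra.
  rewrite leNgt ltr_cos ?in_itv /= -?leNgt; lra.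
move=> /andP[u0 u2]; have [u4|u4] := leP u (pi / 4).
  by apply: le_trans (low u _); [lra|rewrite u0].
apply: (@le_trans _ _ (sin (pi / 4))); last first.
  by rewrite leNgt ltr_sin ?in_itv /= -?leNgt; lra.
apply: le_trans (low (pi / 4) _); lra.
Qed.

Definition cis t : R[i]^o := circ 0 1 t.
Lemma cisE t : cis t = (cos t +i* sin t)%C.
Proof. by rewrite /cis /circ add0r mul1r. Qed.

Lemma cis_dist t u : N (cis t - cis u) = 2 * `|sin ((t - u) / 2)|.
Proof.
have h : cos (t - u) = 1 - 2 * sin ((t - u) / 2) ^+ 2.
  have := cos2Dsin2 ((t - u) / 2); have := cos_mulr2n ((t - u) / 2).
  rewrite (_ : ((t - u) / 2) *+ 2 = t - u); last by rewrite -mulr_natl; field.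
  by rewrite -mulr_natl => -> e; lra.
rewrite cosB in h; have c1 := cos2Dsin2 t; have c2 := cos2Dsin2 u.
have E : (cos t - cos u) ^+ 2 + (sin t - sin u) ^+ 2 = (2 * `|sin ((t - u) / 2)|) ^+ 2.
  rewrite exprMn real_normK ?num_real//; nra.
rewrite !cisE /= E.
by rewrite sqrtr_sqr ger0_norm// mulr_ge0.
Qed.

Lemma sin_small (x d : R) : 0 <= x <= pi -> sin x <= d -> x <= 4 * d \/ pi - x <= 4 * d.
Proof.
move=> /andP[x0 xp] h; have [x2|x2] := leP x (pi / 2).
  by left; have := @sin_ge x; rewrite x0 x2 => /(_ isT); lra.
right; have e : sin (pi - x) = sin x.
  by rewrite addrC sinDpi sinN opprK.
have := @sin_ge (pi - x); rewrite e => H.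
have {}H : (pi - x) / 4 <= sin x by apply: H; lra.
lra.
Qed.

Definition near_set n w : set R := [set t | N (cis t - w) <= 2^-1 ^+ n].

Lemma near_set_meas n w : measurable (near_set n w).
Proof.
have c : continuous (fun t => N (cis t - w)).
  move=> t; have h := contB (@circ_cont R 0 1 t) (@contK _ _ w t).
  exact: (@continuous_comp _ _ _ (fun u : R => circ 0 1 u - w) (@Normc.normc R) t h (@N_cont R _)).
apply: closed_measurable; apply: (closed_comp (f := fun t => N (cis t - w)) (D := [set x | x <= 2^-1 ^+ n])).
  by move=> t _; exact: c.
exact: closed_le.
Qed.

(** Two points of the set have chord at most [2 d], so every point lies within [8 d] of a fixed one
    modulo [2 pi]. This leaves one interval of length [16 d] and its two translates, hence
    [48 d]. *)
Lemma near_set_mu n w : (mu (near_set n w `&` `[0%R, (2 * pi)%R]) <= (48 * 2^-1 ^+ n)%:E)%E.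
Proof.
set d := 2^-1 ^+ n; have d0 : 0 < d by rewrite exprn_gt0.
case: (pselect ((near_set n w `&` `[0%R, (2 * pi)%R]) !=set0)) => [[t0 [h1 h2]]|]; last first.
  by move=> /set0P/negP; rewrite negbK => /eqP ->; rewrite measure0 lee_fin mulr_ge0// ltW.
pose J a : set R := `[a - 8 * d, a + 8 * d]%classic.
have mJ a : mu (J a) = (16 * d)%:E.
  rewrite /J lebesgue_measure_itv /= lte_fin ifT; last lra.
  by rewrite -EFinB; congr EFin; ring.
have sub : near_set n w `&` `[0%R, (2 * pi)%R] `<=` J t0 `|` (J (t0 + 2 * pi) `|` J (t0 - 2 * pi)).
  move=> t [/= k1 k2]; move: h1 h2 k1 k2; rewrite /near_set /= !in_itv /= => h1 /andP[h2 h3] k1 /andP[k2 k3].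
  have D : N (cis t - cis t0) <= 2 * d.
    have -> : cis t - cis t0 = (cis t - w) - (cis t0 - w) by ring.
    by apply: le_trans (NB _ _) _; rewrite -/d in h1 k1; lra.
  have S x : 0 <= x -> `|sin x| <= d -> x <= pi -> x <= 4 * d \/ pi - x <= 4 * d.
    move=> x0 hs xp; apply: sin_small; first by rewrite x0.
    by apply: le_trans hs; exact: ler_norm.
  rewrite cis_dist ler_pM2l// in D.
  have [tt|tt] := leP t0 t.
    have [||c|c] := S ((t - t0) / 2) _ D; try lra.
      by left; rewrite /J /= in_itv /=; lra.
    by right; left; rewrite /J /= in_itv /=; lra.
  rewrite -normrN -sinN in D.
  have e : - ((t - t0) / 2) = (t0 - t) / 2 by field.
  rewrite e in D.
  have [||c|c] := S ((t0 - t) / 2) _ D; try lra.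
    by left; rewrite /J /= in_itv /=; lra.
  by right; right; rewrite /J /= in_itv /=; lra.
have mJm a : measurable (J a) by exact: measurable_itv.
apply: le_trans (le_measure mu _ _ sub) _; rewrite ?inE.
- by apply: measurableI; [exact: near_set_meas|exact: measurable_itv].
- by apply: measurableU; [exact: mJm|apply: measurableU; exact: mJm].
have m2 := measurableU _ _ (mJm (t0 + 2 * pi)) (mJm (t0 - 2 * pi)).
apply: (@le_trans _ _ (mu (J t0) + mu (J (t0 + 2 * pi)%R `|` J (t0 - 2 * pi)%R))%E); first exact: (measureU2 mu (mJm _) m2).
have -> : (48 * d)%:E = ((16 * d)%:E + (32 * d)%:E)%E by rewrite -EFinD; congr EFin; ring.
rewrite mJ leeD2l//.
apply: (@le_trans _ _ (mu (J (t0 + 2 * pi)%R) + mu (J (t0 - 2 * pi)%R))%E); first exact: (measureU2 mu (mJm _) (mJm _)).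
by rewrite !mJ -EFinD lee_fin; lra.
Qed.

(* A measurable majorant of the positive part of [ln (1 / |e^it - w|)], infinite
   at the pole: it counts the dyadic discs around [w] that contain [e^it]. *)
Definition log_kernel w t : \bar R := (\sum_(0 <= n <oo) (\1_(near_set n w) t)%:E)%E.

Lemma log_kernel_ge0 w t : (0 <= log_kernel w t)%E.
Proof. by apply: nneseries_ge0 => n _ _; rewrite lee_fin. Qed.

Lemma log_kernel_meas w : measurable_fun `[0%R, (2 * pi)%R] (log_kernel w).
Proof.
apply: ge0_emeasurable_sum => [n x _ _|n _]; first by rewrite lee_fin.
apply/measurable_EFinP; apply: measurable_indic; exact: near_set_meas.
Qed.

(** The geometric series of the bounds [48 * 2 ^ - n]. What matters is that the bound does not
    depend on the pole [w]. *)
Lemma log_kernel_int w : (\int[mu]_(t in `[0%R, (2 * pi)%R]) log_kernel w t <= 96%:E)%E.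
Proof.
rewrite /log_kernel integral_nneseries//; last first.
  move=> n; apply/measurable_EFinP; apply: measurable_indic; exact: near_set_meas.
apply: (@le_trans _ _ (\sum_(0 <= n <oo) (48 * 2^-1 ^+ n : R)%:E)%E).
  apply: lee_nneseries => [n _ _|n _]; first by apply: integral_ge0 => t _; rewrite lee_fin.
  rewrite integral_indic//; last exact: near_set_meas.
  exact: near_set_mu.
apply: lime_le.
  by apply: is_cvg_nneseries => n _ _; rewrite lee_fin mulr_ge0// exprn_ge0.
apply: nearW => m /=; rewrite sumEFin lee_fin.
suff -> : \sum_(0 <= i < m) 48 * 2^-1 ^+ i = 96 - 96 * 2^-1 ^+ m :> R.
  by rewrite lerBlDr lerDl mulr_ge0// exprn_ge0.
elim: m => [|m IH]; first by rewrite big_geq// expr0; ring.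
by rewrite big_nat_recr//= IH exprS; field.
Qed.

Lemma log_kernel_ge w t m : (forall n, (n < m)%N -> N (cis t - w) <= 2^-1 ^+ n) -> (m%:R%:E <= log_kernel w t)%E.
Proof.
move=> H; apply: le_trans (nneseries_lim_ge m _); last by move=> n _ _; rewrite lee_fin.
rewrite sumEFin lee_fin (eq_big_nat _ _ (F2 := fun=> 1)); last first.
  by move=> n /andP[_ nm]; rewrite indicE mem_set//; exact: H.
by rewrite big_const_nat subn0 iter_addr_0.
Qed.

Lemma log_kernel_pole w t : cis t = w -> log_kernel w t = +oo%E.
Proof.
move=> e; apply: eq_infty => x.
have H m : (m%:R%:E <= log_kernel w t)%E.
  by apply: log_kernel_ge => n _; rewrite e subrr Normc.normc0 exprn_ge0.
apply: le_trans (H (Num.bound (Num.max 0 x))); rewrite lee_fin.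
have h : 0 <= Num.max 0 x by rewrite le_max lexx.
by apply: le_trans (ltW (archi_boundP h)); rewrite le_max lexx orbT.
Qed.

(** For the least [m] with [2 ^ - m < |e^it - w|], the first [m] dyadic discs contain [e^it], while
    [ln (1 / |e^it - w|) <= m ln 2 <= m]. *)
Lemma log_kernel_bound w t : cis t != w -> ((Num.max 0 (ln (N (cis t - w))^-1))%:E <= log_kernel w t)%E.
Proof.
move=> cw; have y0 : 0 < N (cis t - w) by rewrite N_gt0 subr_eq0.
set y := N (cis t - w) in y0 *.
have ex : exists n, 2^-1 ^+ n < y by have [n] := half_pow_lt 1 y0; rewrite mul1r; exists n.
have [m my mmin] := ex_minnP ex.
rewrite EFin_max ge_max log_kernel_ge0 /=.
apply: le_trans (@log_kernel_ge w t m _); last first.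
  move=> n nm; rewrite leNgt; apply/negP => /mmin; by rewrite leqNgt nm.
rewrite lee_fin lnV// lerNl; apply: le_trans (_ : ln (2^-1 ^+ m) <= _); last first.
  by rewrite ler_ln ?posrE ?exprn_gt0// ltW.
have -> : ln (2^-1 ^+ m) = - (m%:R * ln 2) :> R by rewrite lnXn// lnV ?posrE// mulNrn mulr_natl.
rewrite lerN2 ler_piMr//.
have := @le_ln1Dx R 1; rewrite (_ : 1 + 1 = 2 :> R); last by lra.
apply; lra.
Qed.
End Kernel.

(** * The Askey-Wilson difference quotient on a circle *)

Section AW.
Context {R : realType}.
Notation mu := (@lebesgue_measure R).
Implicit Types (x y p w : R[i]^o).
Variables (qh : R[i]^o) (zeta : R[i]^o -> R[i]^o).
Hypothesis hzeta : joukowski_branch zeta.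
Hypothesis qh0 : qh != 0.

Notation hat := (aw_hat qh zeta).
Notation chk := (aw_check qh zeta).

Lemma zetaP x : zeta x != 0 /\ zeta x + (zeta x)^-1 = 2 * x.
Proof.
have h := hzeta x.
have e : zeta x * zeta x + 1 = 2 * x * zeta x.
  have -> : zeta x * zeta x + 1 = (zeta x - x) ^+ 2 - (x ^+ 2 - 1) + 2 * x * zeta x by ring.
  by rewrite h subrr add0r.
have z0 : zeta x != 0.
  by apply/eqP => z0; move: e; rewrite z0 !mulr0 add0r => /eqP; rewrite oner_eq0.
split=> //; apply: (mulIf z0); rewrite -e mulrDl mulVf//.
Qed.

Lemma N2 : N (2 : R[i]^o) = 2.
Proof. by rewrite (_ : 2 = (2 : R)%:C) ?NR ?normr_nat// rmorph_nat. Qed.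

Lemma N_zeta x : 1 <= N x -> N (zeta x) <= 3 * N x /\ N (zeta x)^-1 <= 3 * N x.
Proof.
move=> x1; have [z0 zE] := zetaP x; have h := hzeta x.
have b : N (zeta x - x) <= 2 * N x.
  have : N (zeta x - x) ^+ 2 <= (2 * N x) ^+ 2.
    rewrite -NX h; apply: le_trans (NB _ _) _; rewrite NX Normc.normc1; nra.
  by rewrite ler_pXn2r// nnegrE ?N_ge0// mulr_ge0 ?N_ge0.
have -> : (zeta x)^-1 = 2 * x - zeta x by rewrite -zE; ring.
split.
  have -> : zeta x = (zeta x - x) + x by ring.
  by apply: le_trans (ND _ _) _; lra.
have -> : 2 * x - zeta x = x - (zeta x - x) by ring.
by apply: le_trans (NB _ _) _; lra.
Qed.

(** [awK - 1] bounds [|x^| / |x|] and [|x_| / |x|] for [|x| >= 1]; the additional 1 makes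
    [awK * |x|] a bound for the displacements [|x^ - x|] and [|x_ - x|] as well. *)
Definition awK : R := 2 * (N qh + (N qh)^-1) + 1.

Lemma awK_ge1 : 1 <= awK.
Proof. by rewrite /awK lerDr mulr_ge0// addr_ge0 ?invr_ge0 ?N_ge0. Qed.

Lemma N_half x y (a b r : R) : N x <= a -> N y <= b -> N ((x + y) / 2) <= (a + b) / 2.
Proof.
move=> h1 h2; rewrite Normc.normcM Normc.normcV N2 ler_pM2r ?invr_gt0//.
by apply: le_trans (ND _ _) _; exact: lerD.
Qed.

Lemma N_hat x : 1 <= N x -> N (hat x) <= (awK - 1) * N x /\ N (chk x) <= (awK - 1) * N x.
Proof.
move=> x1; have [h1 h2] := N_zeta x1.
have a0 : 0 < N qh by rewrite N_gt0.
have b0 : 0 < (N qh)^-1 by rewrite invr_gt0.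
have x0 := N_ge0 x.
have bd u v : N (u * v) = N u * N v := Normc.normcM u v.
have e1 (u : R[i]^o) : N u <= 3 * N x -> N (qh * u) <= N qh * (3 * N x).
  by move=> h; rewrite bd ler_wpM2l// ltW.
have e2 (u : R[i]^o) : N u <= 3 * N x -> N (qh^-1 * u) <= (N qh)^-1 * (3 * N x).
  by move=> h; rewrite bd Normc.normcV ler_wpM2l// ltW.
rewrite /awK; split; rewrite /aw_hat /aw_check.
  apply: le_trans (N_half 0 (e1 _ h1) (e2 _ h2)) _; nra.
apply: le_trans (N_half 0 (e2 _ h1) (e1 _ h2)) _; nra.
Qed.

(* Both sides are x^2 + p^2 - (q^(1/2) + q^(-1/2)) x p + (q^(1/2) - q^(-1/2))^2 / 4.
   The identity turns zeros of [f] at the shifted points into values of [x]. *)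
Lemma aw_identity x p : (hat x - p) * (chk x - p) = (x - hat p) * (x - chk p).
Proof.
have [z0 zE] := zetaP x; have [w0 wE] := zetaP p.
have xE : x = (zeta x + (zeta x)^-1) / 2 by rewrite zE; field.
have pE : p = (zeta p + (zeta p)^-1) / 2 by rewrite wE; field.
rewrite /aw_hat /aw_check; move: (zeta x) (zeta p) z0 w0 xE pE => z w z0 w0 -> ->.
by field; rewrite qh0 z0 w0.
Qed.

Lemma aw_diff x : (hat x - chk x) ^+ 2 = (qh - qh^-1) ^+ 2 * (x ^+ 2 - 1).
Proof.
have [z0 zE] := zetaP x; have h := hzeta x.
rewrite /aw_hat /aw_check -h.
have -> : (zeta x)^-1 = 2 * x - zeta x by rewrite -zE; ring.
by field.
Qed.

Lemma aw_diff_ge1 : N qh != 1 -> exists r0, 1 < r0 /\ forall x, r0 <= N x -> 1 <= N (hat x - chk x).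
Proof.
move=> q1; have d0 : 0 < N (qh - qh^-1).
  rewrite N_gt0 subr_eq0; apply: contraNneq q1 => e.
  have : N qh * N qh = 1 by rewrite -Normc.normcM {2}e divff// Normc.normc1.
  have h0 := N_ge0 qh => h; apply/eqP.
  have /eqP : (N qh - 1) * (N qh + 1) = 0 by rewrite mulrDr mulrBl h; ring.
  rewrite mulf_eq0 => /orP[|] /eqP; lra.
set d := N _ in d0; exists (2 + d^-1).
have i0 : 0 < d^-1 by rewrite invr_gt0.
split; first lra.
move=> x hx; have : 1 <= N (hat x - chk x) ^+ 2.
  rewrite -NX aw_diff Normc.normcM NX -/d.
  have h2 : N x ^+ 2 - 1 <= N (x ^+ 2 - 1) by apply: le_trans (NB_le _ _); rewrite NX Normc.normc1.
  apply: (@le_trans _ _ (d ^+ 2 * (N x ^+ 2 - 1))); last by rewrite ler_wpM2l ?sqr_ge0.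
  have h3 : d^-1 ^+ 2 <= N x ^+ 2 - 1 by nra.
  have e1 : d ^+ 2 * d^-1 ^+ 2 = 1 :> R by rewrite -exprMn divff ?expr1n// gt_eqF.
  rewrite -[X in X <= _]e1.
  by rewrite ler_wpM2l ?sqr_ge0.
have n0 := N_ge0 (hat x - chk x); nra.
Qed.

Lemma log_plus_ge0 (a : R) : 0 <= log_plus a. Proof. by rewrite /log_plus le_max lexx. Qed.
Lemma log_plus_ge (a : R) : ln a <= log_plus a. Proof. by rewrite /log_plus le_max lexx orbT. Qed.

(** If [b >= r] the ratio [a / b] is at most [1 + K]; otherwise [a <= (1 + K) r] and the rest is
    [r / b = 1 / nu]. *)
Lemma ln_ratio1 (a b r K nu : R) : 0 < r -> 0 <= K -> 0 < a -> 0 < b -> nu = b / r -> a <= b + K * r ->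
  ln a - ln b <= ln (1 + K) + log_plus nu^-1.
Proof.
move=> r0 K0 a0 b0 -> ab; have nu0 : 0 < b / r by rewrite divr_gt0.
rewrite -ln_div ?posrE//.
have K1 : 0 < 1 + K by lra.
have [c|c] := leP r b.
  apply: (@le_trans _ _ (ln (1 + K))); last by rewrite lerDl log_plus_ge0.
  rewrite ler_ln ?posrE ?divr_gt0// ler_pdivrMr//; nra.
apply: (@le_trans _ _ (ln (1 + K) + ln (b / r)^-1)); last by rewrite lerD2l log_plus_ge.
rewrite -lnM ?posrE ?invr_gt0// ler_ln ?posrE ?divr_gt0 ?mulr_gt0 ?invr_gt0//.
by rewrite ler_pdivrMr// invf_div -mulrA divfK ?gt_eqF//; nra.
Qed.

(** Here the small quantity [b] is a distance at a shifted point, which must not appear in the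
    result. When [b < r], the relation [b b' = u v] and [b' <= (2 K + 1) r] replace [1 / b] by
    [(2 K + 1) r / (u v)], with [u] and [v] distances from [x] itself. *)
Lemma ln_ratio2 (a b b' u v r K nu1 nu2 : R) : 0 < r -> 0 <= K -> 0 < a -> 0 < b -> 0 < b' -> 0 < u -> 0 < v ->
  nu1 = u / r -> nu2 = v / r -> a <= b + K * r -> b' <= b + 2 * K * r -> b * b' = u * v ->
  ln a - ln b <= ln ((1 + K) * (2 * K + 1)) + (log_plus nu1^-1 + log_plus nu2^-1).
Proof.
move=> r0 K0 a0 b0 b'0 u0 v0 -> -> ab bb uv.
have l1 := log_plus_ge0 (u / r)^-1; have l2 := log_plus_ge0 (v / r)^-1.
have K1 : 0 < 1 + K by lra. have K2 : 0 < 2 * K + 1 by lra.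
rewrite -ln_div ?posrE//.
have [c|c] := leP r b.
  apply: (@le_trans _ _ (ln ((1 + K) * (2 * K + 1)))); last by rewrite lerDl addr_ge0.
  rewrite ler_ln ?posrE ?divr_gt0 ?mulr_gt0// ler_pdivrMr//.
  apply: (@le_trans _ _ ((1 + K) * b)); first nra.
  by apply: ler_wpM2r; [exact: ltW|rewrite ler_peMr; lra].
apply: (@le_trans _ _ (ln ((1 + K) * (2 * K + 1)) + (ln (u / r)^-1 + ln (v / r)^-1))); last first.
  by rewrite lerD2l lerD// log_plus_ge.
rewrite -lnM ?posrE ?invr_gt0 ?divr_gt0// -lnM ?posrE ?mulr_gt0 ?invr_gt0 ?divr_gt0//.
rewrite ler_ln ?posrE ?divr_gt0 ?mulr_gt0 ?invr_gt0 ?divr_gt0//.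
rewrite ler_pdivrMr// !invf_div.
have -> : (1 + K) * (2 * K + 1) * (r / u * (r / v)) * b = (1 + K) * r * ((2 * K + 1) * r / b').
  have -> : b = u * v / b' by rewrite -uv mulfK// gt_eqF.
  by field; rewrite !gt_eqF.
apply: (@le_trans _ _ ((1 + K) * r)); first nra.
apply: ler_peMr; first by rewrite mulr_ge0// ltW.
by rewrite ler_pdivlMr// mul1r; nra.
Qed.

Lemma intz_mul_le (n : int) (d b : R) : d <= b -> - d <= b ->
  n%:~R * d <= ((posp n)%:R + (negp n)%:R) * b.
Proof.
case: n => n d1 d2 /=; first by rewrite addr0 ler_wpM2l.
by rewrite add0r NegzE mulrNz mulNr -mulrN ler_wpM2l.
Qed.

Section Est.
Variables (f : R[i]^o -> R[i]^o) (k : R[i]^o -> int) (g0 : R[i]^o -> R[i]^o).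
Hypothesis ok : forall p, ord_at f p (k p).
Hypothesis hg0 : hol_near g0 0.
Hypothesis g00 : g0 0 != 0.
Hypothesis fg0 : nbhs ((0 : R[i]^o)^') (fun z => f z = g0 z * (z - 0) ^ (k 0)).
Variables (S r : R) (bs : seq R[i]^o).
Hypothesis r1 : 1 < r.
Hypothesis rS : awK * r <= S / 2.
Hypothesis cov : covers f S bs.
Hypothesis dge : forall x, N x = r -> 1 <= N (hat x - chk x).

Let K := awK.
Let c3 : R := ln ((1 + K) * (2 * K + 1)) + 2.
Let A : R := (2 * pi)^-1 * rint 0 (2 * pi) (fun t => `|ln (N (f (circ 0 S t)))|).
Let r0 : 0 < r. Proof. exact: lt_trans r1. Qed.
Let K1 : 1 <= K. Proof. exact: awK_ge1. Qed.
Let S0 : 0 < S. Proof. have := mulr_gt0 (lt_le_trans ltr01 K1) r0; move: rS; rewrite -/K; lra. Qed.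

(** The pole is rescaled to the unit circle, where the bound on the integral of [log_kernel] is
    uniform. *)
Definition sing p t : R := log_plus (N (cis t - p / (r%:C : R[i]^o)))^-1.
Definition singM p t : R := sing p t + (sing (hat p) t + sing (chk p) t).

Lemma sing_scale p t : N (cis t - p / (r%:C : R[i]^o)) = N (circ 0 r t - p) / r.
Proof.
have rn : (r%:C : R[i]^o) != 0 by rewrite realC_neq0 ?gt_eqF.
have -> : circ 0 r t - p = (r%:C : R[i]^o) * (cis t - p / (r%:C : R[i]^o)).
  rewrite /cis /circ !add0r mul1r; move: (_ +i* _)%C => c; field; exact: rn.
by rewrite Normc.normcM NR gtr0_norm// mulrAC divff ?mul1r// gt_eqF.
Qed.

(** Both moduli lie between [S ^ 2 / 2] and [3 S ^ 2 / 2], and [ln 3 <= 2]. This is the summand 2 of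
    [c3]. *)
Lemma ratio_den x y p : N x <= S / 2 -> N y <= S / 2 -> N p < S ->
  ln (N (((S ^+ 2)%:C : R[i]^o) - p^*%C * x)) - ln (N (((S ^+ 2)%:C : R[i]^o) - p^*%C * y)) <= 2.
Proof.
move=> hx hy hp.
have bnd z : N z <= S / 2 -> S ^+ 2 / 2 <= N (((S ^+ 2)%:C : R[i]^o) - p^*%C * z) <= 3 * (S ^+ 2 / 2).
  move=> hz; have e : N (p^*%C * z) <= S ^+ 2 / 2.
    rewrite Normc.normcM N_conj expr2 -mulrA; apply: ler_pM; rewrite ?N_ge0//; exact: ltW.
  have e2 : N ((S ^+ 2)%:C : R[i]^o) = S ^+ 2 by rewrite NR ger0_norm ?sqr_ge0.
  apply/andP; split.
    by apply: le_trans (NB_le _ _); rewrite e2; lra.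
  by apply: le_trans (NB _ _) _; rewrite e2; lra.
have /andP[_ b2] := bnd x hx; have /andP[b3 b4] := bnd y hy.
have /andP[b1 _] := bnd x hx.
have S2 : 0 < S ^+ 2 / 2 by rewrite divr_gt0// exprn_gt0.
rewrite -ln_div ?posrE; [|exact: lt_le_trans b1|exact: lt_le_trans b3].
have := @le_ln1Dx R 2; rewrite (_ : 1 + 2 = 3 :> R); last lra.
move=> h; apply: (@le_trans _ _ (ln 3)); last by apply: h; lra.
rewrite ler_ln ?posrE ?divr_gt0//; [|exact: lt_le_trans b1|exact: lt_le_trans b3].
rewrite ler_pdivrMr; last exact: lt_le_trans b3.
by apply: le_trans b2 _; lra.
Qed.

(** Here [y] is the shifted point under estimation and [y'] the other one. The difference is bounded
    with both signs, as [k p] is positive at zeros and negative at poles: one sign only involves the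
    singularity at [p], the other goes through the product identity to the singularities at [hat p]
    and [chk p]. *)
Lemma term_bound t y y' p : let x := circ 0 r t in
  (hat x = y /\ chk x = y' \/ hat x = y' /\ chk x = y) -> p \in bs ->
  x != p -> y != p -> y' != p ->
  (k p)%:~R * (ln (N (blaschke S p y)) - ln (N (blaschke S p x))) <= kabs k p * (c3 + singM p t).
Proof.
move=> x xy pb xp yp y'p; have [_ _ bS _] := cov; have pS := bS p pb.
have Nx : N x = r by rewrite -[x]subr0 N_circ// ltW.
have x1 : 1 <= N x by rewrite Nx ltW.
have [Nh Nc] := N_hat x1; rewrite Nx in Nh Nc.
have hyy : N y <= (K - 1) * r /\ N y' <= (K - 1) * r by case: xy => [[<- <-]|[<- <-]].
have xS : N x <= S / 2 by rewrite Nx; move: rS K1 r0; rewrite -/K; nra.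
have yS : N y <= S / 2 by move: rS hyy.1 r0; rewrite -/K; nra.
have xS' : N x <= S by move: xS S0; lra.
have yS' : N y <= S by move: yS S0; lra.
have dn := N_gt0.
have nx : 0 < N (x - p) by rewrite N_gt0 subr_eq0.
have ny : 0 < N (y - p) by rewrite N_gt0 subr_eq0.
have ny' : 0 < N (y' - p) by rewrite N_gt0 subr_eq0.
have prod : (y - p) * (y' - p) = (x - hat p) * (x - chk p).
  by rewrite -aw_identity; case: xy => [[<- <-]//|[<- <-]]; rewrite mulrC.
have hh : x - hat p != 0 /\ x - chk p != 0.
  have : (x - hat p) * (x - chk p) != 0 by rewrite -prod mulf_neq0// subr_eq0.
  by rewrite mulf_eq0 negb_or => /andP[].
have lnB z : N z <= S -> z != p -> ln (N (blaschke S p z)) = ln S + ln (N (z - p)) - ln (N (((S ^+ 2)%:C : R[i]^o) - p^*%C * z)).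
  move=> zS zp; have d0 := blaschke_den pS zS; have zp0 : 0 < N (z - p) by rewrite N_gt0 subr_eq0.
  rewrite /blaschke !Normc.normcM Normc.normcV NR gtr0_norm// ln_div ?posrE ?mulr_gt0// ?N_gt0//.
  by rewrite lnM ?posrE.
set D := ln _ - _.
have DE : D = (ln (N (y - p)) - ln (N (x - p))) + (ln (N (((S ^+ 2)%:C : R[i]^o) - p^*%C * x)) - ln (N (((S ^+ 2)%:C : R[i]^o) - p^*%C * y))).
  by rewrite /D !lnB//; ring.
have e1 := ratio_den xS yS pS; have e2 := ratio_den yS xS pS.
have K0 : 0 <= K by move: K1; lra.
have Nyx : N (y - x) <= K * r.
  by apply: le_trans (NB _ _) _; rewrite Nx; move: hyy.1; lra.
have s0 q : 0 <= sing q t by exact: log_plus_ge0.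
have D1 : D <= c3 + singM p t.
  have l : ln (N (y - p)) - ln (N (x - p)) <= ln (1 + K) + sing p t.
    apply: (ln_ratio1 r0 K0 ny nx (sing_scale p t)).
    have -> : y - p = (x - p) + (y - x) by ring.
    by apply: le_trans (ND _ _) _; rewrite lerD2l.
  have l2 : ln (1 + K) <= ln ((1 + K) * (2 * K + 1)).
    have p1 : 0 < 1 + K by move: K1; lra.
    have p2 : 0 < 2 * K + 1 by move: K1; lra.
    rewrite ler_ln ?posrE; [|exact: p1|exact: mulr_gt0].
    by apply: ler_peMr; [exact: ltW|move: K1; lra].
  rewrite DE /c3 /singM; have := s0 (hat p); have := s0 (chk p); lra.
have D2 : - D <= c3 + singM p t.
  have l : ln (N (x - p)) - ln (N (y - p)) <= ln ((1 + K) * (2 * K + 1)) + (sing (hat p) t + sing (chk p) t).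
    apply: (ln_ratio2 (b' := N (y' - p)) r0 K0 nx ny ny' _ _ (sing_scale (hat p) t) (sing_scale (chk p) t)).
    - by rewrite N_gt0 hh.1.
    - by rewrite N_gt0 hh.2.
    - have -> : x - p = (y - p) - (y - x) by ring.
      by apply: le_trans (NB _ _) _; rewrite lerD2l.
    - have -> : y' - p = (y - p) + (y' - y) by ring.
      apply: le_trans (ND _ _) _; rewrite lerD2l; apply: le_trans (NB _ _) _.
      by move: hyy.1 hyy.2; nra.
    - by rewrite -!Normc.normcM prod.
  rewrite DE /c3 /singM; have := s0 p; lra.
exact: intz_mul_le.
Qed.

Lemma ratio_bound t y y' : let x := circ 0 r t in
  (hat x = y /\ chk x = y' \/ hat x = y' /\ chk x = y) ->
  x \notin bs -> y \notin bs -> y' \notin bs ->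
  N (f y) <= expR (8 * K * r / S * A + \sum_(p <- bs) kabs k p * (c3 + singM p t)) * N (f x).
Proof.
move=> x xy xb yb y'b.
have Nx : N x = r by rewrite -[x]subr0 N_circ// ltW.
have x1 : 1 <= N x by rewrite Nx ltW.
have [Nh Nc] := N_hat x1; rewrite Nx in Nh Nc.
have hyy : N y <= (K - 1) * r by case: xy => [[<- _]|[_ <-]].
have xS : N x <= S / 2 by rewrite Nx; move: rS K1 r0; rewrite -/K; nra.
have yS : N y <= S / 2 by move: rS hyy r0; rewrite -/K; nra.
have fx0 : 0 < N (f x).
  have h : N x <= S by move: xS S0; lra.
  by rewrite N_gt0; have [[_ h'] _] := covers_k ok cov h xb; exact: h'.
have fy0 : 0 < N (f y).
  have h : N y <= S by move: yS S0; lra.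
  by rewrite N_gt0; have [[_ h'] _] := covers_k ok cov h yb; exact: h'.
rewrite -ler_pdivrMr// -[leLHS]lnK ?posrE ?divr_gt0// ler_expR ln_div ?posrE//.
apply: le_trans (poisson_jensen ok hg0 g00 fg0 S0 cov yS xS yb xb) _.
rewrite -/A addrC; apply: lerD.
  rewrite ler_wpM2r//.
    rewrite /A mulr_ge0 ?invr_ge0 ?twopi_ge0//; apply: Rintegral_ge0 => u _ //.
  rewrite -!mulrA ler_wpM2l// !mulrA ler_wpM2r ?invr_ge0 ?(ltW S0)//.
  by apply: le_trans (NB _ _) _; rewrite Nx; lra.
rewrite big_seq [leRHS]big_seq; apply: ler_sum => p pb; apply: (term_bound xy pb).
- by apply/eqP => e; move/negP: xb; apply; rewrite /x e.
- by apply/eqP => e; move/negP: yb; apply; rewrite e.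
- by apply/eqP => e; move/negP: y'b; apply; rewrite e.
Qed.
End Est.
End AW.

(** * The proximity function of the difference quotient *)

Section Prox.
Context {R : realType}.
Notation mu := (@lebesgue_measure R).
Implicit Types (x y p w : R[i]^o).
Variables (qh : R[i]^o) (zeta : R[i]^o -> R[i]^o).
Hypothesis hzeta : joukowski_branch zeta.
Hypothesis qh0 : qh != 0.
Notation hat := (aw_hat qh zeta).
Notation chk := (aw_check qh zeta).
Notation K := (awK qh).
Notation I2 := (`[0%R, (2 * pi)%R]%classic : set R).

Lemma integral_weighted_sum (I : Type) (s : seq I) (w : I -> R) (F : I -> R -> \bar R) (M : R) :
  (forall i, 0 <= w i) -> (forall i t, (0 <= F i t)%E) -> (forall i, measurable_fun I2 (F i)) ->
  (forall i, (\int[mu]_(t in I2) F i t <= M%:E)%E) ->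
  (\int[mu]_(t in I2) (\sum_(i <- s) (w i)%:E * F i t) <= (\sum_(i <- s) w i * M)%:E)%E.
Proof.
move=> w0 F0 mF FM; rewrite ge0_integral_sum//; last 2 first.
- by move=> i; apply: emeasurable_funM; [exact: measurable_cst|exact: mF].
- by move=> i t _; apply: mule_ge0; rewrite ?lee_fin.
rewrite -sumEFin; apply: lee_sum => i _.
rewrite (@ge0_integralZl_EFin _ _ _ mu I2 (measurable_itv _) (F i))//; last exact: mF.
have wi : (0 <= (w i)%:E)%E by rewrite lee_fin.
exact: (lee_wpmul2l wi (FM i)).
Qed.

Lemma integral_cst2pi (a : R) : (\int[mu]_(t in I2) a%:E = (2 * pi * a)%:E)%E.
Proof.
rewrite (@integral_cst _ _ _ mu I2 (measurable_itv _) a%:E).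
have e : mu I2 = (2 * pi)%:E by rewrite lebesgue_measure_itv /= lte_fin twopi_gt0 oppr0 adde0.
transitivity (a%:E * (2 * pi)%:E)%E; last by rewrite -EFinM mulrC.
exact: (congr1 (mule a%:E) e).
Qed.

Lemma Rintegral_le_bound (g : R -> R) (Phi : R -> \bar R) (M : R) : (forall t, 0 <= g t) ->
  (forall t, ((g t)%:E <= Phi t)%E) -> (\int[mu]_(t in I2) Phi t <= M%:E)%E ->
  \int[mu]_(t in I2) g t <= M.
Proof.
move=> g0 gP PM; rewrite /Rintegral.
have l : (\int[mu]_(t in I2) (g t)%:E <= M%:E)%E.
  by apply: le_trans PM; apply: le_integral_nomeas => t _; rewrite ?lee_fin.
have l0 : (0 <= \int[mu]_(t in I2) (g t)%:E)%E by apply: integral_ge0 => t _; rewrite lee_fin.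
by case: (integral _ _ _) l l0 => [v| |]//=; rewrite lee_fin.
Qed.

Section Bound.
Variables (f : R[i]^o -> R[i]^o) (k : R[i]^o -> int) (g0 : R[i]^o -> R[i]^o).
Hypothesis ok : forall p, ord_at f p (k p).
Hypothesis hg0 : hol_near g0 0.
Hypothesis g00 : g0 0 != 0.
Hypothesis fg0 : nbhs ((0 : R[i]^o)^') (fun z => f z = g0 z * (z - 0) ^ (k 0)).
Variables (S r : R) (bs : seq R[i]^o).
Hypothesis r1 : 1 < r.
Hypothesis rS : K * r <= S / 2.
Hypothesis cov : covers f S bs.
Hypothesis dge : forall x, N x = r -> 1 <= N (hat x - chk x).

Let c3 : R := ln ((1 + K) * (2 * K + 1)) + 2.
Let A : R := (2 * pi)^-1 * rint 0 (2 * pi) (fun t => `|ln (N (f (circ 0 S t)))|).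
Let c : R := ln 2 + 8 * K * r / S * A.
(* A positive extra weight on every point of [bs], so that [Phi] is infinite on
   the finitely many arguments where the pointwise estimate breaks down. *)
Let om : R := (size bs)%:R^-1.
Let LK p t : \bar R := log_kernel (p / (r%:C : R[i]^o)) t.
Let Psi p t : \bar R := (c3%:E + (LK p t + (LK (hat p) t + LK (chk p) t)))%E.
Let Phi t : \bar R := (c%:E + \sum_(p <- bs) (kabs k p + om)%:E * Psi p t)%E.
Let g t : R := log_plus (N (askey_wilson qh zeta f (circ 0 r t) / f (circ 0 r t))).

Lemma aw_c3_ge0 : 0 <= c3.
Proof.
have K1 := awK_ge1 qh; rewrite /c3 addr_ge0// ln_ge0//; nra.
Qed.

Lemma rn0 : (r%:C : R[i]^o) != 0.
Proof. apply: realC_neq0; rewrite gt_eqF//; exact: lt_trans r1. Qed.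

Lemma sing_le p t : ((sing r p t)%:E <= LK p t)%E.
Proof.
rewrite /LK; have [e|ne] := eqVneq (cis t) (p / (r%:C : R[i]^o)).
  by rewrite (log_kernel_pole e) leey.
exact: log_kernel_bound.
Qed.

Lemma LK_ge0 p t : (0 <= LK p t)%E. Proof. exact: log_kernel_ge0. Qed.

Lemma LK_pole p t : circ 0 r t = p -> LK p t = +oo%E.
Proof.
move=> e; apply: log_kernel_pole; rewrite -e /cis /circ !add0r mul1r mulrAC divff ?mul1r//; exact: rn0.
Qed.

Lemma Psi_ge0 p t : (0 <= Psi p t)%E.
Proof. by rewrite /Psi !adde_ge0 ?lee_fin ?aw_c3_ge0 ?LK_ge0. Qed.

Lemma kabs_ge0 p : 0 <= kabs k p. Proof. by rewrite /kabs addr_ge0. Qed.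
Lemma om_gt0 : 0 < om.
Proof. by rewrite /om invr_gt0 ltr0n; case: cov => _; case: bs. Qed.

Lemma Phi_pole p t : p \in bs -> circ 0 r t = p \/ circ 0 r t = hat p \/ circ 0 r t = chk p -> Phi t = +oo%E.
Proof.
move=> pb H.
have w0 q : 0 < kabs k q + om by rewrite ltr_wpDl ?kabs_ge0 ?om_gt0.
have t0 q : (0 <= (kabs k q + om)%:E * Psi q t)%E by rewrite mule_ge0 ?Psi_ge0// lee_fin ltW.
have PP : Psi p t = +oo%E.
  rewrite /Psi; have a1 := LK_ge0 p t; have a2 := LK_ge0 (hat p) t; have a3 := LK_ge0 (chk p) t.
  have nn (u : \bar R) : (0 <= u)%E -> u != -oo%E by case: u.
  case: H => [/LK_pole ->|[/LK_pole ->|/LK_pole ->]].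
  - by rewrite addye ?addey// nn// adde_ge0.
  - by rewrite addye ?nn// addey ?nn// addey.
  - by rewrite addey ?nn// addey ?nn// addey.
have E : (\sum_(p <- bs) (kabs k p + om)%:E * Psi p t)%E = +oo%E.
  apply/esum_eqyP => [q _|]; first by move: (t0 q); case: (_ * _)%E.
  by exists p; split=> //; rewrite PP gt0_muley ?lte_fin.
by rewrite /Phi E addey.
Qed.

(** If [x], [hat x] or [chk x] belongs to [bs], then by the product identity [x] is one of [p],
    [hat p], [chk p] with [p] in [bs], and [Phi] is infinite. Otherwise both shifted values are
    bounded by [expR E * |f x|] and the denominator is at least 1; the two values account for
    [ln 2]. *)
Lemma log_plus_ratio_le t : ((g t)%:E <= Phi t)%E.
Proof.
set x : R[i]^o := circ 0 r t.
have r0 : 0 < r by exact: lt_trans r1.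
have Nx : N x = r by rewrite -[x]subr0 N_circ// ltW.
have hc y : (hat x == y) || (chk x == y) -> y \in bs -> Phi t = +oo%E.
  move=> xy yb; apply: (Phi_pole yb); right.
  have /eqP : (x - hat y) * (x - chk y) = 0.
    rewrite -aw_identity//; case/orP: xy => /eqP ->; by rewrite subrr ?mul0r ?mulr0.
  by rewrite mulf_eq0 !subr_eq0 => /orP[/eqP|/eqP]; [left|right].
have [xb|xb] := boolP (x \in bs); first by rewrite (Phi_pole xb) ?leey//; left.
have [hb|hb] := boolP (hat x \in bs); first by rewrite (hc _ _ hb) ?leey ?eqxx.
have [cb|cb] := boolP (chk x \in bs); first by rewrite (hc _ _ cb) ?leey ?eqxx ?orbT.
have B1 := ratio_bound hzeta qh0 ok hg0 g00 fg0 r1 rS cov (t := t) (y := hat x) (y' := chk x)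
  (or_introl (conj erefl erefl)) xb hb cb.
have B2 := ratio_bound hzeta qh0 ok hg0 g00 fg0 r1 rS cov (t := t) (y := chk x) (y' := hat x)
  (or_intror (conj erefl erefl)) xb cb hb.
move: B1 B2; cbv zeta; rewrite -/A -/c3 -/x; set E := (X in expR X) => B1 B2.
have S0 : 0 < S by have K1 := awK_ge1 qh; move: rS r0 K1; nra.
have A0 : 0 <= A.
  rewrite /A mulr_ge0 ?invr_ge0 ?twopi_ge0//; apply: Rintegral_ge0 => u _ //.
have sM p : 0 <= singM qh zeta r p t by rewrite /singM /sing !addr_ge0 ?log_plus_ge0.
have E0 : 0 <= E.
  rewrite /E addr_ge0//.
    rewrite mulr_ge0// divr_ge0 ?(ltW S0)//; have K1 := awK_ge1 qh; move: r0 K1; nra.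
  by apply: sumr_ge0 => p _; rewrite mulr_ge0 ?kabs_ge0// addr_ge0 ?aw_c3_ge0.
have gE : g t <= ln 2 + E.
  rewrite /g /log_plus -/x ge_max addr_ge0 ?ln_ge0 ?ler1n//=.
  have x1 : (x == 1) || (x == -1) = false.
    apply/negbTE; rewrite negb_or; apply/andP; split; apply: contraTneq r1 => e.
      by rewrite -Nx e Normc.normc1 ltxx.
    by rewrite -Nx e NN Normc.normc1 ltxx.
  rewrite /askey_wilson x1; set v := N _.
  have fx0 : 0 < N (f x).
    have K1 := awK_ge1 qh; have h : N x <= S by rewrite Nx; move: rS r0 K1 S0; nra.
    by rewrite N_gt0; have [[_ h'] _] := covers_k ok cov h xb.
  have v2 : v <= 2 * expR E.
    rewrite /v /aw_quotient !Normc.normcM !Normc.normcV -mulrA -invfM.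
    have d1 := dge Nx.
    rewrite ler_pdivrMr; last by rewrite mulr_gt0// (lt_le_trans ltr01).
    apply: le_trans (NB _ _) _.
    apply: (@le_trans _ _ (2 * expR E * N (f x))); first by move: B1 B2; lra.
    by rewrite ler_wpM2l ?mulr_ge0 ?expR_ge0// ler_peMl ?N_ge0.
  have [v0|v0] := leP v 0.
    by rewrite ln0// addr_ge0 ?ln_ge0 ?ler1n.
  apply: (@le_trans _ _ (ln (2 * expR E))).
    by rewrite ler_ln ?posrE ?mulr_gt0 ?expR_gt0.
  by rewrite lnM ?posrE ?expR_gt0// expRK.
apply: (@le_trans _ _ (ln 2 + E)%:E); first by rewrite lee_fin.
rewrite /E addrA EFinD /Phi; apply: leeD; first by rewrite lee_fin.
rewrite -sumEFin; apply: lee_sum => p _; rewrite EFinM; apply: lee_pmul.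
- by rewrite lee_fin kabs_ge0.
- by rewrite lee_fin addr_ge0 ?aw_c3_ge0.
- by rewrite lee_fin lerDl ltW// om_gt0.
- by rewrite /Psi /singM !EFinD !leeD// sing_le.
Qed.

Lemma Psi_meas p : measurable_fun I2 (Psi p).
Proof.
apply: emeasurable_funD; first exact: measurable_cst.
apply: emeasurable_funD; first exact: log_kernel_meas.
apply: emeasurable_funD; exact: log_kernel_meas.
Qed.

(** Three logarithmic poles, each of integral at most 96. *)
Lemma Psi_int p : (\int[mu]_(t in I2) Psi p t <= (2 * pi * c3 + 288)%:E)%E.
Proof.
have m w := @log_kernel_meas R w; have l q t (_ : I2 t) := LK_ge0 q t.
have C0 := aw_c3_ge0.
have md := measurable_itv.
have mD q q' : measurable_fun I2 (fun t => LK q t + LK q' t)%E by apply: emeasurable_funD; exact: m.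
have mD3 : measurable_fun I2 (fun t => LK p t + (LK (hat p) t + LK (chk p) t))%E.
  by apply: emeasurable_funD; [exact: m|exact: mD].
rewrite /Psi ge0_integralD//; last by move=> t _; rewrite !adde_ge0 ?LK_ge0.
rewrite integral_cst2pi EFinD leeD2l//.
have mL q : measurable_fun I2 (LK q) by exact: m.
rewrite (@ge0_integralD _ _ _ mu I2 (measurable_itv _) (LK p) (fun t => LK (hat p) t + LK (chk p) t)%E)//;
  try (by move=> t _; rewrite ?adde_ge0 ?LK_ge0); try exact: mL; try exact: mD.
rewrite (@ge0_integralD _ _ _ mu I2 (measurable_itv _) (LK (hat p)) (LK (chk p)))//;
  try (by move=> t _; rewrite LK_ge0); try exact: mL.
have -> : 288%:E = (96%:E + (96%:E + 96%:E))%E :> \bar R by rewrite -!EFinD; congr EFin; lra.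
by apply: leeD; [|apply: leeD]; exact: log_kernel_int.
Qed.

(** The [+ 1] is the total of the extra weights [om]. Division by [2 * pi >= 1] allows 288 to stay
    as it is. *)
Lemma aw_proximity_bound :
  proximity r (fun x => askey_wilson qh zeta f x / f x) <=
  ln 2 + 8 * K * r / S * A + (\sum_(p <- bs) kabs k p + 1) * (c3 + 288).
Proof.
have tp := @twopi_gt0 R.
have tp1 : 1 <= 2 * pi :> R by have := pi_ge2 R; lra.
have wE : \sum_(p <- bs) (kabs k p + om) = \sum_(p <- bs) kabs k p + 1.
  rewrite big_split /= big_const_seq count_predT iter_addr_0 /om -[_ *+ _]mulr_natr mulVf//.
  by rewrite pnatr_eq0 -lt0n; case: cov => _; case: bs.
have K0 : 0 <= \sum_(p <- bs) kabs k p by apply: sumr_ge0 => p _; exact: kabs_ge0.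
have PhiI : (\int[mu]_(t in I2) Phi t <= (2 * pi * c + (\sum_(p <- bs) kabs k p + 1) * (2 * pi * c3 + 288))%:E)%E.
  have w0 p : 0 <= kabs k p + om by rewrite addr_ge0 ?kabs_ge0// ltW// om_gt0.
  have S0 : 0 < S by have K1 := awK_ge1 qh; move: rS r1 K1; nra.
  have A0 : 0 <= A.
    rewrite /A mulr_ge0 ?invr_ge0 ?twopi_ge0//; apply: Rintegral_ge0 => u _ //.
  have c0 : 0 <= c.
    rewrite /c addr_ge0 ?ln_ge0 ?ler1n//.
    rewrite mulr_ge0// divr_ge0 ?(ltW S0)//; have K1 := awK_ge1 qh; move: r1 K1; nra.
  rewrite /Phi ge0_integralD//.
  - rewrite integral_cst2pi EFinD leeD2l//.
    rewrite -wE mulr_suml; apply: integral_weighted_sum => //; [exact: Psi_ge0|exact: Psi_meas|exact: Psi_int].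
  - by move=> t _; rewrite sume_ge0// => p _; rewrite mule_ge0 ?Psi_ge0// lee_fin.
  - apply: emeasurable_sum => p; apply: emeasurable_funM; first exact: measurable_cst.
    exact: Psi_meas.
have g0' t : 0 <= g t by rewrite /g /log_plus le_max lexx.
have := Rintegral_le_bound g0' log_plus_ratio_le PhiI.
rewrite /proximity (@eq_Rintegral _ _ _ mu _ g); last first.
  move=> t _; rewrite /g; congr (log_plus (N _)).
  have -> : ((r * cos t)%R +i* (r * sin t)%R)%C = circ 0 r t :> R[i]^o.
    by rewrite /circ add0r; apply/eqP; rewrite eq_complex /= !mul0r subr0 addr0 !eqxx.
  by [].
rewrite ler_pdivrMl// => H; apply: le_trans H _.
rewrite -/c; move: tp1 K0 aw_c3_ge0; nra.
Qed.
End Bound.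
End Prox.

(** * The key estimate *)

Section Data.
Context {R : realType}.
Implicit Types (x y p w z : R[i]^o) (f g : R[i]^o -> R[i]^o).

Lemma avoid_seq (s : seq R) (a b : R) : a < b -> exists2 u, a <= u <= b & u \notin s.
Proof.
elim: s a b => [|x s IH] a b ab; first by exists a; rewrite ?in_nil// lexx ltW.
have [xm|mx] := leP x ((a + b) / 2).
  have [|u /andP[u1 u2] us] := IH ((a + 3 * b) / 4) b; first lra.
  by exists u; [lra|rewrite inE negb_or us andbT; apply/eqP; lra].
have [|u /andP[u1 u2] us] := IH a ((a + b) / 2); first lra.
by exists u; [lra|rewrite inE negb_or us andbT; apply/eqP; lra].
Qed.

(** Two functions at a time, because the lower bound for the characteristic compares [f] with
    [f - a] on the same circle. *)
Lemma generic_between f g k k' (a b : R) : (forall p, ord_at f p (k p)) -> (forall p, ord_at g p (k' p)) ->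
  0 < a -> a < b -> exists S, [/\ a <= S, S <= b, generic f S & generic g S].
Proof.
move=> ok ok' a0 ab.
have bad h m : (forall p, ord_at h p (m p)) -> exists bs : seq R[i]^o, forall p, N p <= b -> ~ good h p -> p \in bs.
  move=> om; have [|bs [_ H]] := @disc_finite R (fun p => ~ good h p) b; last by exists bs.
  by move=> p; apply: dnbhs_sub (ord_at_good_near (om p)) => z _ hz /(_ hz).
have [bs Hf] := bad f k ok; have [bs' Hg] := bad g k' ok'.
have [u /andP[au ub] us] := avoid_seq ([seq N p | p <- bs] ++ [seq N p | p <- bs']) ab.
move: us; rewrite mem_cat negb_or => /andP[u1 u2].
exists u; split=> //; split; try exact: lt_le_trans au.
  move=> p pu; apply: contrapT => /(Hf p) h; move/negP: u1; apply; rewrite -pu map_f//; apply: h; by rewrite pu.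
move=> p pu; apply: contrapT => /(Hg p) h; move/negP: u2; apply; rewrite -pu map_f//; apply: h; by rewrite pu.
Qed.

Lemma mero_data f : meromorphic f -> (forall p, ~ nbhs (p^') (fun z => f z = 0)) ->
  exists k, (forall p, ord_at f p (k p)) /\ exists g0, [/\ hol_near g0 0, g0 0 != 0 &
    nbhs ((0 : R[i]^o)^') (fun z => f z = g0 z * (z - 0) ^ (k 0))].
Proof.
move=> mf nz; have H p : exists k, ord_at f p k by case: (mero_order p mf) => // /nz.
by have [k kP] := choice H; exists k; split=> //; have [g h] := kP 0; exists g.
Qed.

Lemma pole_order_le_subcst f p n (a : R[i]^o) : pole_order_le f p n -> pole_order_le (fun z => f z - a) p n.
Proof.
move=> [g [/hol_nearP hg fg]]; exists (fun z => g z - a * (z - p) ^+ n); split.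
  apply/hol_nearP; apply: hol_nearB => //; apply: hol_nearM; first exact: hol_near_cst.
  exact: hol_nearX (hol_near_sub _ _).
apply: dnbhs_sub fg => z zp ->; rewrite mulrBl mulfK// expf_neq0// subr_eq0//.
Qed.

Lemma pole_order_subcst f p (a : R[i]^o) : pole_order (fun z => f z - a) p = pole_order f p.
Proof.
have E n : pole_order_le (fun z => f z - a) p n = pole_order_le f p n.
  apply/propext; split; last exact: pole_order_le_subcst.
  move=> /(@pole_order_le_subcst _ _ _ (- a)); congr (pole_order_le _ _ _).
  by apply/funext => z; rewrite opprK subrK.
rewrite /pole_order; congr (xget _ _); apply/seteqP; split => n [h1 h2].
  by split; [rewrite -E|move=> j; rewrite -E; exact: h2].
by split; [rewrite E|move=> j; rewrite E; exact: h2].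
Qed.

Lemma pole_counting_subcst f (a : R[i]^o) S : pole_counting (fun z => f z - a) S = pole_counting f S.
Proof.
have E : pole_count (fun z => f z - a) = pole_count f.
  apply/funext => t; apply: eq_fsbigr => p _; by rewrite pole_order_subcst.
by rewrite /pole_counting E.
Qed.

Lemma meromorphic_subcst f (a : R[i]^o) : meromorphic f -> meromorphic (fun z => f z - a).
Proof. by move=> mf p; have [n h] := mf p; exists n; exact: pole_order_le_subcst. Qed.

Lemma ord_at_zero_gt0 f p k : hol_near f p -> f p = 0 -> ord_at f p k -> (0 < k)%R.
Proof.
move=> hf fp ok; case: (hol_order hf) => [h|[n on]].
  have [z zp [fz]] := dnbhs_ex (dnbhs_and (nbhs_dnbhsN h) (ord_at_neq0 ok)).
  by rewrite fz eqxx.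
rewrite (ord_at_uniq ok on); case: n on => // -[u [hu u0 fu]].
have : f p = u p.
  apply: cont_near_eq; [exact: hol_near_cont|exact: hol_near_cont|].
  by apply: dnbhs_sub fu => z _ ->; rewrite expr0z mulr1.
by rewrite fp => e; move: u0; rewrite -e eqxx.
Qed.

Lemma log_plus_subcst (u a : R[i]^o) : u - a != 0 -> 
  log_plus (N (u - a)) <= log_plus (N u) + (log_plus (N a) + ln 2).
Proof.
move=> ua; have l2 : 0 <= ln 2 :> R by rewrite ln_ge0 ?ler1n.
have p0 := @log_plus_ge0 R; have pl := @log_plus_ge R.
rewrite {1}/log_plus ge_max; apply/andP; split; first by rewrite !addr_ge0.
have n0 : 0 < N (u - a) by rewrite N_gt0.
have tri := NB u a.
have key (b c : R) : N u <= b -> N a <= b -> 0 < b -> ln b = c -> ln (N (u - a)) <= c + ln 2.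
  move=> h1 h2 b0 <-; rewrite -lnM ?posrE//; rewrite ler_ln ?posrE ?mulr_gt0//; lra.
have [h|h] := leP (N u) (N a).
  have a0 : 0 < N a by move: n0 tri h; lra.
  apply: le_trans (key _ _ h (lexx _) a0 erefl) _; have := pl (N a); have := p0 (N u); lra.
have u0 : 0 < N u by apply: le_lt_trans h; exact: N_ge0.
apply: le_trans (key _ _ (lexx _) (ltW h) u0 erefl) _; have := pl (N u); have := p0 (N a); lra.
Qed.
End Data.

(** * Logarithmic lower bound for the characteristic *)

Section Lower.
Context {R : realType}.
Implicit Types (p w z : R[i]^o) (f : R[i]^o -> R[i]^o).
Variables (f : R[i]^o -> R[i]^o) (k k' : R[i]^o -> int) (a p : R[i]^o).
Let fa z : R[i]^o := f z - a.
Hypothesis ok : forall p, ord_at f p (k p).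
Hypothesis ok' : forall p, ord_at fa p (k' p).
Hypothesis gp : hol_near f p.
Hypothesis fp : f p = a.

(** Subtracting a constant keeps the poles, so only the proximity terms have to be compared. *)
Lemma characteristic_subcst S : generic f S -> generic fa S ->
  characteristic S fa <= characteristic S f + (log_plus (N a) + ln 2).
Proof.
move=> gS gS'; have [bs cov] := generic_covers ok gS; have [bs' cov'] := generic_covers ok' gS'.
have S0 : 0 < S by case: gS.
have [g0 [hg0 g00 fg0]] := ok 0; have [g1 [hg1 g10 fg1]] := ok' 0.
rewrite /characteristic pole_counting_subcst addrAC lerD2r !proximityE.
have cm h m g (hok : forall p, ord_at h p (m p)) (hg : hol_near g 0) (gn : g 0 != 0)
    (hh : nbhs ((0 : R[i]^o)^') (fun z => h z = g z * (z - 0) ^ (m 0))) b (cv : covers h S b) :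
    contab (fun t => Num.max 0 (ln (N (h (circ 0 S t))))) 0 (2 * pi).
  have c1 := lnf_contab hok hg gn hh S0 cv.
  by move=> t ht; apply: (@continuous_max _ _ (fun=> 0) _ t); [exact: cst_continuous|exact: c1].
have c1 := cm _ _ _ ok hg0 g00 fg0 _ cov; have c2 := cm _ _ _ ok' hg1 g10 fg1 _ cov'.
set c := log_plus (N a) + ln 2.
have tp := @twopi_gt0 R.
have -> : c = (2 * pi)^-1 * (2 * pi * c) by rewrite mulKf// gt_eqF.
rewrite -mulrDr ler_pM2l ?invr_gt0//.
rewrite -[2 * pi * c](_ : rint 0 (2 * pi) (fun=> c) = _); last by rewrite rintC ?twopi_ge0// subr0 mulrC.
rewrite -rintD//; last exact: contabC.
apply: rint_le; [exact: c2|exact: contabD c1 (@contabC _ c 0 (2 * pi))|].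
move=> t _; apply: log_plus_subcst.
have [_ H] := gS'; have [|_ h] := H (circ 0 S t); last exact: h.
by rewrite -[circ _ _ _]subr0 N_circ// ltW.
Qed.

(** [f - a] has a zero at [p], so its zero sum is at least [lam p S], which is [ln S] up to a
    constant. Jensen's formula bounds that sum by the characteristic of [f - a], which exceeds that
    of [f] by at most a constant. *)
Lemma characteristic_lower : exists C, forall S, N p + 1 <= S -> generic f S -> generic fa S ->
  ln S - C <= characteristic S f.
Proof.
have [g1 [hg1 g10 fg1]] := ok' 0.
(* At the origin [lam p S] is [ln S] itself, without correction. *)
pose L := if p == 0 then 0 else ln (N p).
exists (L - clead g1 + (log_plus (N a) + ln 2)) => S pS gS gS'.
have p0 := N_ge0 p.
have S0 : 0 < S by case: gS.
have S1 : 1 <= S by lra.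
have [bs cov] := generic_covers ok' gS'.
have [_ _ H] := nevanlinna_bounds ok' hg1 g10 fg1 S0 cov S1.
have T := characteristic_subcst gS gS'.
have hfa : hol_near fa p by apply: hol_nearB => //; exact: hol_near_cst.
have fap : fa p = 0 by rewrite /fa fp subrr.
have kp := ord_at_zero_gt0 hfa fap (ok' p).
have pb : p \in bs.
  have [_ _ _ h] := cov; apply: h; first by lra.
  by move=> [_]; rewrite fap eqxx.
have l0 q : q \in bs -> 0 <= lam q S by exact: (lam_ge0 cov).
have : lam p S <= \sum_(q <- bs) (posp (k' q))%:R * lam q S.
  rewrite (big_rem _ pb) /=; apply: (@le_trans _ _ ((posp (k' p))%:R * lam p S)).
    by rewrite ler_peMl ?l0// ler1n; case: (k' p) kp.
  rewrite lerDl big_seq sumr_ge0// => q /mem_rem qb; by rewrite mulr_ge0// l0.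
have -> : lam p S = ln S - L.
  rewrite /lam /L; case: eqP => [_|/eqP pn]; first by rewrite subr0.
  by rewrite ln_div ?posrE// N_gt0.
lra.
Qed.
End Lower.

(** * Exclusion of constant functions *)

Section Nonconst.
Context {R : realType}.
Implicit Types (x p w z : R[i]^o).
Variables (qh : R[i]^o) (zeta : R[i]^o -> R[i]^o).
Hypothesis hzeta : joukowski_branch zeta.
Hypothesis qh0 : qh != 0.
Notation hat := (aw_hat qh zeta).
Notation chk := (aw_check qh zeta).

(** Unlike [N_hat] this covers small [x] too, since exceptional points may be anywhere in the
    plane. *)
Lemma N_hat_le x : N (hat x) <= (N qh + (N qh)^-1) * (2 * N x + 1) /\
  N (chk x) <= (N qh + (N qh)^-1) * (2 * N x + 1).
Proof.
have [z0 zE] := zetaP hzeta x; have h := hzeta x; have x0 := N_ge0 x.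
have b : N (zeta x - x) <= N x + 1.
  have : N (zeta x - x) ^+ 2 <= (N x + 1) ^+ 2.
    rewrite -NX h; apply: le_trans (NB _ _) _; rewrite NX Normc.normc1; nra.
  by rewrite ler_pXn2r// nnegrE ?N_ge0// addr_ge0 ?N_ge0.
have b1 : N (zeta x) <= 2 * N x + 1.
  have -> : zeta x = (zeta x - x) + x by ring.
  by apply: le_trans (ND _ _) _; lra.
have b2 : N (zeta x)^-1 <= 2 * N x + 1.
  have -> : (zeta x)^-1 = x - (zeta x - x) by move: zE; move: (zeta x)^-1 => u e; rewrite -[u](addKr (zeta x)) e; ring.
  by apply: le_trans (NB _ _) _; lra.
have a0 : 0 < N qh by rewrite N_gt0.
have c0 : 0 < (N qh)^-1 by rewrite invr_gt0.
have e (u : R[i]^o) : N u <= 2 * N x + 1 ->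
    N (qh * u) <= N qh * (2 * N x + 1) /\ N (qh^-1 * u) <= (N qh)^-1 * (2 * N x + 1).
  by move=> hu; rewrite !(Normc.normcM _ u) Normc.normcV !ler_wpM2l// ltW.
have [e1 e2] := e _ b1; have [e3 e4] := e _ b2.
rewrite /aw_hat /aw_check; split.
  apply: le_trans (N_half 0 e1 e4) _; nra.
apply: le_trans (N_half 0 e2 e3) _; nra.
Qed.

Lemma dnbhs_neq p (s : seq R[i]^o) : nbhs (p^') (fun z => z \notin s).
Proof.
elim: s => [|y s IH]; first by apply/dnbhsN; exists 1 => // w _ _; rewrite in_nil.
have h : nbhs (p^') (fun z => z != y).
  have [<-|py] := eqVneq p y; first by apply/dnbhsN; exists 1.
  apply/dnbhsN; exists (N (p - y)); first by rewrite N_gt0 subr_eq0.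
  by move=> w _; apply: contraTneq => ->; rewrite -leNgt NBC.
by apply: dnbhs_sub (dnbhs_and IH h) => z _ [z1 z2]; rewrite inE negb_or z2.
Qed.

(** The quotient can be nonzero only where a shifted point meets one of the finitely many nearby
    exceptional points [e] of [f], or at [1] and [-1]. The product identity confines such [x] to
    [hat e] and [chk e], with no continuity of [zeta] involved. *)
Lemma aw_const_eq0 f (c : R[i]^o) : (forall p, nbhs (p^') (fun z => f z = c)) ->
  meromorphic_eq0 (askey_wilson qh zeta f).
Proof.
move=> fc p.
pose B := (N qh + (N qh)^-1) * (2 * (N p + 1) + 1).
have [|es [_ esP]] := @disc_finite R (fun z => f z <> c) B.
  by move=> w; apply: dnbhs_sub (fc w) => z _ -> /(_ erefl).
pose s := [:: 1; -1 : R[i]^o] ++ [seq hat e | e <- es] ++ [seq chk e | e <- es].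
have near1 : nbhs (p^') (fun z => N (z - p) < 1) by apply/dnbhsN; exists 1.
apply: dnbhs_sub (dnbhs_and (dnbhs_neq p s) near1) => x xp [xs x1].
have Nx : N x <= N p + 1.
  have -> : x = (x - p) + p by rewrite subrK.
  by apply: le_trans (ND _ _) _; lra.
have q0 : 0 <= N qh + (N qh)^-1 by rewrite addr_ge0 ?invr_ge0 ?N_ge0.
have [h1 h2] := N_hat_le x.
have BB : (N qh + (N qh)^-1) * (2 * N x + 1) <= B by rewrite ler_wpM2l//; lra.
have ne (y : R[i]^o) : N y <= B -> (hat x == y) || (chk x == y) -> f y = c.
  move=> yB xy; apply: contrapT => /(esP _ yB) ye.
  have /eqP : (x - hat y) * (x - chk y) = 0.
    by rewrite -aw_identity//; case/orP: xy => /eqP ->; rewrite subrr ?mul0r ?mulr0.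
  rewrite mulf_eq0 !subr_eq0 => H; move/negP: xs; apply; rewrite /s !mem_cat.
  by case/orP: H => /eqP ->; rewrite map_f ?orbT.
rewrite /askey_wilson.
have -> : (x == 1) || (x == -1) = false.
  by move: xs; rewrite /s mem_cat negb_or !inE => /andP[/negbTE -> _].
rewrite /aw_quotient (ne (hat x)) ?eqxx//; last exact: le_trans h1 BB.
rewrite (ne (chk x)) ?eqxx ?orbT//; last exact: le_trans h2 BB.
by rewrite subrr mul0r.
Qed.

Lemma mero_const f (c : R[i]^o) p : meromorphic f -> nbhs (p^') (fun z => f z = c) ->
  forall w, nbhs (w^') (fun z => f z = c).
Proof.
move=> mf H w; have := @mero_identity _ _ p (meromorphic_subcst c mf) _ w.
have h : nbhs (p^') (fun z => f z - c = 0) by apply: dnbhs_sub H => z _ ->; rewrite subrr.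
by move=> /(_ h); apply: dnbhs_sub => z _ /eqP; rewrite subr_eq0 => /eqP.
Qed.
End Nonconst.

Section Key.
Context {R : realType}.
Implicit Types (x p w z : R[i]^o).
Variables (qh : R[i]^o) (zeta : R[i]^o -> R[i]^o).
Hypothesis hzeta : joukowski_branch zeta.
Hypothesis qh0 : qh != 0.
Hypothesis qh1 : N qh != 1.
Variables (f : R[i]^o -> R[i]^o) (k : R[i]^o -> int).
Hypothesis ok : forall p, ord_at f p (k p).

(** Every [p] with [|p| < S] has weight [lam p T >= ln (T / S)]; at [p = 0] this is where [1 <= S]
    enters. Points listed in [bsS] but not in [bsT] have order 0. *)
Lemma kabs_sum_le g0 S T bsS bsT : hol_near g0 0 -> g0 0 != 0 ->
  nbhs ((0 : R[i]^o)^') (fun z => f z = g0 z * (z - 0) ^ (k 0)) ->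
  1 <= S -> S < T -> covers f S bsS -> covers f T bsT ->
  (\sum_(p <- bsS) kabs k p) * ln (T / S) <= 2 * characteristic T f + `|clead g0|.
Proof.
move=> hg0 g00 fg0 S1 ST cS cT.
have T1 : 1 <= T by apply: le_trans S1 (ltW ST).
have S0 : 0 < S by apply: lt_le_trans S1.
have T0 : 0 < T by apply: lt_trans ST.
have [H _ _] := nevanlinna_bounds ok hg0 g00 fg0 T0 cT T1.
apply: le_trans H.
have l0 q : q \in bsT -> 0 <= lam q T by exact: (lam_ge0 cT).
have kk q : 0 <= kabs k q :> R by exact: kabs_ge0.
have [uS _ bS _] := cS; have [uT _ bT _] := cT.
rewrite mulr_suml.
apply: (@le_trans _ _ (\sum_(p <- bsS | p \in bsT) kabs k p * lam p T)).
  rewrite [leRHS]big_mkcond big_seq [leRHS]big_seq; apply: ler_sum => p pS; have pN := bS p pS.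
  case: ifPn => pT.
    rewrite ler_wpM2l// /lam; case: eqP => [_|/eqP p0].
      rewrite ler_ln ?posrE ?divr_gt0// ler_pdivrMr// ler_peMr// ltW//.
    have np : 0 < N p by rewrite N_gt0.
    by rewrite ler_ln ?posrE ?divr_gt0// ler_pM2l// lef_pV2// ltW.
  have [_ k0] := covers_k ok cT (ltW (lt_trans pN ST)) pT.
  by rewrite /kabs k0 /= addr0 mul0r.
rewrite -big_filter (perm_big [seq p <- bsT | p \in bsS]) /=; last first.
  by apply: uniq_perm; rewrite ?filter_uniq// => p; rewrite !mem_filter andbC.
rewrite big_filter big_mkcond big_seq [leRHS]big_seq; apply: ler_sum => p pT.
by case: ifP => // _; rewrite mulr_ge0// l0.
Qed.

Lemma aw_proximity_estimate : exists C r1, [/\ 0 <= C, 1 < r1 &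
  forall r S T, r1 <= r -> 2 * awK qh * r <= S -> S < T -> generic f S -> generic f T ->
  proximity r (fun x => askey_wilson qh zeta f x / f x) <=
  C * (r / S * (characteristic S f + 1) + (characteristic T f + 1) / ln (T / S) + 1)].
Proof.
have [g0 [hg0 g00 fg0]] := ok 0.
have [r1 [r11 dge]] := aw_diff_ge1 hzeta qh0 qh1.
have K1 := awK_ge1 qh.
set c3 : R := ln ((1 + awK qh) * (2 * awK qh + 1)) + 2 + 288.
have c30 : 0 <= c3 by have := @aw_c3_ge0 R qh; rewrite /c3; lra.
set c := `|clead g0|; have c0 : 0 <= c by exact: normr_ge0.
have l2 : 0 <= ln 2 :> R by rewrite ln_ge0 ?ler1n.
(* The summands cover in turn the constant, the regular part (its mean is at most
   [(2 + c) (T(S) + 1)]), and the zeros and poles together with the extra weight 1. *)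
set C := ln 2 + 8 * awK qh * (2 + c) + c3 * (3 + c).
exists C, r1; split=> //.
  by rewrite /C !addr_ge0// mulr_ge0//; lra.
move=> r S T rr1 rS ST gS gT.
have r_1 : 1 < r by exact: lt_le_trans rr1.
have S1 : 1 <= S by move: rS K1 r_1; nra.
have S0 : 0 < S by apply: lt_le_trans S1.
have T0 : 0 < T by apply: lt_trans ST.
have rS' : awK qh * r <= S / 2 by move: rS; lra.
have [bsS cS] := generic_covers ok gS; have [bsT cT] := generic_covers ok gT.
have dg x : N x = r -> 1 <= N (aw_hat qh zeta x - aw_check qh zeta x) by move=> e; apply: dge; rewrite e.
have P := aw_proximity_bound hzeta qh0 ok hg0 g00 fg0 r_1 rS' cS dg.
have [_ A _] := nevanlinna_bounds ok hg0 g00 fg0 S0 cS S1.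
have KS := kabs_sum_le hg0 g00 fg0 S1 ST cS cT.
have Tc V : generic f V -> 1 <= V -> 0 <= characteristic V f.
  move=> gV V1; have [bs cv] := generic_covers ok gV; have [V0 _] := gV.
  rewrite /characteristic (pole_countingE ok V0 cv) proximityE.
  rewrite addr_ge0//; first by rewrite mulr_ge0 ?invr_ge0 ?twopi_ge0//; apply: Rintegral_ge0 => t _; rewrite le_max lexx.
  rewrite big_seq sumr_ge0// => p pb; rewrite mulr_ge0// (lam_ge0 cv)//.
have TS := Tc S gS S1; have TT := Tc T gT (le_trans S1 (ltW ST)).
have lT : 0 < ln (T / S) by rewrite ln_gt0// ltr_pdivlMr// mul1r.
move: P A KS TS TT lT; rewrite -/c.
set A0 := (2 * pi)^-1 * _; set m := proximity _ _; set TS := characteristic S f; set TT := characteristic T f.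
set L := ln (T / S); set Sg := \sum_(p <- bsS) _ => P A KS TS0 TT0 L0.
have Sg1 : Sg <= (2 + c) * ((TT + 1) / L).
  rewrite mulrA ler_pdivlMr//; apply: le_trans KS _; nra.
have A1 : A0 <= (2 + c) * (TS + 1) by nra.
have rSp : 0 <= r / S by rewrite divr_ge0// ltW// (lt_trans ltr01).
set u := r / S * (TS + 1); set v := (TT + 1) / L.
have u0 : 0 <= u by rewrite mulr_ge0// addr_ge0.
have v0 : 0 <= v by apply: divr_ge0; [exact: addr_ge0|exact: ltW].
have e1 : 8 * awK qh * r / S * A0 <= 8 * awK qh * (2 + c) * u.
  have -> : 8 * awK qh * (2 + c) * u = 8 * awK qh * (r / S) * ((2 + c) * (TS + 1)) by rewrite /u; ring.
  have -> : 8 * awK qh * r / S = 8 * awK qh * (r / S) by rewrite mulrA.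
  by rewrite ler_wpM2l// mulr_ge0// mulr_ge0//; lra.
have e2 : (Sg + 1) * c3 <= c3 * (3 + c) * (v + 1).
  have : Sg + 1 <= (3 + c) * (v + 1) by move: Sg1 v0 c0; rewrite -/v; nra.
  move=> h; rewrite [c3 * _]mulrC -mulrA [c3 * _]mulrC mulrA; exact: ler_wpM2r.
apply: le_trans P _.
rewrite -[X in (Sg + 1) * X]/c3.
have k0 : 0 <= 8 * awK qh * (2 + c) by rewrite mulr_ge0//; lra.
have k1 : 0 <= c3 * (3 + c) by rewrite mulr_ge0//; lra.
apply: (@le_trans _ _ (ln 2 + 8 * awK qh * (2 + c) * u + c3 * (3 + c) * (v + 1))); first lra.
rewrite /C; move: k0 k1 l2 u0 v0; move: (8 * awK qh * (2 + c)) (c3 * (3 + c)) (ln 2) => a b d a0 b0 d0 u0 v0.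
have := mulr_ge0 a0 v0; have := mulr_ge0 b0 u0; have := mulr_ge0 d0 u0; have := mulr_ge0 d0 v0; lra.
Qed.
End Key.

(** * Growth *)

Section Limf.
Context {R : realType}.
Implicit Types (u : R -> R) (b : R).

Lemma evP (P : R -> Prop) : (\forall r \near +oo, P r) <-> exists M, forall r, M < r -> P r.
Proof.
split; first by move=> [M [_ H]]; exists M => r; exact: H.
by move=> [M H]; exists M; split=> //; exact: num_real.
Qed.

Lemma ev_gt b : \forall r \near +oo, b < r.
Proof. by apply/evP; exists b. Qed.

Lemma esup_lt_ev u b : (limf_esup (fun r => (u r)%:E) +oo%R < b%:E)%E -> \forall r \near +oo, u r < b.
Proof.
rewrite limf_esupE => /ereal_inf_lt[_ [A FA <-]] h; apply: filterS FA => r Ar.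
by rewrite -lte_fin; apply: le_lt_trans h; apply: ereal_sup_ubound; exists r.
Qed.

Lemma esup_le_ev u b : (\forall r \near +oo, u r <= b) -> (limf_esup (fun r => (u r)%:E) +oo%R <= b%:E)%E.
Proof.
move=> H; rewrite limf_esupE; apply: (@le_trans _ _ (ereal_sup [set (u r)%:E | r in [set r | u r <= b]])).
  by apply: ereal_inf_lbound; exists [set r | u r <= b].
by apply: ge_ereal_sup => _ [r /= h <-]; rewrite lee_fin.
Qed.

Lemma einf_gt_ev u b : (b%:E < limf_einf (fun r => (u r)%:E) +oo%R)%E -> \forall r \near +oo, b < u r.
Proof.
rewrite /limf_einf lteNr => h.
have : \forall r \near +oo, - u r < - b by apply: esup_lt_ev; rewrite EFinN.
by apply: filterS => r; rewrite ltrN2.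
Qed.

Lemma einf_ge_ev u b : (\forall r \near +oo, b <= u r) -> (b%:E <= limf_einf (fun r => (u r)%:E) +oo%R)%E.
Proof.
move=> h; rewrite /limf_einf leeNr -EFinN.
have : \forall r \near +oo, - u r <= - b by apply: filterS h => r; rewrite lerN2.
exact: esup_le_ev.
Qed.

Lemma einf_le_ev u b : (\forall r \near +oo, u r <= b) -> (limf_einf (fun r => (u r)%:E) +oo%R <= b%:E)%E.
Proof.
move=> h; rewrite leNgt; apply/negP => /einf_gt_ev h2.
have [M H] := (evP _).1 (filterI h h2).
by have [] := H (M + 1) _; [lra|lra].
Qed.

Lemma esup_pinfty u : limf_esup (fun r => (u r)%:E) +oo = +oo%E -> forall M b, exists2 r, M < r & b < u r.
Proof.
move=> h M b; apply: contrapT => H.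
have : (limf_esup (fun r => (u r)%:E) +oo%R <= b%:E)%E.
  apply: esup_le_ev; apply: filterS (ev_gt M) => r Mr; rewrite leNgt; apply/negP => br; apply: H; by exists r.
by rewrite h.
Qed.
End Limf.

(** * Choice of the two radii *)

Section Radii.
Context {R : realType}.
Implicit Types (K C r y a l L P S V t v : R).

(** With [y ^ 2 = s r / r] the intervals end at the geometric mean of [r] and [s r] and at [s r].
    Intervals are needed, because a prescribed radius may fail to be generic. *)
Lemma convex_radii_itv K r y : 0 < r -> 1 <= K -> 4 * K <= y ->
  [/\ 0 < r * y / 2, r * y / 2 < r * y, 0 < r * y ^+ 2 / 2 & r * y ^+ 2 / 2 < r * y ^+ 2].
Proof.
move=> r0 K1 yK; have y0 : 0 < y by lra.
have ry : 0 < r * y by exact: mulr_gt0.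
have ryy : 0 < r * y ^+ 2 by rewrite mulr_gt0// exprn_gt0.
split; lra.
Qed.

(** As [y >= 4], [V / S >= y / 2 >= sqrt y], so [ln (V / S)] is at least a quarter of [ln (y ^ 2)].
    Moreover [r / S <= 2 / y <= 2 / ln y]. *)
Lemma convex_radii K r y S V : 0 < r -> 1 <= K -> 4 * K <= y ->
  r * y / 2 <= S -> S <= r * y -> r * y ^+ 2 / 2 <= V ->
  [/\ 2 * K * r <= S, S < V, r <= S, S <= r * y ^+ 2 &
   [/\ 0 < ln (y ^+ 2), ln (y ^+ 2) / 4 <= ln (V / S) & r / S <= 4 / ln (y ^+ 2)]].
Proof.
move=> r0 K1 yK S1 S2 V1; have y4 : 4 <= y by lra.
have y0 : 0 < y by lra.
have ry : 0 < r * y by exact: mulr_gt0.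
have ryy : 4 * (r * y) <= r * y ^+ 2.
  have -> : r * y ^+ 2 = y * (r * y) by ring.
  by apply: ler_wpM2r => //; exact: ltW.
have KS : 2 * K * r <= S by apply: le_trans S1; nra.
have rS : r <= S by apply: le_trans KS; rewrite ler_peMl; lra.
have S0 : 0 < S by exact: lt_le_trans rS.
have SV : S < V by lra.
have V0 : 0 < V by exact: lt_trans SV.
have ly : 0 < ln y by rewrite ln_gt0//; lra.
have LE : ln (y ^+ 2) = 2 * ln y by rewrite lnXn// mulr_natl.
split=> //; first by lra.
rewrite LE; split; first by rewrite mulr_gt0.
  apply: (@le_trans _ _ (ln (y / 2))).
    have : ln y <= 2 * ln (y / 2).
      have -> : 2 * ln (y / 2) = ln ((y / 2) ^+ 2) by rewrite lnXn ?mulr_natl// divr_gt0.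
      by rewrite ler_ln ?posrE ?exprn_gt0 ?divr_gt0//; clear -y4; nra.
    by clear; lra.
  rewrite ler_ln ?posrE ?divr_gt0// ler_pdivlMr//.
  apply: (@le_trans _ _ (y / 2 * (r * y))); first by rewrite ler_wpM2l// divr_ge0// ltW.
  by apply: le_trans V1; rewrite expr2; clear; lra.
rewrite ler_pdivrMr// mulrAC ler_pdivlMr ?mulr_gt0//.
have lyy : ln y < y by exact: ln_sublinear.
apply: (@le_trans _ _ (r * (2 * y))); first by rewrite ler_wpM2l ?(ltW r0)// ler_wpM2l// ltW.
by clear -S1; lra.
Qed.

Lemma convex_combine C a l L P t v : 0 <= C -> 0 < L -> 1 <= P -> 0 <= a ->
  a <= 4 / L -> L / 4 <= l -> t <= P -> v <= P ->
  C * (a * (t + 1) + (v + 1) / l + 1) <= (16 * C + 1) * (P / L + 1).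
Proof.
move=> C0 L0 P1 a0 aL Ll tP vP.
have l0 : 0 < l by apply: lt_le_trans Ll; rewrite divr_gt0.
have Q0 : 0 <= P / L by rewrite divr_ge0 ?(ltW L0)//; lra.
have e1 : a * (t + 1) <= 8 * (P / L).
  apply: (@le_trans _ _ (4 / L * (2 * P))); last by rewrite le_eqVlt; apply/orP; left; apply/eqP; ring.
  apply: (@le_trans _ _ (a * (2 * P))); first by rewrite ler_wpM2l//; lra.
  by rewrite ler_wpM2r//; lra.
have e2 : (v + 1) / l <= 8 * (P / L).
  rewrite ler_pdivrMr//; apply: (@le_trans _ _ (8 * (P / L) * (L / 4))); last by rewrite ler_wpM2l// mulr_ge0.
  have -> : 8 * (P / L) * (L / 4) = 2 * P by field; rewrite gt_eqF.
  by clear -vP P1; lra.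
apply: (@le_trans _ _ (C * (16 * (P / L) + 1))); first by rewrite ler_wpM2l//; lra.
by clear -C0 Q0; move: (P / L) Q0 => Q Q0; nra.
Qed.

Lemma subadditive_radii_itv K r : 0 < r -> 1 <= K ->
  [/\ 0 < 2 * K * r, 2 * K * r < 4 * K * r, 0 < 8 * K * r & 8 * K * r < 16 * K * r].
Proof. by move=> r0 K1; have Kr : 0 < K * r; [rewrite mulr_gt0//; lra|split; lra]. Qed.

Lemma subadditive_radii K r S V : 0 < r -> 1 <= K -> 2 * K * r <= S -> S <= 4 * K * r -> 8 * K * r <= V ->
  [/\ S < V, r <= S, S <= 16 * K * r & ln 2 <= ln (V / S) /\ r / S <= 1].
Proof.
move=> r0 K1 S1 S2 V1; have Kr : r <= K * r by rewrite ler_peMl// ltW.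
have S0 : 0 < S by lra.
have V0 : 0 < V by lra.
split; try lra.
rewrite ler_ln ?posrE ?divr_gt0// ler_pdivlMr// ler_pdivrMr//; split; lra.
Qed.

Lemma subadditive_combine C a l P t v : 0 <= C -> 1 <= P -> 0 <= a -> a <= 1 ->
  ln 2 <= l -> t <= P -> v <= P ->
  C * (a * (t + 1) + (v + 1) / l + 1) <= C * (3 + 2 / ln 2) * P.
Proof.
move=> C0 P1 a0 a1 Ll tP vP.
have l2 : 0 < ln 2 :> R by rewrite ln_gt0// ltr1n.
have l0 : 0 < l by exact: lt_le_trans Ll.
have e1 : a * (t + 1) <= 2 * P.
  apply: (@le_trans _ _ (a * (2 * P))); first by rewrite ler_wpM2l//; lra.
  by rewrite ler_piMl//; lra.
have e2 : (v + 1) / l <= 2 * P / ln 2.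
  apply: (@le_trans _ _ (2 * P / l)); first by rewrite ler_wpM2r ?invr_ge0 ?(ltW l0)//; lra.
  by rewrite ler_wpM2l ?lef_pV2 ?posrE//; lra.
rewrite -mulrA ler_wpM2l//.
have -> : (3 + 2 / ln 2) * P = 3 * P + 2 * P / ln 2 by ring.
by clear -e1 e2 P1; lra.
Qed.
End Radii.

(** * Growth estimates, with [T], [m] and [G] abstracting the characteristic, the proximity function
    and genericity *)

Section Growth.
Context {R : realType}.
Variables (R0 : R) (phi s : R -> R).
Hypothesis hphi : admissible_phi R0 phi.

Lemma phi_large M : \forall r \near +oo, M < phi r.
Proof.
have [_ pm pu _] := hphi; have [r0 r0R Mr] := pu M.
by apply: filterS (ev_gt r0) => r h; apply: lt_le_trans Mr _; apply: pm => //; exact: ltW.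
Qed.

Lemma phi_powR_large M c : 0 < c -> \forall r \near +oo, M <= phi r `^ c.
Proof.
move=> c0; apply: filterS (phi_large (Num.max 1 M `^ c^-1)) => r h.
have M1 : 0 <= Num.max 1 M by rewrite le_max ler01.
apply: (@le_trans _ _ (Num.max 1 M)); first by rewrite le_max lexx orbT.
have -> : Num.max 1 M = (Num.max 1 M `^ c^-1) `^ c by rewrite -powRrM mulVf ?powRr1// gt_eqF.
apply: ge0_ler_powR; rewrite ?nnegrE ?powR_ge0 ?(ltW c0) ?(ltW h)//.
by apply: le_trans (ltW h); exact: powR_ge0.
Qed.

Variables (T m : R -> R) (G : R -> Prop) (K C r1 C' r2 rho : R).
Hypothesis K1 : 1 <= K.
Hypothesis C0 : 0 <= C.
Hypothesis m0 : forall r, 0 <= m r.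
Hypothesis Gex : forall a b, 0 < a -> a < b -> exists S, [/\ a <= S, S <= b & G S].
Hypothesis key : forall r S V, r1 <= r -> 2 * K * r <= S -> S < V -> G S -> G V ->
  m r <= C * (r / S * (T S + 1) + (T V + 1) / ln (V / S) + 1).
Hypothesis low : forall S, r2 <= S -> G S -> ln S - C' <= T S.
Hypothesis hrho : limf_esup (fun r => (ln (T r) / ln (phi r))%:E) +oo = rho%:E.

Lemma T_le d : 0 < d -> \forall r \near +oo, T r <= phi r `^ (rho + d).
Proof.
move=> d0.
have h : \forall r \near +oo, ln (T r) / ln (phi r) < rho + d.
  by apply: esup_lt_ev; rewrite hrho lte_fin; lra.
apply: filterS (filterI h (phi_large 1)) => r [h1 p1].
have l0 : 0 < ln (phi r) by exact: ln_gt0.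
have [t0|t0] := leP (T r) 0; first exact: le_trans t0 (powR_ge0 _ _).
have pr0 : 0 < phi r by lra.
by rewrite -ler_ln ?posrE ?powR_gt0// ln_powR -ler_pdivrMr// ltW.
Qed.

Lemma generic_lower d : 0 < d -> forall M, exists S, [/\ M < S, G S & ln S - C' <= phi S `^ (rho + d)].
Proof.
move=> d0 M; have [M' H] := (evP _).1 (T_le d0).
pose a := Num.max 1 (Num.max r2 (Num.max M M') + 1).
have a0 : 0 < a by rewrite /a lt_max ltr01.
have [|S [aS _ GS]] := @Gex a (a + 1) a0; first by lra.
move: aS; rewrite /a ge_max => /andP[_ aS].
have : [/\ r2 < S, M < S & M' < S].
  have e : Num.max r2 (Num.max M M') < S by lra.
  by move: e; rewrite !gt_max => /andP[-> /andP[-> ->]].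
move=> [h1 h2 h3]; exists S; split=> //.
by apply: le_trans (H S h3); apply: low => //; exact: ltW.
Qed.

(** A negative order would keep [T] at most 1 at large generic radii, where it is at least
    [ln S - C']. *)
Lemma rho_ge0 : 0 <= rho.
Proof.
rewrite leNgt; apply/negP => r0.
have [M H] := (evP _).1 (phi_large 1).
have d0 : 0 < - rho / 2 by lra.
have [S [MS GS h]] := generic_lower d0 (Num.max M (expR (C' + 2))).
move: MS; rewrite gt_max => /andP[h1 h2].
have p1 := H S h1.
have : phi S `^ (rho + - rho / 2) <= phi S `^ 0 by apply: ler_powR; [exact: ltW|lra].
rewrite powRr0 => q.
have : C' + 2 < ln S by rewrite -[ltLHS]expRK ltr_ln// ?posrE ?expR_gt0// (lt_trans (expR_gt0 _) h2).
lra.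
Qed.

Hypothesis hs : admissible_s R0 s.

(** This is where the lower limit of [s r / r] being above 1 enters: it keeps the denominators
    [ln (s r / r)] away from 0. *)
Lemma ln_ratio_lb : exists2 c, 0 < c & \forall r \near +oo, c <= ln (s r / r).
Proof.
have [_ _ _ h] := hs.
have [b b1 hb] : exists2 b : R, 1 < b & (b%:E < limf_einf (fun r : R => (s r / r)%:E) +oo%R)%E.
  move: h; case: (limf_einf _ _) => [v| |]//=; last by exists 2 => //; [lra|exact: ltry].
  by rewrite lte_fin => v1; exists ((1 + v) / 2); rewrite ?lte_fin; lra.
exists (ln b); first exact: ln_gt0.
apply: filterS (einf_gt_ev hb) => r h1; rewrite ler_ln ?posrE ?(ltW h1)//; first lra.
by apply: lt_trans h1; lra.
Qed.

Lemma ev_basic : \forall r \near +oo, [/\ R0 < r, 1 < r, r < s r & s r <= r ^+ 2] /\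
  [/\ 1 < phi r, phi r <= phi (s r), ln r <= phi r & ln (s r / r) <= ln r].
Proof.
have [_ pm _ pl] := hphi; have [_ _ sr _] := hs.
apply: filterS (filterI (filterI (ev_gt R0) (ev_gt 1)) (filterI (phi_large 1) (filterI pl sr))).
move=> r [[h1 h2] [h3 [/andP[h4 _] /andP[h5 h6]]]].
have r0 : 0 < r by lra.
split=> //; split=> //; first by apply: pm => //; exact: ltW.
rewrite ler_ln ?posrE ?divr_gt0//; last by lra.
by rewrite ler_pdivrMr// -expr2.
Qed.

Notation al := (alpha_growth phi s).
Notation ga := (gamma_growth phi s).

(** The quotient is eventually in [[0, 1]], so [fine] loses nothing in the definition of
    [alpha_growth]. *)
Lemma alphaE : limf_einf (fun r : R => (ln (phi r) / ln (phi (s r)))%:E) +oo = al%:E /\ 0 <= al <= 1.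
Proof.
have b : \forall r \near +oo, 0 <= ln (phi r) / ln (phi (s r)) <= 1.
  apply: filterS ev_basic => r [[h1 h2 h3 h4] [h5 h6 h7 h8]].
  have l0 : 0 < ln (phi r) by exact: ln_gt0.
  have p2 : 1 < phi (s r) by exact: lt_le_trans h6.
  have l1 : 0 < ln (phi (s r)) by exact: ln_gt0.
  rewrite divr_ge0 ?(ltW l0) ?(ltW l1)//= ler_pdivrMr// mul1r ler_ln ?posrE//; lra.
have g0 : (0%:E <= limf_einf (fun r : R => (ln (phi r) / ln (phi (s r)))%:E) +oo%R)%E.
  by apply: einf_ge_ev; apply: filterS b => r /andP[].
have g1 : (limf_einf (fun r : R => (ln (phi r) / ln (phi (s r)))%:E) +oo%R <= 1%:E)%E.
  by apply: einf_le_ev; apply: filterS b => r /andP[].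
rewrite /alpha_growth; move: g0 g1; case: (limf_einf _ _) => [v| |]//=.
by rewrite !lee_fin => -> ->.
Qed.

(** The upper bound is [ln (s r / r) <= ln r <= phi r]. From below, [ln (ln (s r / r))] is only
    known to be bounded, possibly negative; divided by the unbounded [ln (phi r)] it exceeds every
    [- d]. *)
Lemma gammaE : limf_einf (fun r : R => (ln (ln (s r / r)) / ln (phi r))%:E) +oo = ga%:E /\ 0 <= ga <= 1.
Proof.
have [c c0 hc] := ln_ratio_lb.
have b d : 0 < d -> \forall r \near +oo, - d <= ln (ln (s r / r)) / ln (phi r) <= 1.
  move=> d0; apply: filterS (filterI hc (filterI ev_basic (phi_large (expR (`|ln c| / d))))).
  move=> r [h0 [[[h1 h2 h3 h4] [h5 h6 h7 h8]] h9]].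
  have l0 : 0 < ln (phi r) by exact: ln_gt0.
  have p0 : 0 < phi r by lra.
  have x0 : 0 < ln (s r / r) by exact: lt_le_trans h0.
  rewrite ler_pdivlMr// ler_pdivrMr// mul1r; apply/andP; split; last first.
    by rewrite ler_ln ?posrE//; exact: le_trans h7.
  apply: (@le_trans _ _ (ln c)); last by rewrite ler_ln ?posrE.
  rewrite mulNr lerNl; apply: (@le_trans _ _ `|ln c|); first by rewrite -normrN ler_norm.
  rewrite mulrC -ler_pdivrMr// -[leLHS]expRK ler_ln ?posrE ?expR_gt0// ltW//.
have g1 : (limf_einf (fun r : R => (ln (ln (s r / r)) / ln (phi r))%:E) +oo%R <= 1%:E)%E.
  by apply: einf_le_ev; apply: filterS (b 1 ltr01) => r /andP[].
have g0 d : 0 < d -> ((- d)%:E <= limf_einf (fun r : R => (ln (ln (s r / r)) / ln (phi r))%:E) +oo%R)%E.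
  by move=> d0; apply: einf_ge_ev; apply: filterS (b d d0) => r /andP[].
rewrite /gamma_growth; move: g0 g1; case: (limf_einf _ _) => [v| |]//= g0; last by have := g0 1 ltr01.
rewrite !lee_fin => ->; split=> //; rewrite andbT leNgt; apply/negP => v0.
have /g0 : 0 < - v / 2 by lra.
rewrite lee_fin; lra.
Qed.

Lemma gamma_lb d : 0 < d -> \forall r \near +oo, phi r `^ (ga - d) <= ln (s r / r).
Proof.
move=> d0; have [gE _] := gammaE; have [c c0 hc] := ln_ratio_lb.
have h : \forall r \near +oo, ga - d < ln (ln (s r / r)) / ln (phi r).
  by apply: einf_gt_ev; rewrite gE lte_fin; lra.
apply: filterS (filterI h (filterI hc (phi_large 1))) => r [h1 [h2 h3]].
have l0 : 0 < ln (phi r) by exact: ln_gt0.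
have pr0 : 0 < phi r by lra.
have lr0 : 0 < ln (s r / r) by exact: lt_le_trans h2.
by rewrite -ler_ln ?posrE ?powR_gt0// ln_powR -ler_pdivlMr// ltW.
Qed.

Lemma alpha_lb d : 0 < d -> \forall r \near +oo, phi (s r) `^ (al - d) <= phi r.
Proof.
move=> d0; have [aE _] := alphaE.
have h : \forall r \near +oo, al - d < ln (phi r) / ln (phi (s r)).
  by apply: einf_gt_ev; rewrite aE lte_fin; lra.
apply: filterS (filterI h ev_basic) => r [h1 [_ [h5 h6 _ _]]].
have p2 : 1 < phi (s r) by exact: lt_le_trans h6.
have l1 : 0 < ln (phi (s r)) by exact: ln_gt0.
have pr0 : 0 < phi r by lra.
have ps0 : 0 < phi (s r) by lra.
by rewrite -ler_ln ?posrE ?powR_gt0// ln_powR -ler_pdivlMr// ltW.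
Qed.

(* At generic radii [S] one has [phi S `^ (ga - d) <= ln S <= T S + C'], while
   [T S <= phi S `^ (rho + d)]. *)
Lemma rho_ge_gamma : ga <= rho.
Proof.
rewrite leNgt; apply/negP => rg; have r0 := rho_ge0.
pose d := (ga - rho) / 4; have d0 : 0 < d by rewrite /d; lra.
have d2 : 0 < 2 * d by lra.
have [M H] := (evP _).1 (filterI (gamma_lb d0) (filterI ev_basic (phi_powR_large (2 + `|C'|) d2))).
have [S [MS GS h]] := generic_lower d0 M.
have [h1 [[_ [h5 _ _ h8]] h9]] := H S MS.
have p0 : phi S != 0 by rewrite gt_eqF// (lt_trans ltr01).
move: h1; rewrite (_ : ga - d = (rho + d) + 2 * d); last by rewrite /d; field.
rewrite powRD ?p0 ?implybT// => h1.
have b1 : 1 <= phi S `^ (rho + d).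
  have := @ler_powR R (phi S) (ltW h5) 0 (rho + d) _; rewrite powRr0; apply; lra.
have c1 := ler_norm C'; have c2 := normr_ge0 C'.
have : phi S `^ (rho + d) * (2 + `|C'|) <= phi S `^ (rho + d) * phi S `^ (2 * d) by rewrite ler_wpM2l// (le_trans ler01).
nra.
Qed.

Variable eps : R.
Hypothesis eps0 : 0 < eps.

(** [ln (s r / r)] is at least [phi r] to a power near [ga], and [phi r] is at least [phi (s r)] to
    a power near [al]. The summand 1 is absorbed because [al * ga <= ga <= rho] makes the exponent
    positive. *)
Lemma growth_exponent : (fun r : R => phi (s r) `^ (rho + eps / 2) / ln (s r / r) + 1) =O_ (+oo_R)
   (fun r : R => phi (s r) `^ (rho - al * ga + eps)).
Proof.
have [_ /andP[a0 a1]] := alphaE; have [_ /andP[g0 g1]] := gammaE.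
have rg := rho_ge_gamma; have r0 := rho_ge0; have e0 := eps0.
have [c c0 hc] := ln_ratio_lb.
have ag : al * ga <= ga by rewrite ler_piMl.
have red k : 0 < k -> (\forall r \near +oo, phi (s r) `^ (rho + eps / 2) / ln (s r / r) <= k * phi (s r) `^ (rho - al * ga + eps)) ->
    (fun r : R => phi (s r) `^ (rho + eps / 2) / ln (s r / r) + 1) =O_ (+oo_R)
   (fun r : R => phi (s r) `^ (rho - al * ga + eps)).
  move=> k0 H; apply/eqO_exP; exists (k + 1); first by lra.
  apply: filterS (filterI H (filterI hc ev_basic)) => r [h [h0 [_ [h5 h6 _ _]]]].
  have p2 : 1 <= phi (s r) by apply: ltW; exact: lt_le_trans h6.
  have B1 : 1 <= phi (s r) `^ (rho - al * ga + eps).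
    have := @ler_powR R _ p2 0 (rho - al * ga + eps) _; rewrite powRr0; apply; lra.
  rewrite (ger0_norm (powR_ge0 _ _)) ger0_norm.
    by rewrite mulrDl mul1r; exact: lerD.
  by rewrite addr_ge0// divr_ge0 ?powR_ge0// (le_trans (ltW c0) h0).
(* When the product is 0, boundedness of the denominator from below suffices; otherwise [d] can be
   taken below both [al] and [ga]. *)
have [z|nz] := eqVneq (al * ga) 0.
  apply: (red c^-1); first by rewrite invr_gt0.
  apply: filterS (filterI hc ev_basic) => r [h0 [_ [h5 h6 _ _]]].
  have p2 : 1 <= phi (s r) by apply: ltW; exact: lt_le_trans h6.
  rewrite mulrC; apply: ler_pM; rewrite ?invr_ge0 ?powR_ge0//.
  - by rewrite (le_trans (ltW c0) h0).
  - by rewrite lef_pV2 ?posrE//; exact: lt_le_trans h0.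
  - by apply: ler_powR => //; rewrite z; lra.
have al0 : 0 < al by rewrite lt_def a0 andbT; apply: contraNneq nz => ->; rewrite mul0r.
have ga0 : 0 < ga by rewrite lt_def g0 andbT; apply: contraNneq nz => ->; rewrite mulr0.
(* The bound [eps / 4] gives [d * (al + ga) <= eps / 2]; half the minimum keeps [al - d] and
   [ga - d] positive, so that powers are monotone. *)
pose d := Num.min (eps / 4) (Num.min al ga / 2).
have d0 : 0 < d.
  rewrite /d lt_min divr_gt0//= divr_gt0// lt_min al0 ga0//.
have : d <= eps / 4 /\ d <= Num.min al ga / 2.
  by split; rewrite /d ge_min lexx ?orbT.
move=> [d1]; have m1 : Num.min al ga <= al by rewrite ge_min lexx.
have m2 : Num.min al ga <= ga by rewrite ge_min lexx orbT.
move=> d3.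
apply: (red 1) => //.
apply: filterS (filterI (gamma_lb d0) (filterI (alpha_lb d0) ev_basic)) => r [h1 [h2 [_ [h5 h6 _ _]]]].
have p2 : 1 < phi (s r) by exact: lt_le_trans h6.
have p0 : phi (s r) != 0 by rewrite gt_eqF// (lt_trans ltr01).
have L : phi (s r) `^ ((al - d) * (ga - d)) <= ln (s r / r).
  apply: le_trans h1; rewrite powRrM; apply: ge0_ler_powR; rewrite ?nnegrE ?powR_ge0//; try lra.
have q0 : 0 < phi (s r) `^ ((al - d) * (ga - d)) by rewrite powR_gt0// (lt_trans ltr01).
rewrite mul1r ler_pdivrMr; last exact: lt_le_trans L.
apply: (@le_trans _ _ (phi (s r) `^ (rho - al * ga + eps) * phi (s r) `^ ((al - d) * (ga - d)))); last first.
  by rewrite ler_wpM2l ?powR_ge0.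
rewrite -powRD ?p0 ?implybT//; apply: ler_powR; [exact: ltW|nra].
Qed.

(** Chord slopes of a convex function from a fixed point [a] increase. One far point [x] with a
    steep chord, given by the infinite upper limit, thus makes all later chords at least as
    steep. *)
Lemma superlinear : limf_esup (fun r : R => (s r / r)%:E) +oo = +oo%E ->
  convex_function (E := R^o) `]R0, +oo[ s -> forall M, \forall r \near +oo, M <= s r / r.
Proof.
move=> hsup hconv M0; pose M := Num.max 0 M0.
have M_0 : 0 <= M by rewrite /M le_max lexx.
pose a := Num.max 1 (R0 + 1).
have a1 : 1 <= a by rewrite /a le_max lexx.
have aR : R0 < a by rewrite /a lt_max; apply/orP; right; lra.
have sa : 0 < s a by have [sp _ _ _] := hs; exact: sp.
(* Since [x >= 1], the extra [s a] pays for the value at [a] and leaves chord slope at least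
   [2 * M]. The 2 is spent at the end, where [2 * (r - a) >= r]. *)
have [x xa hx] := esup_pinfty hsup a (2 * M + s a).
clear hsup.
have x0 : 0 < x by lra.
rewrite ltr_pdivlMr// in hx.
apply: filterS (filterI (ev_gt x) (ev_gt (2 * a))) => r [xr ar].
have ra : 0 < r - a by lra.
have t0 : 0 <= (r - x) / (r - a) by rewrite divr_ge0//; lra.
have t1 : (r - x) / (r - a) <= 1 by rewrite ler_pdivrMr//; lra.
have := hconv (Itv01 t0 t1) a r; rewrite !convRE !inE /= !in_itv /= !andbT => H.
have {}H := H aR (lt_trans aR (lt_trans xa xr)).
move: H; rewrite /unstable.onem.
rewrite [conv _ _ _](_ : _ = x); last first.
  by change ((r - x) / (r - a) * a + (1 - (r - x) / (r - a)) * r = x); field; lra.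
have -> : (r - x) / (r - a) * s a + (1 - (r - x) / (r - a)) * s r = s a + (x - a) / (r - a) * (s r - s a) by field; lra.
move=> H.
have H2 : 2 * M * x <= (x - a) / (r - a) * (s r - s a).
  have : s a <= s a * x by rewrite ler_peMr//; lra.
  by move: hx H; rewrite mulrDl; lra.
have H3 : 2 * M * (r - a) <= s r - s a.
  have xa0 : 0 < x - a by lra.
  rewrite [X in _ <= X]mulrAC ler_pdivlMr// in H2.
  rewrite -(ler_pM2l xa0); apply: le_trans H2.
  have : 0 <= 2 * M * (r - a) by rewrite !mulr_ge0// ltW.
  nra.
rewrite ler_pdivlMr; last by lra.
apply: (@le_trans _ _ (M * r)); first by rewrite ler_wpM2r; [by []|lra|by rewrite /M le_max lexx orbT].
nra.
Qed.

(** Both radii lie between [r] and [s r], so monotonicity of [phi] bounds both characteristics by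
    the same power of [phi (s r)]. *)
Lemma growth_convex : limf_esup (fun r : R => (s r / r)%:E) +oo = +oo%E ->
  convex_function (E := R^o) `]R0, +oo[ s ->
  m =O_ (+oo_R) (fun r : R => phi (s r) `^ (rho + eps / 2) / ln (s r / r) + 1).
Proof.
move=> hsup hconv; have [_ pm _ _] := hphi.
have e0 : 0 < eps / 2 by rewrite divr_gt0.
have e1 : 0 <= rho + eps / 2 by rewrite addr_ge0 ?rho_ge0// ltW.
have [MT HT] := (evP _).1 (T_le e0).
apply/eqO_exP; exists (16 * C + 1); first by rewrite ltr_wpDl// mulr_ge0.
apply: filterS (filterI (filterI (ev_gt MT) (ev_gt r1)) (filterI ev_basic (superlinear hsup hconv ((4 * K) ^+ 2)))).
move=> r [[MTr r1r] [[[h1 h2 _ _] [h5 h6 _ _]] hx]].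
have rp : 0 < r by exact: lt_trans h2.
have k0 : 0 <= 4 * K by rewrite mulr_ge0// (le_trans ler01).
(* The bound [(4 * K) ^ 2] requested from [superlinear] gives [y >= 4 * K], hence
   [S >= r * y / 2 >= 2 * K * r]. *)
pose y := Num.sqrt (s r / r).
have yE : y ^+ 2 = s r / r by rewrite sqr_sqrtr// (le_trans _ hx)// sqr_ge0.
have yK : 4 * K <= y by rewrite -[leLHS]ger0_norm// -sqrtr_sqr; exact: ler_wsqrtr.
have sE : s r = r * y ^+ 2 by rewrite yE mulrCA divff ?mulr1// gt_eqF.
have [a1 a2 a3 a4] := convex_radii_itv rp K1 yK.
have [S [S1 S2 GS]] := Gex a1 a2.
have [V [V1 V2 GV]] := Gex a3 a4.
have [KS SV rS Ss [L0 LV LS]] := convex_radii rp K1 yK S1 S2 V1.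
set P := phi (s r) `^ _.
have P0 : 0 <= P by exact: powR_ge0.
have p2 : 1 <= phi (s r) by exact: le_trans (ltW h5) h6.
have P1 : 1 <= P by have := ler_powR p2 e1; rewrite powRr0.
have pP u : r <= u -> u <= s r -> T u <= P.
  move=> ru us; apply: le_trans (HT u (lt_le_trans MTr ru)) _.
  have pu : phi u <= phi (s r) by apply: pm => //; exact: lt_le_trans ru.
  have p0 : 0 <= phi u by rewrite (le_trans _ (pm _ _ h1 ru))// (le_trans ler01 (ltW h5)).
  by apply: ge0_ler_powR; rewrite ?nnegrE// (le_trans p0 pu).
have TS : T S <= P by apply: pP => //; rewrite sE.
have TV : T V <= P by apply: pP; [exact: le_trans rS (ltW SV)|rewrite sE].
apply: (@le_trans _ _ ((16 * C + 1) * (P / ln (y ^+ 2) + 1))); last first.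
  rewrite yE [X in _ <= _ * X]ger0_norm// addr_ge0// divr_ge0// -yE ltW//.
rewrite (ger0_norm (m0 r)); apply: le_trans (key (ltW r1r) KS SV GS GV) _.
apply: convex_combine => //; rewrite divr_ge0 ?(ltW rp)//.
exact: le_trans (ltW rp) rS.
Qed.

Lemma subadditive_mul A (n : nat) r : (forall a b, A <= a -> A <= b -> phi (a + b) <= phi a + phi b) ->
  A <= r -> 0 <= r -> phi (n.+1%:R * r) <= n.+1%:R * phi r.
Proof.
move=> sub Ar r0; elim: n => [|n IH]; first by rewrite !mul1r.
rewrite -natr1 !mulrDl !mul1r; apply: le_trans (sub _ _ _ Ar) _; last by rewrite lerD2r.
by apply: le_trans Ar _; rewrite ler_peMl// ler1n.
Qed.

(** Both radii are at most [16 * K * r], a fixed multiple of [r], so subadditivity bounds [phi]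
    there by a multiple of [phi r]; the power of that multiple is [Q]. *)
Lemma growth_subadditive : subadditive_near_oo phi ->
  m =O_ (+oo_R) (fun r : R => phi r `^ (rho + eps)).
Proof.
move=> [A sub]; have [pp pm _ _] := hphi.
have e1 : 0 <= rho + eps by rewrite addr_ge0 ?rho_ge0// ltW.
have [MT HT] := (evP _).1 (T_le eps0).
pose n := Num.bound (16 * K).
have n16 : 16 * K <= n.+1%:R.
  have h : 0 <= 16 * K by rewrite mulr_ge0// (le_trans ler01).
  by apply: le_trans (ltW (archi_boundP h)) _; rewrite ler_nat.
pose Q : R := n.+1%:R `^ (rho + eps).
have Q1 : 1 <= Q.
  have n1 : 1 <= n.+1%:R :> R by rewrite ler1n.
  by have := ler_powR n1 e1; rewrite powRr0.
have l2 : 0 < ln 2 :> R by rewrite ln_gt0// ltr1n.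
have D0 : 0 <= C * (3 + 2 / ln 2) * Q.
  by rewrite !mulr_ge0 ?powR_ge0// addr_ge0// divr_ge0// ltW.
apply/eqO_exP; exists (C * (3 + 2 / ln 2) * Q + 1); first by rewrite ltr_wpDl.
apply: filterS (filterI (filterI (ev_gt MT) (ev_gt r1)) (filterI ev_basic (ev_gt A))).
move=> r [[MTr r1r] [[[h1 h2 _ _] [h5 _ _ _]] Ar]].
have rp : 0 < r by exact: lt_trans h2.
have [a1 a2 a3 a4] := subadditive_radii_itv rp K1.
have [S [S1 S2 GS]] := Gex a1 a2.
have [V [V1 V2 GV]] := Gex a3 a4.
have [SV rS Sr [LV LS]] := subadditive_radii rp K1 S1 S2 V1.
set P := phi r `^ _.
have P1 : 1 <= P by have := ler_powR (ltW h5) e1; rewrite powRr0.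
have p0 : 0 <= phi r by exact: le_trans ler01 (ltW h5).
have pP u : r <= u -> u <= 16 * K * r -> T u <= Q * P.
  move=> ru us; apply: le_trans (HT u (lt_le_trans MTr ru)) _.
  rewrite -powRM//; have ur : R0 < u by exact: lt_le_trans ru.
  apply: ge0_ler_powR; rewrite ?nnegrE//; [exact: ltW (pp _ ur)|by rewrite mulr_ge0|].
  apply: le_trans (subadditive_mul n sub (ltW Ar) (ltW rp)).
  by apply: pm => //; apply: le_trans us _; rewrite ler_wpM2r// ltW.
have TS : T S <= Q * P by exact: pP.
have TV : T V <= Q * P by apply: pP => //; exact: le_trans rS (ltW SV).
have QP1 : 1 <= Q * P by rewrite -[leLHS]mulr1; apply: ler_pM.
have QP0 := le_trans ler01 QP1.
apply: (@le_trans _ _ (C * (3 + 2 / ln 2) * (Q * P))); last first.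
  rewrite (ger0_norm (powR_ge0 _ _)) -/P [leLHS]mulrA; move: (C * _ * Q) => D.
  rewrite mulrDl lerDl mul1r.
  exact: le_trans ler01 P1.
rewrite (ger0_norm (m0 r)); apply: le_trans (key (ltW r1r) S1 SV GS GV) _.
by apply: subadditive_combine => //; rewrite divr_ge0 ?(ltW rp)// (le_trans (ltW rp) rS).
Qed.
End Growth.

Theorem lemma3p1 (R : realType) (R0 : R) (phi s : R -> R)
    (hphi : admissible_phi R0 phi) (hs : admissible_s R0 s)
    (q qh : R[i]) (hq0 : 0 < Normc.normc q) (hq1 : Normc.normc q < 1)
    (hqh : qh ^+ 2 = q)
    (zeta : R[i]^o -> R[i]^o) (hzeta : joukowski_branch zeta)
    (f : R[i]^o -> R[i]^o) (hf : meromorphic f)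
    (hfin : phi_order phi f \is a fin_num)
    (hDf : ~ meromorphic_eq0 (askey_wilson qh zeta f))
    (eps : R) (heps : 0 < eps) :
  let rho := fine (phi_order phi f) in
  let m := fun r : R => proximity r (fun x => askey_wilson qh zeta f x / f x) in
  (limf_esup (fun r : R => (s r / r)%:E) +oo = +oo%E ->
   convex_function (E := R^o) `]R0, +oo[ s ->
   (forall r, R0 < r -> derivable s r 1) ->
   let A := fun r : R => phi (s r) `^ (rho + eps / 2) / ln (s r / r) + 1 in
   m =O_ (+oo_R) A /\
   A =O_ (+oo_R)
     (fun r : R => phi (s r) `^ (rho - alpha_growth phi s * gamma_growth phi s + eps)))
  /\
  ((limf_esup (fun r : R => (s r / r)%:E) +oo%R < +oo)%E ->
   subadditive_near_oo phi ->
   m =O_ (+oo_R) (fun r : R => phi r `^ (rho + eps))).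
Proof.
move=> rho m.
have Nq : Normc.normc qh ^+ 2 = Normc.normc q by rewrite -hqh NX.
have qh0 : (qh : R[i]^o) != 0.
  by apply: contraTneq hq0 => e; rewrite -Nq e Normc.normc0 expr0n ltxx.
have qh1 : Normc.normc qh != 1.
  by apply: contraTneq hq1 => e; rewrite -Nq e expr1n ltxx.
(* A constant [f] would make the difference quotient vanish identically, against [hDf]. With [c = 0]
   this gives [f] an order at every point. *)
have nonconst c p : ~ nbhs (p^') (fun z => f z = c).
  by move=> h; apply: hDf; apply: (aw_const_eq0 hzeta qh0 (c := c)); exact: mero_const hf h.
have [k [ok _]] := mero_data hf (nonconst 0).
(* The value at a regular point [p] serves as the constant [a] of the lower bound: [f - f p] is not
   identically zero, yet has a zero at [p]. *)
have [p _ [hp _]] := dnbhs_ex (ord_at_good_near (ok 0)).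
have nz w : ~ nbhs (w^') (fun z => f z - f p = 0).
  move=> h; apply: (nonconst (f p) w); apply: dnbhs_sub h => z _ /eqP.
  by rewrite subr_eq0 => /eqP.
have [k' [ok' _]] := mero_data (meromorphic_subcst (f p) hf) nz.
pose G S := generic f S /\ generic (fun z => f z - f p) S.
have Gex a b : 0 < a -> a < b -> exists S, [/\ a <= S, S <= b & G S].
  by move=> a0 ab; have [S [h1 h2 h3 h4]] := generic_between ok ok' a0 ab; exists S.
have [C [r1 [C0 _ est]]] := aw_proximity_estimate hzeta qh0 qh1 ok.
have [C' low] := characteristic_lower ok ok' hp erefl.
have m0 r : 0 <= m r.
  rewrite /m /proximity mulr_ge0 ?invr_ge0 ?twopi_ge0//.
  by apply: Rintegral_ge0 => t _; rewrite /log_plus le_max lexx.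
have key r S V : r1 <= r -> 2 * awK qh * r <= S -> S < V -> G S -> G V ->
    m r <= C * (r / S * (characteristic S f + 1) + (characteristic V f + 1) / ln (V / S) + 1).
  by move=> h1 h2 h3 [gS _] [gV _]; exact: est.
have low' S : Normc.normc p + 1 <= S -> G S -> ln S - C' <= characteristic S f.
  by move=> h [g1 g2]; exact: low.
have hrho : limf_esup (fun r : R => (ln (characteristic r f) / ln (phi r))%:E) +oo = rho%:E.
  by rewrite /rho fineK.
have K1 := awK_ge1 qh.
split=> [hsup hconv _|_ hsub]; first split.
- exact: (growth_convex hphi K1 C0 m0 Gex key low' hrho hs heps hsup hconv).
- exact: (growth_exponent hphi Gex low' hrho hs heps).
- exact: (growth_subadditive hphi K1 C0 m0 Gex key low' hrho hs heps hsub).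
Qed.
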